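(* Let $A$ be a cyclic matrix in $\Omega_n$ such that at least two of the eigenvalues of $A$ are not equal. Then there exists a matrix $B\in \Omega_n$ such that $$l_{\Omega_n}(A,B) > g_{\Omega_n}(A,B).$$
   Context: $\mathbb D$ is the open unit disk in $\mathbb C$. $\mathcal M_n$ is the set of all $n\times n$ complex matrices; $r(A)$ is the spectral radius of $A$. The spectral ball is $\Omega_n=\{A\in\mathcal M_n: r(A)<1\}$, a domain in $\mathcal M_n\cong\mathbb C^{n^2}$. A matrix $A\in\mathcal M_n$ is cyclic (non-derogatory) if it admits a cyclic vector, i.e. there is $v\in\mathbb C^n$ such that $v, Av,\dots,A^{n-1}v$ span $\mathbb C^n$. For a domain $D\subset\mathbb C^m$ and $z,w\in D$, the Lempert function is $$l_D(z,w):=\inf\{|\alpha|:\alpha\in\mathbb D \text{ and } \exists\,\varphi\in\mathcal O(\mathbb D,D):\varphi(0)=z,\ \varphi(\alpha)=w\},$$ where $\mathcal O(\mathbb D,D)$ is the set of holomorphic maps from $\mathbb D$ to $D$. For $(a,z)\in D\times D$, the pluricomplex Green function with pole at $a$, evaluated at $z$, is (in exponential form) $$g_D(a,z):=\sup\{u(z): u:D\to[0,1),\ \log u\in PSH(D),\ \exists\, C=C(u,a)>0,\ \forall w\in D:\ u(w)\le C\|w-a\|\},$$ where $PSH(D)$ is the family of all plurisubharmonic functions on $D$ and $\|\cdot\|$ is the Euclidean norm. *)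

(* Defs.v *)
From HB Require Import structures.
From mathcomp Require Import all_boot all_order all_algebra.
From mathcomp Require Import all_classical all_reals all_analysis.
From mathcomp Require Export complex.

Set Implicit Arguments.
Unset Strict Implicit.
Unset Printing Implicit Defensive.

Import Order.TTheory GRing.Theory Num.Theory numFieldNormedType.Exports.

Local Open Scope classical_set_scope.
Local Open Scope ring_scope.

(* [numFieldNormedType.Exports] covers the abstract number structures only, so
   the topology of the concrete field [R[i]] is copied in the same way from
   [R[i]^o], where it is the one given by the complex modulus. *)
#[export, non_forgetful_inheritance]
HB.instance Definition _ (R : realType) := GRing.ComAlgebra.copy R[i] R[i]^o.
#[export, non_forgetful_inheritance]
HB.instance Definition _ (R : realType) := Vector.copy R[i] R[i]^o.
#[export, non_forgetful_inheritance]
HB.instance Definition _ (R : realType) := NormedModule.copy R[i] R[i]^o.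

Section Defs.
Context {R : realType}.
Local Notation C := R[i].

(* [ComplexField.Normc.normc] is the modulus with values in [R]; the generic norm [`|z|] of
   [z : C] is its image in [C]. *)
Local Notation modulus := (@ComplexField.Normc.normc R).

Definition cyclic_vector n (A : 'M[C]_n) (v : 'cV[C]_n) : Prop :=
  (<<[seq A ^+ k *m v | k : 'I_n]>> = fullv)%VS.

Definition cyclic_mx n (A : 'M[C]_n) : Prop :=
  exists v : 'cV[C]_n, cyclic_vector A v.

Definition spectral_radius n (A : 'M[C]_n) : R :=
  sup [set modulus a | a in [set a : C | eigenvalue A a]].

Definition spectral_ball n : set 'M[C]_n :=
  [set A | spectral_radius A < 1].

Definition euclidean_norm p q (M : 'M[C]_(p, q)) : R :=
  Num.sqrt (\sum_i \sum_j modulus (M i j) ^+ 2).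

Definition unit_disk : set C := [set z | modulus z < 1].

(* Domains of C^m are taken in the space of p x q matrices with p * q = m. Maps
   are total; their values outside the domain are irrelevant. The difference
   quotients in [derivable phi z 1] are over C: this is complex
   differentiability. *)
Definition holomorphic_into p q (U : set C) (D : set 'M[C]_(p, q))
    (phi : C -> 'M[C]_(p, q)) : Prop :=
  (forall z, U z -> D (phi z)) /\
  (forall z, U z -> derivable phi z 1).

(* The infimum is taken in the extended reals, so that the infimum of the empty
   set is [+oo]. *)
Definition lempert p q (D : set 'M[C]_(p, q)) (z w : 'M[C]_(p, q)) : \bar R :=
  ereal_inf [set (modulus alpha)%:E | alpha in
    [set alpha : C | unit_disk alpha /\
      exists phi : C -> 'M[C]_(p, q),
        [/\ holomorphic_into unit_disk D phi, phi 0 = z & phi alpha = w]]].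

(* Functions D -> [-oo, +oo) are total functions into [\bar R] that are [< +oo]
   on D. *)
Definition usc_on (T : topologicalType) (D : set T) (f : T -> \bar R) : Prop :=
  forall x, D x -> forall a : R, (f x < a%:E)%E ->
    \forall y \near within D (nbhs x), (f y < a%:E)%E.

Definition circle_point (c : C) (r t : R) : C :=
  c + r%:C%C * (cos t +i* sin t)%C.

(* The integral makes sense, with value in [-oo, +oo), because f is upper
   semicontinuous, hence bounded above on the circle. The function that is
   identically -oo is regarded as subharmonic. *)
Definition subharmonic_on (U : set C) (f : C -> \bar R) : Prop :=
  [/\ forall z, U z -> (f z < +oo)%E,
      usc_on U f &
      forall (c : C) (r : R), 0 < r ->
        [set z | modulus (z - c) <= r] `<=` U ->
        (f c <= ((2 * pi)^-1)%R%:E *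
          \int[lebesgue_measure]_(t in `[0%R, (2 * pi)%R]) f (circle_point c r t))%E].

Definition psh_on p q (D : set 'M[C]_(p, q)) (f : 'M[C]_(p, q) -> \bar R) :
    Prop :=
  [/\ forall x, D x -> (f x < +oo)%E,
      usc_on D f &
      forall a b : 'M[C]_(p, q),
        subharmonic_on [set l : C | D (a + l *: b)] (fun l => f (a + l *: b))].

(* [lne] is the extended logarithm: it is [-oo] at 0. *)
Definition green_candidate p q (D : set 'M[C]_(p, q)) (a : 'M[C]_(p, q))
    (u : 'M[C]_(p, q) -> R) : Prop :=
  [/\ forall w, D w -> 0 <= u w < 1,
      psh_on D (fun w => lne (u w)%:E) &
      exists2 c : R, 0 < c & forall w, D w -> u w <= c * euclidean_norm (w - a)].

Definition green p q (D : set 'M[C]_(p, q)) (a z : 'M[C]_(p, q)) : \bar R :=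
  ereal_sup [set (u z)%:E | u in green_candidate D a].

End Defs.

Arguments spectral_ball {R} n _.

(* Main.v *)
(** Write [m_c x] for [moebius c x] and take [B = c%:M].

    Lower bound. If [phi 0 = A] and [phi alpha = c%:M], the function
    [tr (m_c (phi z) ^ N)] is bounded by [n] and vanishes to order [N] at [alpha],
    so the maximum principle gives [|sum_j (m_c l_j)^N| <= n |alpha|^(N-1)] for the
    eigenvalues [l_j] of [A]. When a single eigenvalue value [a] maximizes
    [|m_c|], letting [N] tend to infinity yields [al := |m_c a| <= |alpha|].

    Choice of [c]. Let [b] be an eigenvalue of maximal multiplicity and [a] one that
    is farthest from [b] in the pseudohyperbolic distance; the point symmetric to [a]
    with respect to [b] is a center [c] for which [a] is the unique farthest
    eigenvalue, the others satisfying [|m_c x| <= be < al].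

    Upper bound. As [a] occurs at most as often as [b], each [a] can be paired with
    a [b]. In the coordinate [m_c], the pair moves along the two branches of
    [w h(w)], [w ^ 2 = xi], where the Pick function [h] is chosen so that the
    branches end at the pair for some [xi = T] with [be < T < al]; the remaining
    eigenvalues move along [xi (m_c x) / T]. Since [A] is cyclic it is similar to a
    companion matrix, so these motions come from a holomorphic disc in the spectral
    ball through [A] at [T]; at [0] its only eigenvalue is [c]. A Green candidate [u]
    is therefore at most about [T] at that matrix [M], and [u c%:M <= u M] by
    Liouville's theorem on the affine line through both, which lies in the
    spectral ball.

    Since [log u] is only known to be subharmonic on affine lines, the maximum
    principle along a curved disc is proved by doubling the variables. *)

(* The gap comes from branching. A disc that ends at the scalar matrix [c%:M] has [m_c (phi z)]
   vanishing there as a matrix, so all eigenvalues approach [c] at least linearly in [z - alpha];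
   this forces [|alpha| >= al]. A disc that ends at a nonscalar matrix whose only eigenvalue is [c]
   may have eigenvalues branching like a square root, and can be shorter. The Green function is no
   larger at [c%:M] than at that other matrix, so it cannot exceed the length of the shorter disc.
   The number [T = (al + be - 2 al be) / (2 - al - be)] is where the Schwarz-Pick condition for the
   values of [h] at the two square roots of [T] becomes an equality, in the worst case of two
   positive numbers [al] and [be]. It tends to [al] as [be] tends to [al], so pairing [a] with
   another copy of [a] would gain nothing: this is why [a] must be strictly farther from [c] than
   the rest and must not outnumber its partner. *)
Require Import Defs.
From HB Require Import structures.
From mathcomp Require Import all_boot all_order all_algebra.
From mathcomp Require Import all_classical all_reals all_analysis.
From mathcomp Require Import ring lra spectral mxred.

Set Implicit Arguments.
Unset Strict Implicit.
Unset Printing Implicit Defensive.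

Import Order.TTheory GRing.Theory Num.Theory numFieldNormedType.Exports.

Local Open Scope classical_set_scope.
Local Open Scope ring_scope.

(** * Goursat's theorem on rectangles *)

Section IntervalIntegral.
Context {R : realType}.
Implicit Types (f g : R -> R) (a b c : R).

Definition itv_int f a b : R := \int[lebesgue_measure]_(x in `[a, b]) f x.

Lemma itv_integrable f a b : {within `[a, b], continuous f} ->
  (@lebesgue_measure R).-integrable `[a, b] (EFin \o f).
Proof.
by move=> cf; apply: continuous_compact_integrable => //; exact: segment_compact.
Qed.

Lemma itv_int_cat f a b c : a <= b -> b <= c -> {within `[a, c], continuous f} ->
  itv_int f a c = itv_int f a b + itv_int f b c.
Proof.
move=> ab bc cf; apply/eqP; rewrite addrC -subr_eq; apply/eqP.
rewrite /itv_int Rintegral_itvB ?bnd_simp//; last exact: itv_integrable.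
rewrite Rintegral_itv_obnd_cbnd//.
apply: integrableS (itv_integrable cf) => //.
by apply: subset_itvr; rewrite bnd_simp.
Qed.

Lemma itv_intB f g a b : {within `[a, b], continuous f} ->
  {within `[a, b], continuous g} ->
  itv_int (fun x => f x - g x) a b = itv_int f a b - itv_int g a b.
Proof. by move=> cf cg; rewrite /itv_int RintegralB//; exact: itv_integrable. Qed.

Lemma le_itv_int f g a b : {within `[a, b], continuous f} ->
  {within `[a, b], continuous g} -> (forall x, a <= x <= b -> f x <= g x) ->
  itv_int f a b <= itv_int g a b.
Proof.
move=> cf cg fg; apply: le_Rintegral => //; exact: itv_integrable.
Qed.

Lemma itv_int_cst a b r : a <= b -> itv_int (fun=> r) a b = r * (b - a).
Proof.
move=> ab; rewrite /itv_int Rintegral_cst//= lebesgue_measure_itv/= lte_fin.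
case: ltP => [//|ba]; suff -> : b = a by rewrite subrr mulr0.
by apply/eqP; rewrite eq_le ab ba.
Qed.

Lemma itv_int_near_cst f a b k m : a <= b -> {within `[a, b], continuous f} ->
  (forall x, a <= x <= b -> `|f x - k| <= m) ->
  `|itv_int f a b - k * (b - a)| <= m * (b - a).
Proof.
move=> ab cf h.
have cc r : {within `[a, b], continuous (fun=> r : R)}.
  by apply: continuous_subspaceT => x; exact: cvg_cst.
have lo : itv_int (fun=> k - m) a b <= itv_int f a b.
  by apply: le_itv_int => // x /h; rewrite ler_norml; lra.
have hi : itv_int f a b <= itv_int (fun=> k + m) a b.
  by apply: le_itv_int => // x /h; rewrite ler_norml; lra.
move: lo hi; rewrite !itv_int_cst// ler_norml !mulrDl mulNr => ? ?.
by apply/andP; split; lra.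
Qed.

End IntervalIntegral.

Section Green.
Context {R : realType}.
Variables (P Q : R -> R -> R) (a b c d : R).
Hypotheses (ab : a <= b) (cd : c <= d).
Hypothesis cP : forall x, a <= x <= b -> {within `[c, d], continuous (P x)}.
Hypothesis cQ :
  forall y, c <= y <= d -> {within `[a, b], continuous (fun x => Q x y)}.
(** The coefficient [p] is shared: this is differentiability at each point together with the
    equality of the x-derivative of [P] and the y-derivative of [Q]. In polar coordinates it will be
    one of the Cauchy-Riemann equations. *)
Hypothesis PQ : forall x0 y0, a <= x0 <= b -> c <= y0 <= d ->
  exists p q r : R, forall e, 0 < e -> exists2 dl, 0 < dl &
    forall x y, a <= x <= b -> c <= y <= d -> `|x - x0| <= dl -> `|y - y0| <= dl ->
      `|P x y - (P x0 y0 + p * (x - x0) + q * (y - y0))|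
        <= e * (`|x - x0| + `|y - y0|) /\
      `|Q x y - (Q x0 y0 + r * (x - x0) + p * (y - y0))|
        <= e * (`|x - x0| + `|y - y0|).

Let flux x1 x2 y1 y2 :=
  itv_int (fun y => P x2 y - P x1 y) y1 y2 -
  itv_int (fun x => Q x y2 - Q x y1) x1 x2.

Let subP x y1 y2 : a <= x <= b -> c <= y1 -> y2 <= d ->
  {within `[y1, y2], continuous (P x)}.
Proof.
move=> hx h1 h2; apply: continuous_subspaceW (cP hx).
by apply: subset_itv; rewrite bnd_simp.
Qed.

Let subQ y x1 x2 : c <= y <= d -> a <= x1 -> x2 <= b ->
  {within `[x1, x2], continuous (fun x => Q x y)}.
Proof.
move=> hx h1 h2; apply: continuous_subspaceW (cQ hx).
by apply: subset_itv; rewrite bnd_simp.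
Qed.

Let subB (f g : R -> R) (A : set R) : {within A, continuous f} ->
  {within A, continuous g} -> {within A, continuous (fun x => f x - g x)}.
Proof. by move=> cf cg x; apply: cvgB; [exact: cf|exact: cg]. Qed.

Let flux_catx x1 x2 x3 y1 y2 :
  a <= x1 <= x2 -> x2 <= x3 <= b -> c <= y1 <= y2 -> y2 <= d ->
  flux x1 x3 y1 y2 = flux x1 x2 y1 y2 + flux x2 x3 y1 y2.
Proof.
move=> /andP[h1 h2] /andP[h3 h4] /andP[h5 h6] h7; rewrite /flux.
rewrite (@itv_int_cat _ _ x1 x2 x3)//; last first.
  by apply: subB; apply: subQ => //; lra.
by rewrite !itv_intB; first lra; (apply: subP || apply: subQ); lra.
Qed.

Let flux_caty x1 x2 y1 y2 y3 :
  a <= x1 <= x2 -> x2 <= b -> c <= y1 <= y2 -> y2 <= y3 <= d ->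
  flux x1 x2 y1 y3 = flux x1 x2 y1 y2 + flux x1 x2 y2 y3.
Proof.
move=> /andP[h1 h2] h3 /andP[h4 h5] /andP[h6 h7]; rewrite /flux.
rewrite (@itv_int_cat _ _ y1 y2 y3)//; last first.
  by apply: subB; apply: subP => //; lra.
by rewrite !itv_intB; first lra; (apply: subP || apply: subQ); lra.
Qed.

(** The affine parts of [P] and [Q] both contribute [p] times the area and cancel, so only the error
    terms remain. The bound is quadratic in the size of the rectangle, the rate at which bisection
    divides the flux. *)
Let flux_local e x0 y0 x1 x2 y1 y2 p q r dl :
  0 <= e -> a <= x1 -> x1 <= x0 <= x2 -> x2 <= b ->
  c <= y1 -> y1 <= y0 <= y2 -> y2 <= d ->
  (forall x y, a <= x <= b -> c <= y <= d -> `|x - x0| <= dl -> `|y - y0| <= dl ->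
      `|P x y - (P x0 y0 + p * (x - x0) + q * (y - y0))|
        <= e * (`|x - x0| + `|y - y0|) /\
      `|Q x y - (Q x0 y0 + r * (x - x0) + p * (y - y0))|
        <= e * (`|x - x0| + `|y - y0|)) ->
  x2 - x1 <= dl -> y2 - y1 <= dl ->
  `|flux x1 x2 y1 y2| <= 2 * e * ((x2 - x1) + (y2 - y1)) ^+ 2.
Proof.
move=> e0 h1 /andP[h2 h3] h4 h5 /andP[h6 h7] h8 H dx dy.
have near x y : x1 <= x <= x2 -> y1 <= y <= y2 ->
    `|P x y - (P x0 y0 + p * (x - x0) + q * (y - y0))|
      <= e * ((x2 - x1) + (y2 - y1)) /\
    `|Q x y - (Q x0 y0 + r * (x - x0) + p * (y - y0))|
      <= e * ((x2 - x1) + (y2 - y1)).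
  move=> /andP[hx1 hx2] /andP[hy1 hy2].
  have bx : `|x - x0| <= x2 - x1 by rewrite ler_norml; lra.
  have by_ : `|y - y0| <= y2 - y1 by rewrite ler_norml; lra.
  have [||||A B] := H x y; [lra|lra|lra|lra|].
  have le : e * (`|x - x0| + `|y - y0|) <= e * ((x2 - x1) + (y2 - y1)).
    by rewrite ler_wpM2l// lerD.
  by split; [exact: le_trans A le|exact: le_trans B le].
set m := e * _ in near.
have IP : `|itv_int (fun y => P x2 y - P x1 y) y1 y2 -
    p * (x2 - x1) * (y2 - y1)| <= 2 * m * (y2 - y1).
  apply: itv_int_near_cst; [lra|by apply: subB; apply: subP => //; lra|].
  move=> y hy; have [||A _] := near x2 y; [lra|lra|].
  have [||B _] := near x1 y; [lra|lra|].
  move: A B; rewrite !ler_norml; lra.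
have IQ : `|itv_int (fun x => Q x y2 - Q x y1) x1 x2 -
    p * (y2 - y1) * (x2 - x1)| <= 2 * m * (x2 - x1).
  apply: itv_int_near_cst; [lra|by apply: subB; apply: subQ => //; lra|].
  move=> x hx; have [||_ A] := near x y2; [lra|lra|].
  have [||_ B] := near x y1; [lra|lra|].
  move: A B; rewrite !ler_norml; lra.
have -> : 2 * e * ((x2 - x1) + (y2 - y1)) ^+ 2 =
    2 * m * (y2 - y1) + 2 * m * (x2 - x1) by rewrite /m; ring.
move: IP IQ; rewrite /flux.
have -> : p * (y2 - y1) * (x2 - x1) = p * (x2 - x1) * (y2 - y1) by ring.
by rewrite !ler_norml; lra.
Qed.

Let w k := (b - a) / 2 ^+ k.
Let h k := (d - c) / 2 ^+ k.

Let wS k : w k = w k.+1 + w k.+1.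
Proof. by rewrite /w exprS; field; rewrite expf_neq0//; lra. Qed.
Let hS k : h k = h k.+1 + h k.+1.
Proof. by rewrite /h exprS; field; rewrite expf_neq0//; lra. Qed.
Let w0 k : 0 <= w k.
Proof. by rewrite /w divr_ge0 ?subr_ge0 ?exprn_ge0. Qed.
Let h0 k : 0 <= h k.
Proof. by rewrite /h divr_ge0 ?subr_ge0 ?exprn_ge0. Qed.

Let bad (e : R) k (z : R * R) :=
  [/\ a <= z.1, z.1 + w k <= b, c <= z.2, z.2 + h k <= d &
      e / 4 ^+ k <= `|flux z.1 (z.1 + w k) z.2 (z.2 + h k)|].

Let bad_step e k z : bad e k z -> exists z', bad e k.+1 z' /\
  [/\ z.1 <= z'.1, z'.1 + w k.+1 <= z.1 + w k,
      z.2 <= z'.2 & z'.2 + h k.+1 <= z.2 + h k].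
Proof.
case: z => x y [/= h1 h2 h3 h4 h5].
have := w0 k.+1; have := h0 k.+1; have := wS k; have := hS k.
set u := w k.+1; set v := h k.+1 => ev eu v0 u0.
apply: contrapT => /forallNP N.
have B x' y' : (x' = x \/ x' = x + u) -> (y' = y \/ y' = y + v) ->
    `|flux x' (x' + u) y' (y' + v)| < e / 4 ^+ k.+1.
  move=> hx hy; rewrite ltNge; apply/negP => ge; apply: (N (x', y')).
  by clear N; case: hx => hx; case: hy => hy; rewrite ?hx ?hy in ge *;
    split; split => //=; rewrite -?/u -?/v; lra.
have e4 : e / 4 ^+ k = 4 * (e / 4 ^+ k.+1).
  by rewrite exprS; field; rewrite expf_neq0//; lra.
move: h5; rewrite eu ev !addrA.
rewrite (@flux_catx _ (x + u)); [|lra..].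
rewrite (@flux_caty _ _ _ (y + v)); [|lra..].
rewrite (@flux_caty (x + u) _ _ (y + v)); [|lra..].
have := B x y (or_introl erefl) (or_introl erefl).
have := B (x + u) y (or_intror erefl) (or_introl erefl).
have := B x (y + v) (or_introl erefl) (or_intror erefl).
have := B (x + u) (y + v) (or_intror erefl) (or_intror erefl).
rewrite e4 !ltr_norml => ? ? ? ?; rewrite leNgt => /negP; apply.
by rewrite ltr_norml; lra.
Qed.

(* Goursat's bisection argument: the partial derivatives need not be
   continuous. *)
Lemma green_rectangle :
  itv_int (fun y => P b y - P a y) c d = itv_int (fun x => Q x d - Q x c) a b.
Proof.
apply/eqP; rewrite -subr_eq0 -[_ - _]/(flux a b c d); apply: contrapT => /negP.
rewrite -normr_gt0; set e := `|_| => e0.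
have bad0 : bad e 0 (a, c).
  rewrite /bad /w /h !expr0 !divr1/=.
  have -> : a + (b - a) = b by ring.
  by have -> : c + (d - c) = d by ring.
have step k : forall z, exists z', bad e k z -> bad e k.+1 z' /\
    [/\ z.1 <= z'.1, z'.1 + w k.+1 <= z.1 + w k,
        z.2 <= z'.2 & z'.2 + h k.+1 <= z.2 + h k].
  move=> z; case: (pselect (bad e k z)) => [/bad_step[z' hz']|nb].
    by exists z'.
  by exists z.
have [nxt hn] := choice (fun kz : nat * (R * R) => step kz.1 kz.2).
pose fix s (k : nat) : R * R := if k is k'.+1 then nxt (k', s k') else (a, c).
have bs k : bad e k (s k) by elim: k => [//|k ih]; have [] := hn (k, s k) ih.
have mono k m : (s k).1 <= (s (k + m)%N).1 /\ (s (k + m)%N).1 + w (k + m)%N <= (s k).1 + w k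
    /\ (s k).2 <= (s (k + m)%N).2 /\ (s (k + m)%N).2 + h (k + m)%N <= (s k).2 + h k.
  elim: m => [|m [i1 [i2 [i3 i4]]]]; first by rewrite addn0; do !split.
  rewrite addnS /=; have [_ /=[j1 j2 j3 j4]] := hn (_, _) (bs (k + m)%N).
  by split; [lra|split; [lra|split; lra]].
(* [(X, Y)] is the common point of the nested rectangles, at which differentiability is used. *)
pose X := sup [set (s k).1 | k in [set: nat]].
pose Y := sup [set (s k).2 | k in [set: nat]].
have ubX k : ubound [set (s m).1 | m in [set: nat]] ((s k).1 + w k).
  move=> _ [m _ <-]; have [km|mk] := leqP k m.
    have [_ [+ _]] := mono k (m - k)%N.
    by rewrite subnKC//; have := w0 m; lra.
  have [+ _] := mono m (k - m)%N.
  by rewrite subnKC; [have := w0 k; lra|exact: ltnW].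
have ubY k : ubound [set (s m).2 | m in [set: nat]] ((s k).2 + h k).
  move=> _ [m _ <-]; have [km|mk] := leqP k m.
    have [_ [_ [_ +]]] := mono k (m - k)%N.
    by rewrite subnKC//; have := h0 m; lra.
  have [_ [_ [+ _]]] := mono m (k - m)%N.
  by rewrite subnKC; [have := h0 k; lra|exact: ltnW].
have X1 k : (s k).1 <= X by apply: ub_le_sup; [exists ((s 0%N).1 + w 0); exact: ubX|exists k].
have X2 k : X <= (s k).1 + w k by apply: ge_sup; [exists (s 0%N).1, 0%N|exact: ubX].
have Y1 k : (s k).2 <= Y by apply: ub_le_sup; [exists ((s 0%N).2 + h 0); exact: ubY|exists k].
have Y2 k : Y <= (s k).2 + h k by apply: ge_sup; [exists (s 0%N).2, 0%N|exact: ubY].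
have hX : a <= X <= b.
  by have [? ? _ _ _] := bs 0%N; have := X1 0%N; have := X2 0%N; lra.
have hY : c <= Y <= d.
  by have [_ _ ? ? _] := bs 0%N; have := Y1 0%N; have := Y2 0%N; lra.
have [p [q [r H]]] := PQ hX hY.
(* The summand 1 keeps [S] positive for degenerate rectangles. With tolerance [e / (4 * S ^+ 2)],
   [flux_local] bounds the flux of the [k]-th rectangle by half of [e / 4 ^+ k]. *)
pose S := (b - a) + (d - c) + 1.
have S0 : 0 < S by rewrite /S; lra.
have e'0 : 0 < e / (4 * S ^+ 2) by rewrite divr_gt0// mulr_gt0 ?exprn_gt0.
have [dl dl0 Hdl] := H _ e'0.
have [k hk] : exists k : nat, S / 2 ^+ k <= dl.
  exists (Num.bound (S / dl)); rewrite ler_pdivrMr ?exprn_gt0// mulrC -ler_pdivrMr//.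
  apply: ltW; apply: lt_le_trans (_ : (Num.bound (S / dl))%:R <= _).
    by apply: archi_boundP; rewrite divr_ge0 ?ltW.
  by rewrite -natrX ler_nat ltnW// ltn_expl.
have [b1 b2 b3 b4 b5] := bs k.
have p2 : 0 < (2 : R) ^+ k by rewrite exprn_gt0.
have wk : w k <= dl by apply: le_trans hk; rewrite ler_pM2r ?invr_gt0// /S; lra.
have hk' : h k <= dl by apply: le_trans hk; rewrite ler_pM2r ?invr_gt0// /S; lra.
have := @flux_local _ X Y _ ((s k).1 + w k) _ ((s k).2 + h k) p q r dl (ltW e'0) b1 _ b2 b3 _ b4 Hdl.
have -> : (s k).1 + w k - (s k).1 = w k by ring.
have -> : (s k).2 + h k - (s k).2 = h k by ring.
rewrite X1 X2 Y1 Y2 => /(_ erefl erefl wk hk') F.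
have := le_trans b5 F.
have -> : w k + h k = ((b - a) + (d - c)) / 2 ^+ k by rewrite /w /h; field; lra.
rewrite expr_div_n -exprM mulnC exprM (_ : 2 ^+ 2 = 4 :> R); last by ring.
rewrite mulrA ler_pM2r ?invr_gt0 ?exprn_gt0//.
have -> : 2 * (e / (4 * S ^+ 2)) * (b - a + (d - c)) ^+ 2 =
   e * ((b - a + (d - c)) ^+ 2 / S ^+ 2 / 2) by field; lra.
rewrite ler_pMr//; apply/negP; rewrite -ltNge.
rewrite ltr_pdivrMr// mul1r; apply: le_lt_trans (_ : 1 < 2); last by lra.
rewrite ler_pdivrMr ?exprn_gt0// mul1r ler_sqr ?nnegrE /S; lra.
Qed.

End Green.

(** * The complex modulus *)

Section ComplexModulus.
Context {R : realType}.
Local Notation C := R[i].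
Local Notation modulus := (@ComplexField.Normc.normc R).
Implicit Types (x y z : C).
Import ComplexField.Normc.

Lemma modulus_ge0 z : 0 <= modulus z.
Proof. by case: z => a b; exact: sqrtr_ge0. Qed.

Lemma modulus_eq0 z : (modulus z == 0) = (z == 0).
Proof. by apply/eqP/eqP => [/eq0_normc|->]; rewrite ?normc0. Qed.

Lemma modulus_gt0 z : (0 < modulus z) = (z != 0).
Proof. by rewrite lt_def modulus_ge0 andbT modulus_eq0. Qed.

Lemma normE z : `|z| = (modulus z)%:C%C.
Proof. by case: z. Qed.

Lemma modulusN z : modulus (- z) = modulus z.
Proof. exact: normcN. Qed.

Lemma modulusB x y : modulus (x - y) = modulus (y - x).
Proof. by rewrite -modulusN opprB. Qed.

Lemma modulus_leD x y : modulus (x + y) <= modulus x + modulus y.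
Proof. exact: le_normcD. Qed.

Lemma modulus_leB x y : modulus (x - y) <= modulus x + modulus y.
Proof. by rewrite -(modulusN y); exact: modulus_leD. Qed.

Lemma modulus_lerB x y : modulus x - modulus y <= modulus (x - y).
Proof. by rewrite lerBlDr -{1}(subrK y x) modulus_leD. Qed.

Lemma modulus_lerD x y : modulus x - modulus y <= modulus (x + y).
Proof. by rewrite -(modulusN y) -{2}(opprK y) modulus_lerB. Qed.

Lemma modulusX z n : modulus (z ^+ n) = modulus z ^+ n.
Proof. by elim: n => [|n ih]; rewrite ?expr0 ?normc1// !exprS normcM ih. Qed.

Lemma modulus_div x y : modulus (x / y) = modulus x / modulus y.
Proof. by rewrite normcM normcV. Qed.

Lemma modulus_sqr z : modulus z ^+ 2 = complex.Re z ^+ 2 + complex.Im z ^+ 2.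
Proof. by case: z => a b /=; rewrite sqr_sqrtr// addr_ge0 ?sqr_ge0. Qed.

Lemma modulus_real (r : R) : modulus r%:C%C = `|r|.
Proof. by rewrite /= expr0n/= addr0 sqrtr_sqr. Qed.

Lemma modulus_conj z : modulus z^*%C = modulus z.
Proof. by case: z => a b /=; rewrite sqrrN. Qed.

Lemma normr_Re z : `|complex.Re z| <= modulus z.
Proof.
by rewrite -ler_sqr ?nnegrE ?modulus_ge0 ?normr_ge0// real_normK ?num_real//
  modulus_sqr lerDl sqr_ge0.
Qed.

Lemma normr_Im z : `|complex.Im z| <= modulus z.
Proof.
by rewrite -ler_sqr ?nnegrE ?modulus_ge0 ?normr_ge0// real_normK ?num_real//
  modulus_sqr lerDr sqr_ge0.
Qed.

Lemma modulus_le_ReIm z : modulus z <= `|complex.Re z| + `|complex.Im z|.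
Proof.
rewrite -ler_sqr ?nnegrE ?modulus_ge0 ?addr_ge0 ?normr_ge0// modulus_sqr.
rewrite -(real_normK (num_real (complex.Re z))) -(real_normK (num_real (complex.Im z))).
by rewrite sqrrD -addrA (addrC (_ *+ 2)) addrA lerDl mulrn_wge0 ?mulr_ge0 ?normr_ge0.
Qed.

Lemma Re_add x y : complex.Re (x + y) = complex.Re x + complex.Re y.
Proof. by case: x; case: y. Qed.
Lemma Im_add x y : complex.Im (x + y) = complex.Im x + complex.Im y.
Proof. by case: x; case: y. Qed.
Lemma Re_opp x : complex.Re (- x) = - complex.Re x.
Proof. by case: x. Qed.
Lemma Im_opp x : complex.Im (- x) = - complex.Im x.
Proof. by case: x. Qed.
Lemma Re_mul x y : complex.Re (x * y) =
  complex.Re x * complex.Re y - complex.Im x * complex.Im y.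
Proof. by case: x; case: y. Qed.
Lemma Im_mul x y : complex.Im (x * y) =
  complex.Re x * complex.Im y + complex.Im x * complex.Re y.
Proof. by case: x; case: y. Qed.

Lemma gt0_complex (e : C) : 0 < e -> 0 < complex.Re e /\ e = (complex.Re e)%:C%C.
Proof. by case: e => a b; rewrite ltcE /= => /andP[/eqP -> ->]. Qed.

Lemma nbhs_complexP (P : set C) z : nbhs z P <->
  exists2 e : R, 0 < e & forall w, modulus (w - z) < e -> P w.
Proof.
split.
  move=> /nbhs_ballP[e /= /gt0_complex[re0 ee] H].
  exists (complex.Re e) => // w hw; apply: H; rewrite -ball_normE/=.
  by rewrite normE ee ltcR modulusB.
case=> e e0 H; apply/nbhs_ballP; exists e%:C%C; first by rewrite /= ltcR.
by move=> w; rewrite -ball_normE/= normE ltcR modulusB; exact: H.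
Qed.

Lemma nbhs_mxP p q (P : set 'M[C]_(p, q)) (M : 'M[C]_(p, q)) : nbhs M P <->
  exists2 e : R, 0 < e &
    forall N : 'M[C]_(p, q), (forall i j, modulus (N i j - M i j) < e) -> P N.
Proof.
split.
  move=> /nbhs_ballP[e /= /gt0_complex[re0 ee] H].
  exists (complex.Re e) => // N hN; apply: H; split => [|i j]; first by rewrite /= ee ltcR.
  by rewrite -ball_normE/= normE ee ltcR modulusB.
case=> e e0 H; apply/nbhs_ballP; exists e%:C%C; first by rewrite /= ltcR.
move=> N [_ hN]; apply: H => i j; move: (hN i j).
by rewrite -ball_normE/= normE ltcR modulusB.
Qed.

Lemma continuous_modulus : continuous modulus.
Proof.
move=> z A /nbhs_ballP[e /= e0 H]; apply/nbhs_complexP; exists e => // w hw.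
apply: H; rewrite -ball_normE/=; apply: le_lt_trans hw; rewrite ler_norml.
have := modulus_lerB w z; have := modulus_lerB z w; rewrite (modulusB z w); lra.
Qed.

End ComplexModulus.

(** * Compactness and attained maxima *)

Section Compactness.
Context {R : realType}.
Local Notation C := R[i].
Local Notation modulus := (@ComplexField.Normc.normc R).

(** Without a maximum, each point of [K] has a neighbourhood where [f] stays below some value [f y].
    Compactness along the filter [F] of upper level sets then makes some value of [f] exceed every
    value on [K], its own included. *)
Lemma usc_attains_max (T : topologicalType) (K : set T) (f : T -> R) :
  compact K -> K !=set0 ->
  (forall x, K x -> forall a, f x < a -> \forall y \near x, K y -> f y < a) ->
  exists2 x, K x & forall y, K y -> f y <= f x.
Proof.
move=> /compact_near_coveringP/near_covering_withinP cK [x0 Kx0] usc.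
apply: contrapT => /forall2NP N.
have {}N x : K x -> exists2 y, K y & f x < f y.
  move=> Kx; apply: contrapT => /forall2NP M; have [//|] := N x; apply=> y Ky.
  by have [//|/negP] := M y; rewrite -leNgt.
pose F := filter_from K (fun y => [set i | K i /\ f y <= f i]).
have FF : Filter F.
  apply: filter_from_filter; first by exists x0.
  move=> y z Ky Kz; have [yz|/ltW zy] := leP (f y) (f z).
    by exists z => // i [Ki zi]; split; split => //; exact: le_trans zi.
  by exists y => // i [Ki zi]; split; split => //; exact: le_trans zi.
have [x Kx|y Ky] := cK T F (fun i x => f x < f i) FF.
  have [y Ky xy] := N x Kx; exists ([set x' | K x' -> f x' < f y], [set i | K i /\ f y <= f i]).
    by split; [exact: usc|exists y].
  by move=> [x' i] [/= hx' [_ yi]] /hx' h; exact: lt_le_trans yi.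
by move=> /(_ y (conj Ky (lexx _)) y Ky); rewrite /= ltxx.
Qed.

Lemma compact_disk (r : R) : compact [set z : C | modulus z <= r].
Proof.
have cl : closed [set z : C | modulus z <= r].
  apply: (@preimage_closed C R modulus [set x | x <= r]); last exact: closed_le.
  by move=> z _; exact: continuous_modulus.
apply: (subclosed_compact cl) (_ : compact ((fun x : R * R => (x.1 +i* x.2)%C) @`
   (`[- r, r] `*` `[- r, r]))) _.
  apply: continuous_compact; last by apply: compact_setX; exact: segment_compact.
  apply: continuous_subspaceT => -[x y] A /nbhs_complexP[e e0 H].
  have e20 : 0 < e / 2 by rewrite divr_gt0.
  exists (ball x (e / 2), ball y (e / 2)).
    by split; exact: nbhsx_ballx.
  move=> [x' y'] [/= hx hy]; apply: H; move: hx hy; rewrite -!ball_normE/= => hx hy.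
  apply: (le_lt_trans (modulus_le_ReIm ((x' - x) +i* (y' - y))%C)) => /=.
  by rewrite (distrC x') (distrC y'); lra.
move=> z /= hz; exists (complex.Re z, complex.Im z); last by case: z hz.
have := normr_Re z; have := normr_Im z; rewrite !ler_norml /= !in_itv/=; lra.
Qed.

Lemma compact_mx_ball p q (r : R) :
  compact [set M : 'M[C]_(p, q) | forall i j, modulus (M i j) <= r].
Proof.
have := @rV_compact C (p * q) (fun _ => [set z : C | modulus z <= r])
  (fun _ => @compact_disk r).
set K := [set v | _] => cK.
rewrite (_ : [set M | _] = (vec_mx : 'rV[C]_(p * q) -> 'M[C]_(p, q)) @` K).
  apply: continuous_compact cK; apply: continuous_subspaceT => v A.
  move=> /nbhs_mxP[e e0 H]; apply/nbhs_mxP; exists e => // w hw; apply: H => i j.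
  by rewrite !mxE; exact: hw.
rewrite eqEsubset; split => [M hM|_ [v hv <-] i j]; last by rewrite mxE; exact: hv.
exists (mxvec M); last exact: mxvecK.
by move=> k /=; case/mxvec_indexP: k => i j; rewrite mxvecE; exact: hM.
Qed.

End Compactness.

(** * Mean values and the maximum modulus principle *)

Section TrigonometricIntegral.
Context {R : realType}.
Variables (k a1 b1 a2 b2 : R).

(** The terms with [a2] and [b2] are those in [cos (2 t)] and [sin (2 t)], expanded: this is the
    restriction to a circle of a harmonic polynomial of degree two, and only [k] survives
    integration over a period. *)
Definition trig_poly (t : R) : R := k + a1 * cos t + b1 * sin t +
  a2 * (cos t ^+ 2 - sin t ^+ 2) + b2 * (2 * (cos t * sin t)).

Let F : R -> R := k *: id + a1 *: (@sin R) - b1 *: (@cos R) +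
  a2 *: (@sin R * @cos R) + b2 *: (@sin R * @sin R).

Let dF (t : R) : is_derive t 1 F (trig_poly t).
Proof.
have ds := is_derive_sin t; have dc := is_derive_cos t.
have h := is_deriveD (is_deriveD (is_deriveB (is_deriveD
  (is_deriveZ k (is_derive_id t 1)) (is_deriveZ a1 ds)) (is_deriveZ b1 dc))
  (is_deriveZ a2 (is_deriveM ds dc))) (is_deriveZ b2 (is_deriveM ds ds)).
case: h => dF eF; apply: DeriveDef; first exact: dF.
rewrite eF /trig_poly /GRing.scale/=; ring.
Qed.

Lemma continuous_trig_poly : continuous trig_poly.
Proof.
move=> t; pose G : R -> R := cst k + a1 *: (@cos R) + b1 *: (@sin R) +
  a2 *: (@cos R * @cos R - @sin R * @sin R) + (b2 * 2) *: (@cos R * @sin R).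
have -> : trig_poly = G.
  by apply/funext => x; rewrite /trig_poly /G !fctE /GRing.scale/=; ring.
have ds := is_derive_sin t; have dc := is_derive_cos t.
have [dG _] := is_deriveD (is_deriveD (is_deriveD (is_deriveD
  (is_derive_cst k t 1) (is_deriveZ a1 dc)) (is_deriveZ b1 ds))
  (is_deriveZ a2 (is_deriveB (is_deriveM dc dc) (is_deriveM ds ds))))
  (is_deriveZ (b2 * 2) (is_deriveM dc ds)).
by apply/differentiable_continuous/derivable1_diffP; exact: dG.
Qed.

Lemma trig_integral : itv_int trig_poly 0 (2 * pi) = k * (2 * pi).
Proof.
have p0 : 0 < 2 * pi :> R by rewrite mulr_gt0 ?pi_gt0.
have dr t : derivable F t 1 by have [] := dF t.
have ct t : {for t, continuous F}.
  by apply/differentiable_continuous/derivable1_diffP.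
rewrite /itv_int /Rintegral (@continuous_FTC2 _ trig_poly F)//=.
- by rewrite /F /= !fctE /GRing.scale/= cos0 sin0 mulr_natl cos2pi sin2pi; ring.
- by apply: continuous_subspaceT => t; exact: continuous_trig_poly.
- split; first by move=> t _; exact: dr.
  + by apply: cvg_at_right_filter; exact: ct.
  + by apply: cvg_at_left_filter; exact: ct.
- by move=> t _; rewrite derive1E; have [_ ->] := dF t.
Qed.

End TrigonometricIntegral.

(** * Complex differentiability and total differentials *)

Section ComplexDifferentiability.
Context {R : realType}.
Local Notation C := R[i].
Local Notation modulus := (@ComplexField.Normc.normc R).

Definition complex_diff (f : C -> C) (z : C) := exists c : C,
  forall e : R, 0 < e -> exists2 d : R, 0 < d & forall w, modulus w <= d ->
    modulus (f (z + w) - f z - c * w) <= e * modulus w.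

Lemma derivable_complex_diff (f : C -> C) (z : C) :
  derivable f z 1 -> complex_diff f z.
Proof.
move=> /cvg_ex[/= c hc]; exists c => e e0.
have /hc : nbhs c [set w | modulus (w - c) < e].
  by apply/nbhs_complexP; exists e.
move=> /nbhs_complexP[d d0 H]; exists (d / 2); first by rewrite divr_gt0.
move=> w hw; have [->|w0] := eqVneq w 0.
  by rewrite !addr0 subrr mulr0 subr0 ComplexField.Normc.normc0 mulr0.
have /H/(_ w0)/= : modulus (w - 0) < d by rewrite subr0; lra.
rewrite /GRing.scale/= mulr1 => h.
have -> : f (z + w) - f z - c * w = (w^-1 * (f (w + z) - f z) - c) * w.
  by rewrite mulrBl mulrAC mulVf// mul1r (addrC z).
by rewrite ComplexField.Normc.normcM ler_wpM2r ?modulus_ge0// ltW.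
Qed.

Lemma complex_diff_lipschitz (f : C -> C) (z : C) : complex_diff f z ->
  exists2 k : R, 0 < k & exists2 d : R, 0 < d &
    forall w, modulus w <= d -> modulus (f (z + w) - f z) <= k * modulus w.
Proof.
move=> [c H]; have [d d0 Hd] := H 1 ltr01.
exists (modulus c + 1); first by rewrite ltr_wpDl ?modulus_ge0.
exists d => // w /Hd h; rewrite -(subrK (c * w) (f (z + w) - f z)).
apply: (le_trans (modulus_leD _ _)).
by rewrite ComplexField.Normc.normcM mulrDl addrC lerD2l.
Qed.

Lemma complex_diff_continuous (f : C -> C) (z : C) :
  complex_diff f z -> {for z, continuous f}.
Proof.
move=> /complex_diff_lipschitz[k k0 [d d0 H]] A /nbhs_complexP[e e0 HA].
apply/nbhs_complexP; exists (Num.min d (e / k)).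
  by rewrite lt_min d0 divr_gt0.
move=> w; rewrite lt_min => /andP[h1 h2]; apply: HA.
rewrite -[w](subrK z) (addrC _ z) (le_lt_trans (H _ (ltW h1)))//.
by rewrite mulrC -ltr_pdivlMr.
Qed.

End ComplexDifferentiability.

Section TotalDifferential.
Context {R : realType}.
Implicit Types (f g : R -> R -> R).

Definition total_diff f (x0 y0 p q : R) := forall e, 0 < e ->
  exists2 d, 0 < d & forall x y, `|x - x0| <= d -> `|y - y0| <= d ->
    `|f x y - (f x0 y0 + p * (x - x0) + q * (y - y0))|
      <= e * (`|x - x0| + `|y - y0|).

Lemma total_diff_cst r x0 y0 : total_diff (fun _ _ => r) x0 y0 0 0.
Proof.
move=> e e0; exists 1 => // x y _ _.
by rewrite !mul0r !addr0 subrr normr0; apply: mulr_ge0; [exact: ltW|exact: addr_ge0].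
Qed.

Lemma total_diffD f g x0 y0 p q r s : total_diff f x0 y0 p q ->
  total_diff g x0 y0 r s ->
  total_diff (fun x y => f x y + g x y) x0 y0 (p + r) (q + s).
Proof.
move=> hf hg e e0; have e20 : 0 < e / 2 by rewrite divr_gt0.
have [d1 d10 H1] := hf _ e20; have [d2 d20 H2] := hg _ e20.
exists (Num.min d1 d2); first by rewrite lt_min d10.
move=> x y; rewrite !le_min => /andP[x1 x2] /andP[y1 y2].
have := H1 x y x1 y1; have := H2 x y x2 y2.
set u := `|x - x0| + _; have -> : e * u = e / 2 * u + e / 2 * u by field.
by rewrite !ler_norml; lra.
Qed.

Lemma total_diff_bound f x0 y0 p q : total_diff f x0 y0 p q ->
  exists2 d, 0 < d & forall x y, `|x - x0| <= d -> `|y - y0| <= d ->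
    `|f x y - f x0 y0| <= (`|p| + `|q| + 1) * (`|x - x0| + `|y - y0|).
Proof.
move=> h; have [d d0 H] := h 1 ltr01; exists d => // x y hx hy.
rewrite -(subrK (p * (x - x0) + q * (y - y0)) (f x y - f x0 y0)).
apply: (le_trans (ler_normD _ _)).
have -> : f x y - f x0 y0 - (p * (x - x0) + q * (y - y0)) =
  f x y - (f x0 y0 + p * (x - x0) + q * (y - y0)) by ring.
have := H x y hx hy; rewrite mul1r => h1.
have h2 : `|p * (x - x0) + q * (y - y0)| <= `|p| * `|x - x0| + `|q| * `|y - y0|.
  by apply: (le_trans (ler_normD _ _)); rewrite !normrM.
apply: (le_trans (lerD h1 h2)).
have : 0 <= `|p| * `|y - y0| by rewrite mulr_ge0.
have : 0 <= `|q| * `|x - x0| by rewrite mulr_ge0.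
nra.
Qed.

Lemma total_diffM f g x0 y0 p q r s : total_diff f x0 y0 p q ->
  total_diff g x0 y0 r s ->
  total_diff (fun x y => f x y * g x y) x0 y0
    (p * g x0 y0 + f x0 y0 * r) (q * g x0 y0 + f x0 y0 * s).
Proof.
move=> hf hg e e0.
have [d1 d10 H1] := total_diff_bound hf; have [d2 d20 H2] := total_diff_bound hg.
set A := `|p| + _ + 1 in H1; set B := `|r| + _ + 1 in H2.
have A0 : 0 < A by rewrite ltr_wpDl ?addr_ge0.
have B0 : 0 < B by rewrite ltr_wpDl ?addr_ge0.
pose m := `|f x0 y0| + `|g x0 y0| + 1.
have m0 : 0 < m by rewrite ltr_wpDl ?addr_ge0.
have e30 : 0 < e / (3 * m) by rewrite divr_gt0 ?mulr_gt0.
have [d3 d30 H3] := hf _ e30; have [d4 d40 H4] := hg _ e30.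
pose d5 := e / (6 * (A * B)).
have d50 : 0 < d5 by rewrite divr_gt0 ?mulr_gt0.
exists (Num.min (Num.min d1 d2) (Num.min (Num.min d3 d4) d5)).
  by rewrite !lt_min d10 d20 d30 d40 d50.
move=> x y; rewrite !le_min => /andP[/andP[x1 x2] /andP[/andP[x3 x4] x5]].
move=> /andP[/andP[y1 y2] /andP[/andP[y3 y4] y5]].
have := H1 x y x1 y1; have := H2 x y x2 y2.
have := H3 x y x3 y3; have := H4 x y x4 y4.
set u := `|x - x0| + _.
set lf := f x y - (_ + _ + _); set lg := g x y - (_ + _ + _).
move=> hlg hlf hdg hdf.
have u0 : 0 <= u by rewrite addr_ge0.
have -> : f x y * g x y - (f x0 y0 * g x0 y0 + (p * g x0 y0 + f x0 y0 * r) * (x - x0)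
    + (q * g x0 y0 + f x0 y0 * s) * (y - y0)) =
  f x0 y0 * lg + g x0 y0 * lf + (f x y - f x0 y0) * (g x y - g x0 y0).
  by rewrite /lf /lg; ring.
have t1 : `|f x0 y0 * lg| <= m * (e / (3 * m) * u).
  by rewrite normrM ler_pM// /m -addrA lerDl addr_ge0.
have t2 : `|g x0 y0 * lf| <= m * (e / (3 * m) * u).
  by rewrite normrM ler_pM// /m (addrC `|f _ _|) -addrA lerDl addr_ge0.
have t3 : `|(f x y - f x0 y0) * (g x y - g x0 y0)| <= (A * u) * (B * u).
  by rewrite normrM ler_pM.
have t4 : (A * u) * (B * u) <= e / 3 * u.
  have -> : (A * u) * (B * u) = (A * B * u) * u by ring.
  rewrite ler_wpM2r//.
  have uu : u <= d5 + d5 by rewrite lerD.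
  have : A * B * u <= A * B * (d5 + d5) by rewrite ler_wpM2l// ltW ?mulr_gt0.
  suff -> : A * B * (d5 + d5) = e / 3 by [].
  by rewrite /d5; field; rewrite ?mulf_neq0 ?gt_eqF.
have em : m * (e / (3 * m) * u) = e / 3 * u by field; rewrite gt_eqF.
rewrite em in t1 t2.
have -> : e * u = e / 3 * u + e / 3 * u + e / 3 * u by field.
apply: (le_trans (ler_normD _ _)); apply: lerD; last exact: le_trans t3 t4.
by apply: (le_trans (ler_normD _ _)); apply: lerD.
Qed.

Lemma derive_peano (h : R -> R) (x0 p : R) : is_derive x0 1 h p ->
  forall e, 0 < e -> exists2 d, 0 < d & forall x, `|x - x0| <= d ->
    `|h x - (h x0 + p * (x - x0))| <= e * `|x - x0|.
Proof.
move=> [dh <-] e e0; have := dh; rewrite /derivable => /cvgrPdist_le/(_ e e0).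
rewrite -/(derive h x0 1).
move=> /nbhs_ballP[d /= d0 H]; exists (d / 2); first by rewrite divr_gt0.
move=> x hx; have [->|xx0] := eqVneq x x0.
  by rewrite subrr mulr0 addr0 subrr normr0 mulr0.
have t0 : x - x0 != 0 by rewrite subr_eq0.
have := H (x - x0); rewrite -ball_normE/= sub0r normrN.
have dx : `|x - x0| < d by lra.
move=> /(_ dx t0); rewrite /GRing.scale/= mulr1 subrK => h1.
have -> : h x - (h x0 + 'D_1 h x0 * (x - x0)) =
  - ('D_1 h x0 - (x - x0)^-1 * (h x - h x0)) * (x - x0) by field.
by rewrite normrM normrN ler_wpM2r.
Qed.

Lemma total_diff_fst (h : R -> R) (x0 y0 p : R) : is_derive x0 1 h p ->
  total_diff (fun x _ => h x) x0 y0 p 0.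
Proof.
move=> /derive_peano H e e0; have [d d0 Hd] := H _ e0; exists d => // x y hx hy.
rewrite mul0r addr0 (le_trans (Hd x hx))// ler_wpM2l ?lerDl// ltW//.
Qed.

Lemma total_diff_snd (h : R -> R) (x0 y0 p : R) : is_derive y0 1 h p ->
  total_diff (fun _ y => h y) x0 y0 0 p.
Proof.
move=> /derive_peano H e e0; have [d d0 Hd] := H _ e0; exists d => // x y hx hy.
rewrite mul0r addr0 (le_trans (Hd y hy))// ler_wpM2l ?lerDr// ltW//.
Qed.

Lemma total_diff_continuous_fst f x0 y0 p q : total_diff f x0 y0 p q ->
  {for x0, continuous (fun x => f x y0)}.
Proof.
move=> /total_diff_bound[d d0 H] A /nbhs_ballP[e /= e0 HA]; apply/nbhs_ballP.
set k := `|p| + `|q| + 1 in H; have k0 : 0 < k by rewrite ltr_wpDl ?addr_ge0.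
exists (Num.min d (e / k)); first by rewrite /= lt_min d0 divr_gt0.
move=> x; rewrite -ball_normE/= lt_min => /andP[h1 h2].
apply: HA; rewrite -ball_normE/= distrC.
have := H x y0; rewrite subrr normr0 addr0 => h.
apply: le_lt_trans (h _ (ltW d0)) _; first by rewrite distrC ltW.
by rewrite mulrC -ltr_pdivlMr// distrC.
Qed.

Lemma total_diff_continuous_snd f x0 y0 p q : total_diff f x0 y0 p q ->
  {for y0, continuous (fun y => f x0 y)}.
Proof.
move=> /total_diff_bound[d d0 H] A /nbhs_ballP[e /= e0 HA]; apply/nbhs_ballP.
set k := `|p| + `|q| + 1 in H; have k0 : 0 < k by rewrite ltr_wpDl ?addr_ge0.
exists (Num.min d (e / k)); first by rewrite /= lt_min d0 divr_gt0.
move=> y; rewrite -ball_normE/= lt_min => /andP[h1 h2].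
apply: HA; rewrite -ball_normE/= distrC.
have := H x0 y; rewrite subrr normr0 add0r => h.
apply: le_lt_trans (h (ltW d0) _) _; first by rewrite distrC ltW.
by rewrite mulrC -ltr_pdivlMr// distrC.
Qed.

End TotalDifferential.

Section MeanValue.
Context {R : realType}.
Local Notation C := R[i].
Local Notation modulus := (@ComplexField.Normc.normc R).

(** The same [c], the derivative of [f], governs both partial derivatives. Comparing real and
    imaginary parts gives the Cauchy-Riemann equations in whatever real coordinates [U] and [V] are
    written; polar ones will be used. *)
Lemma complex_chain (f : C -> C) (U V : R -> R -> R) x0 y0 ux uy vx vy :
  total_diff U x0 y0 ux uy -> total_diff V x0 y0 vx vy ->
  complex_diff f (U x0 y0 +i* V x0 y0)%C -> exists c : C,
  total_diff (fun x y => complex.Re (f (U x y +i* V x y)%C)) x0 y0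
    (complex.Re (c * (ux +i* vx)%C)) (complex.Re (c * (uy +i* vy)%C)) /\
  total_diff (fun x y => complex.Im (f (U x y +i* V x y)%C)) x0 y0
    (complex.Im (c * (ux +i* vx)%C)) (complex.Im (c * (uy +i* vy)%C)).
Proof.
move=> hU hV [c hf]; exists c.
pose w x y : C := (U x y +i* V x y)%C.
pose lin x y : C := (x - x0)%:C%C * (ux +i* vx)%C + (y - y0)%:C%C * (uy +i* vy)%C.
suff H e : 0 < e -> exists2 d, 0 < d & forall x y, `|x - x0| <= d ->
    `|y - y0| <= d -> modulus (f (w x y) - f (w x0 y0) - c * lin x y)
      <= e * (`|x - x0| + `|y - y0|).
  split=> e /H[d d0 Hd]; exists d => // x y hx hy; apply: le_trans (Hd x y hx hy).
    apply: le_trans (normr_Re _); rewrite le_eqVlt; apply/orP; left; apply/eqP.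
    congr (`| _ |); rewrite /w /lin !(Re_add, Re_opp, Re_mul, Im_add, Im_mul, Im_opp)/=; ring.
  apply: le_trans (normr_Im _); rewrite le_eqVlt; apply/orP; left; apply/eqP.
  congr (`| _ |); rewrite /w /lin !(Re_add, Re_opp, Re_mul, Im_add, Im_mul, Im_opp)/=; ring.
move=> e0.
have [dU dU0 bU] := total_diff_bound hU; have [dV dV0 bV] := total_diff_bound hV.
set A := `|ux| + _ + 1 in bU; set B := `|vx| + _ + 1 in bV.
have A0 : 0 < A by rewrite ltr_wpDl ?addr_ge0.
have B0 : 0 < B by rewrite ltr_wpDl ?addr_ge0.
have AB0 : 0 < A + B by exact: addr_gt0.
have e1 : 0 < e / (2 * (A + B)) by rewrite divr_gt0// mulr_gt0.
have [df df0 Hf] := hf _ e1.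
have c0 : 0 < modulus c + 1 by rewrite ltr_wpDl ?modulus_ge0.
have e2 : 0 < e / (4 * (modulus c + 1)) by rewrite divr_gt0// mulr_gt0.
have [d1 d10 H1] := hU _ e2; have [d2 d20 H2] := hV _ e2.
pose d3 := df / (2 * (A + B)).
have d30 : 0 < d3 by rewrite divr_gt0// mulr_gt0.
exists (Num.min (Num.min dU dV) (Num.min (Num.min d1 d2) d3)).
  by rewrite !lt_min dU0 dV0 d10 d20 d30.
move=> x y; rewrite !le_min => /andP[/andP[x1 x2] /andP[/andP[x3 x4] x5]].
move=> /andP[/andP[y1 y2] /andP[/andP[y3 y4] y5]].
have := bU x y x1 y1; have := bV x y x2 y2.
have := H1 x y x3 y3; have := H2 x y x4 y4.
set u := `|x - x0| + _ => hV' hU' hdV hdU.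
have u0 : 0 <= u by rewrite addr_ge0.
have dw : modulus (w x y - w x0 y0) <= (A + B) * u.
  apply: (le_trans (modulus_le_ReIm _)).
  by rewrite Re_add Re_opp Im_add Im_opp/= mulrDl lerD.
have dwl : modulus (w x y - w x0 y0 - lin x y) <= 2 * (e / (4 * (modulus c + 1)) * u).
  apply: (le_trans (modulus_le_ReIm _)); rewrite mulr_natl mulr2n; apply: lerD.
    apply: le_trans hU'; rewrite le_eqVlt; apply/orP; left; apply/eqP.
    congr (`| _ |); rewrite /w /lin !(Re_add, Re_opp, Re_mul, Im_add, Im_mul, Im_opp)/=; ring.
  apply: le_trans hV'; rewrite le_eqVlt; apply/orP; left; apply/eqP.
  congr (`| _ |); rewrite /w /lin !(Re_add, Re_opp, Re_mul, Im_add, Im_mul, Im_opp)/=; ring.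
have hdf : modulus (w x y - w x0 y0) <= df.
  apply: le_trans dw _; have uu : u <= d3 + d3 by rewrite lerD.
  have : (A + B) * u <= (A + B) * (d3 + d3) by rewrite ler_wpM2l// ltW.
  suff -> : (A + B) * (d3 + d3) = df by [].
  by rewrite /d3; field; rewrite gt_eqF.
have := Hf _ hdf; rewrite -/(w x0 y0) (addrC (w x0 y0)) subrK => h.
rewrite (_ : f (w x y) - f (w x0 y0) - c * lin x y =
  (f (w x y) - f (w x0 y0) - c * (w x y - w x0 y0)) +
  c * (w x y - w x0 y0 - lin x y)); last by ring.
apply: (le_trans (modulus_leD _ _)).
have -> : e * u = e / (2 * (A + B)) * ((A + B) * u) +
    (modulus c + 1) * (2 * (e / (4 * (modulus c + 1)) * u)).
  by field; rewrite !gt_eqF.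
apply: lerD; first by apply: (le_trans h); rewrite ler_wpM2l// ltW.
rewrite ComplexField.Normc.normcM; apply: ler_pM => //; try exact: modulus_ge0.
by rewrite lerDl.
Qed.

Lemma modulus_cis (t : R) : modulus (cos t +i* sin t)%C = 1.
Proof. by rewrite /= cos2Dsin2 sqrtr1. Qed.

Lemma circle_pointB (z0 : C) (r t : R) : 0 <= r ->
  modulus (circle_point z0 r t - z0) = r.
Proof.
move=> r0; rewrite /circle_point addrAC subrr add0r ComplexField.Normc.normcM.
by rewrite modulus_cis mulr1 modulus_real ger0_norm.
Qed.

(** In polar coordinates, apply [green_rectangle] to the real part of [f] and to the imaginary part
    divided by the radius. The sides at angles [0] and [2 * pi] cancel by periodicity, so the circle
    integral does not depend on the radius; letting the radius tend to [0] gives the value at the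
    centre. *)
Lemma mean_value (f : C -> C) (z0 : C) (r : R) : 0 < r ->
  (forall z, modulus (z - z0) <= r -> complex_diff f z) ->
  {within `[0, 2 * pi], continuous (fun t => complex.Re (f (circle_point z0 r t)))} /\
  itv_int (fun t => complex.Re (f (circle_point z0 r t))) 0 (2 * pi) =
    complex.Re (f z0) * (2 * pi).
Proof.
move=> r0 hf.
have p0 : 0 < 2 * pi :> R by rewrite mulr_gt0 ?pi_gt0.
pose U (x y : R) := complex.Re z0 + x * cos y.
pose V (x y : R) := complex.Im z0 + x * sin y.
have cpE x y : circle_point z0 x y = (U x y +i* V x y)%C.
  rewrite /circle_point /U /V; case: (z0) => a b; apply/eqP; rewrite eq_complex/=.
  by apply/andP; split; apply/eqP; ring.
have dU x y : total_diff U x y (cos y) (- (x * sin y)).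
  have := total_diffD (total_diff_cst (complex.Re z0) x y)
    (total_diffM (total_diff_fst y (is_derive_id x 1))
                 (total_diff_snd x (is_derive_cos y))).
  by rewrite !(mul1r, mul0r, mulr0, addr0, add0r) mulrN.
have dV x y : total_diff V x y (sin y) (x * cos y).
  have := total_diffD (total_diff_cst (complex.Im z0) x y)
    (total_diffM (total_diff_fst y (is_derive_id x 1))
                 (total_diff_snd x (is_derive_sin y))).
  by rewrite !(mul1r, mul0r, mulr0, addr0, add0r).
have chain x y : 0 <= x <= r -> exists c : C,
    total_diff (fun x y => complex.Re (f (circle_point z0 x y))) x y
      (complex.Re (c * (cos y +i* sin y)%C))
      (complex.Re (c * (- (x * sin y) +i* (x * cos y))%C)) /\
    total_diff (fun x y => complex.Im (f (circle_point z0 x y))) x y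
      (complex.Im (c * (cos y +i* sin y)%C))
      (complex.Im (c * (- (x * sin y) +i* (x * cos y))%C)).
  move=> /andP[x0 xr].
  have hd : complex_diff f (U x y +i* V x y)%C.
    by apply: hf; rewrite -cpE circle_pointB.
  have [c H] := complex_chain (dU x y) (dV x y) hd; exists c.
  rewrite (_ : circle_point z0 = fun x y => (U x y +i* V x y)%C)//.
  by apply/funext => x'; apply/funext => y'; exact: cpE.
pose P x y := complex.Re (f (circle_point z0 x y)).
pose Q x y := complex.Im (f (circle_point z0 x y)) / x.
have cP x : 0 <= x <= r -> continuous (P x).
  by move=> hx y; have [c [h _]] := chain x y hx; exact: total_diff_continuous_snd h.
have cPw x : 0 <= x <= r -> {within `[0, 2 * pi], continuous (P x)}.
  by move=> hx; apply: continuous_subspaceT => y; exact: cP.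
split; first by apply: cPw; rewrite lexx ltW.
(* The radius stays above [r1 > 0] because [Q] divides by it. *)
have step r1 : 0 < r1 <= r -> itv_int (P r) 0 (2 * pi) = itv_int (P r1) 0 (2 * pi).
  move=> /andP[r10 r1r].
  have dQ x y : r1 <= x <= r -> exists p q s : R,
      total_diff P x y p q /\ total_diff Q x y s p.
    move=> /andP[hx1 hx2]; have x0 : 0 < x by lra.
    have [c [h1 h2]] := chain x y (introT andP (conj (ltW x0) hx2)).
    have hi : total_diff (fun x (_ : R) => x^-1) x y (- x ^- 2) 0.
      apply: (@total_diff_fst _ (fun x => x^-1)).
      have := is_deriveV (lt0r_neq0 x0 : id x != 0) (is_derive_id x 1).
      by rewrite /GRing.scale/= mulr1.
    have := total_diffM h2 hi; set s := (X in total_diff _ _ _ X _).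
    set p' := (X in total_diff _ _ _ _ X).
    have -> : p' = complex.Re (c * (cos y +i* sin y)%C).
      by rewrite /p' Re_mul Im_mul/=; field; rewrite gt_eqF.
    by move=> hq; do 3 eexists; split; [exact: h1|exact: hq].
  have : itv_int (fun y => P r y - P r1 y) 0 (2 * pi) =
      itv_int (fun x => Q x (2 * pi) - Q x 0) r1 r.
    apply: green_rectangle; [exact: r1r|exact: ltW| | |].
    - by move=> x hx; apply: cPw; lra.
    - move=> y hy; apply/continuous_in_subspaceT => x; rewrite /= inE/= in_itv/= => hx.
      by have [p [q [s [_ h]]]] := dQ x y hx; exact: total_diff_continuous_fst h.
    - move=> x0 y0 hx hy.
      have [p [q [s [h1 h2]]]] := dQ x0 y0 hx; exists p, q, s => e e0.
      have [d1 d10 H1] := h1 e e0; have [d2 d20 H2] := h2 e e0.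
      exists (Num.min d1 d2); first by rewrite lt_min d10.
      move=> x y _ _; rewrite !le_min => /andP[? ?] /andP[? ?].
      by split; [exact: H1|exact: H2].
  have -> : (fun x => Q x (2 * pi) - Q x 0) = (fun=> 0).
    apply/funext => x; rewrite /Q /circle_point mulr_natl cos2pi sin2pi cos0 sin0.
    by rewrite subrr.
  rewrite itv_int_cst// mul0r itv_intB; [|by apply: cPw; lra..].
  by move/eqP; rewrite subr_eq0 => /eqP.
apply/eqP; rewrite -subr_eq0 -normr_le0; apply/ler_addgt0Pl => e e0; rewrite addr0.
have e1 : 0 < e / (2 * pi) by rewrite divr_gt0.
have := complex_diff_continuous (hf z0 _); rewrite subrr ComplexField.Normc.normc0.
move=> /(_ (ltW r0)) cf.
have /cf/nbhs_complexP[d d0 Hd] : nbhs (f z0) [set w | modulus (w - f z0) < e / (2 * pi)].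
  by apply/nbhs_complexP; exists (e / (2 * pi)).
pose r1 := Num.min r (d / 2).
have r10 : 0 < r1 by rewrite lt_min r0 divr_gt0.
have r1r : r1 <= r by rewrite ge_min lexx.
have r1d : r1 < d by rewrite gt_min; apply/orP; right; lra.
rewrite (step r1) ?r10//.
have -> : e = e / (2 * pi) * (2 * pi - 0) by rewrite subr0 divfK// gt_eqF.
rewrite -{2}(subr0 (2 * pi)); apply: itv_int_near_cst; [exact: ltW|by apply: cPw; rewrite ltW|].
move=> t _; rewrite /P -Re_opp -Re_add; apply: (le_trans (normr_Re _)); apply: ltW; apply: Hd.
by rewrite circle_pointB ?ltW.
Qed.

End MeanValue.

Section MaximumModulus.
Context {R : realType}.
Local Notation C := R[i].
Local Notation modulus := (@ComplexField.Normc.normc R).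

Lemma complex_diffZ (k : C) (f : C -> C) (z : C) :
  complex_diff f z -> complex_diff (fun z => k * f z) z.
Proof.
move=> [c H]; exists (k * c) => e e0.
have k0 : 0 < modulus k + 1 by rewrite ltr_wpDl ?modulus_ge0.
have [|d d0 Hd] := H (e / (modulus k + 1)); first by rewrite divr_gt0.
exists d => // w /Hd h.
have -> : k * f (z + w) - k * f z - k * c * w = k * (f (z + w) - f z - c * w) by ring.
rewrite ComplexField.Normc.normcM.
have -> : e * modulus w = (modulus k + 1) * (e / (modulus k + 1) * modulus w).
  by field; rewrite gt_eqF.
by apply: ler_pM => //; rewrite ?modulus_ge0// lerDl.
Qed.

Lemma circle_point_sqr (z0 : C) (r t : R) :
  modulus (circle_point z0 r t) ^+ 2 =
  modulus z0 ^+ 2 + r ^+ 2 +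
  2 * r * (complex.Re z0 * cos t + complex.Im z0 * sin t).
Proof.
rewrite !modulus_sqr /circle_point !(Re_add, Im_add, Re_mul, Im_mul)/=.
have h : sin t ^+ 2 = 1 - cos t ^+ 2 by rewrite -(cos2Dsin2 t); ring.
ring: h.
Qed.

(** The term [e * modulus z ^+ 2] produces a strict drop in the mean. Multiplied by the conjugate of
    [f z0], the function [f] has real part at most [(m ^+ 2 + modulus (f z) ^+ 2) / 2]; averaging
    the assumed bound over the circle yields [m ^+ 2 <= m ^+ 2 - e * r ^+ 2 / 2]. *)
Lemma no_interior_max (f : C -> C) (z0 : C) (r e : R) : 0 < r -> 0 < e ->
  (forall z, modulus (z - z0) <= r -> complex_diff f z) ->
  (forall z, modulus (z - z0) <= r ->
    modulus (f z) ^+ 2 + e * modulus z ^+ 2 <=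
    modulus (f z0) ^+ 2 + e * modulus z0 ^+ 2) -> False.
Proof.
move=> r0 e0 df mx; pose w := (f z0)^*%C; pose m := modulus (f z0).
have p0 : 0 < 2 * pi :> R by rewrite mulr_gt0 ?pi_gt0.
have [cg Ig] := mean_value r0 (fun z h => complex_diffZ w (df z h)).
have Rew : complex.Re (w * f z0) = m ^+ 2.
  by rewrite /m modulus_sqr Re_mul /w; case: (f z0) => a b /=; ring.
pose k := m ^+ 2 - e * r ^+ 2 / 2.
pose T := trig_poly k (- e * r * complex.Re z0) (- e * r * complex.Im z0) 0 0.
have le t : 0 <= t <= 2 * pi -> complex.Re (w * f (circle_point z0 r t)) <= T t.
  move=> _; have hz : modulus (circle_point z0 r t - z0) <= r.
    by rewrite circle_pointB// ltW.
  have := mx _ hz; rewrite circle_point_sqr -/m; set F := modulus (f _) => h.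
  have h1 : complex.Re (w * f (circle_point z0 r t)) <= m * F.
    apply: le_trans (ler_norm _) _; apply: le_trans (normr_Re _) _.
    by rewrite ComplexField.Normc.normcM modulus_conj.
  have h2 : m * F <= (m ^+ 2 + F ^+ 2) / 2.
    by have := sqr_ge0 (m - F); rewrite sqrrB; lra.
  apply: (le_trans h1); apply: (le_trans h2).
  rewrite /T /trig_poly /k; lra.
have cT : {within `[0, 2 * pi], continuous T}.
  by apply: continuous_subspaceT => t; exact: continuous_trig_poly.
have := le_itv_int cg cT le.
rewrite Ig trig_integral Rew ler_pM2r//; apply/negP; rewrite -ltNge.
by rewrite /k ltrBlDr ltrDl divr_gt0// mulr_gt0// exprn_gt0.
Qed.

Lemma continuous_sqr_addZ (T : topologicalType) (g h : T -> R) (e : R) (z : T) :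
  {for z, continuous g} -> {for z, continuous h} ->
  {for z, continuous (fun x => g x ^+ 2 + e * h x ^+ 2)}.
Proof.
move=> cg ch; have sq (k : T -> R) : {for z, continuous k} ->
    {for z, continuous (fun x => k x ^+ 2)}.
  by move=> ck; exact: (cvg_comp _ _ ck (@exprn_continuous R 2 (k z))).
exact: (cvgD (sq g cg) (cvgM (cvg_cst e) (sq h ch))).
Qed.

(** The point [p] is treated as a boundary point, so that a quotient known only to be continuous at
    its singularity can be used without removing the singularity. *)
Lemma maximum_modulus (f : C -> C) (rho M : R) (p : C) : 0 <= M ->
  (forall z, modulus z <= rho -> {for z, continuous f}) ->
  (forall z, modulus z < rho -> z != p -> complex_diff f z) ->
  (forall z, modulus z = rho \/ z = p -> modulus (f z) <= M) ->
  forall z, modulus z <= rho -> modulus (f z) <= M.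
Proof.
move=> M0 cf df bd z1 hz1; rewrite leNgt; apply/negP => hM.
have MF : M ^+ 2 < modulus (f z1) ^+ 2 by rewrite ltr_sqr ?nnegrE ?modulus_ge0.
have rho0 : 0 <= rho by exact: le_trans (modulus_ge0 _) hz1.
(* [e * rho ^+ 2] stays below the excess at [z1], so adding [e * modulus z ^+ 2] cannot move the
   maximum to the boundary or to [p]. *)
pose e := (modulus (f z1) ^+ 2 - M ^+ 2) / (2 * (rho ^+ 2 + 1)).
have rp : 0 < rho ^+ 2 + 1 by rewrite ltr_wpDl ?sqr_ge0.
have e0 : 0 < e by rewrite divr_gt0 ?subr_gt0// mulr_gt0.
have erho : e * rho ^+ 2 < modulus (f z1) ^+ 2 - M ^+ 2.
  rewrite /e mulrAC ltr_pdivrMr ?mulr_gt0// ltr_pM2l ?subr_gt0//; lra.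
pose K := [set z : C | modulus z <= rho].
have [||z hz|z0 Kz0 mx] := @usc_attains_max _ C K
  (fun z => modulus (f z) ^+ 2 + e * modulus z ^+ 2).
- exact: compact_disk.
- by exists z1.
- move=> a ha.
  have c : {for z, continuous (fun z => modulus (f z) ^+ 2 + e * modulus z ^+ 2)}.
    have c1 : {for z, continuous (fun z => modulus (f z))}.
      by exact: (cvg_comp _ _ (cf z hz) (@continuous_modulus R (f z))).
    have c2 : {for z, continuous modulus} by exact: continuous_modulus.
    exact: continuous_sqr_addZ.
  have na : nbhs (modulus (f z) ^+ 2 + e * modulus z ^+ 2) [set x | x < a].
    by apply: open_nbhs_nbhs; split => //; exact: open_lt.
  by apply: (@filterS _ (nbhs z) (nbhs_filter z) _ _ _ (c _ na)) => y h _; exact: h.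
have big : M ^+ 2 + e * rho ^+ 2 < modulus (f z0) ^+ 2 + e * modulus z0 ^+ 2.
  apply: lt_le_trans (mx z1 hz1).
  have : 0 <= e * modulus z1 ^+ 2 by rewrite mulr_ge0 ?sqr_ge0 ?ltW.
  by lra.
have ez0 : e * modulus z0 ^+ 2 <= e * rho ^+ 2.
  by rewrite ler_pM2l// ler_sqr ?nnegrE ?modulus_ge0.
have nb : ~ (modulus z0 = rho \/ z0 = p).
  move=> /bd h; suff : modulus (f z0) ^+ 2 <= M ^+ 2 by lra.
  by rewrite ler_sqr ?nnegrE ?modulus_ge0.
have z0p : z0 != p by apply/eqP => h; apply: nb; right.
have z0r : modulus z0 < rho.
  by rewrite lt_neqAle Kz0 andbT; apply/eqP => h; apply: nb; left.
have dp : 0 < modulus (z0 - p) by rewrite modulus_gt0 subr_eq0.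
pose r := Num.min ((rho - modulus z0) / 2) (modulus (z0 - p) / 2).
have r0 : 0 < r by rewrite lt_min !divr_gt0 ?subr_gt0.
have r1 : r <= (rho - modulus z0) / 2 by rewrite ge_min lexx.
have r2 : r <= modulus (z0 - p) / 2 by rewrite ge_min lexx orbT.
apply: (@no_interior_max f z0 r e r0 e0) => z hz.
  apply: df.
    by have := modulus_leD (z - z0) z0; rewrite subrK; lra.
  by apply/eqP => zp; move: hz; rewrite zp modulusB; lra.
apply: mx; rewrite /K/=.
by have := modulus_leD (z - z0) z0; rewrite subrK; lra.
Qed.

End MaximumModulus.

(** * Maximum principle for logarithmically plurisubharmonic functions *)

Section IntegralMonotone.
Local Open Scope ereal_scope.
Context d (T : measurableType d) (R : realType) (mu : {measure set T -> \bar R}).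

(* No measurability is needed: the integral of a nonnegative function is the
   supremum of the integrals of the simple functions below it. *)
Lemma integral_mono (D : set T) (f g : T -> \bar R) :
  (forall x, D x -> f x <= g x) -> \int[mu]_(x in D) f x <= \int[mu]_(x in D) g x.
Proof.
have pos (h k : T -> \bar R) : (forall x, D x -> 0 <= h x) ->
    (forall x, D x -> 0 <= k x) -> (forall x, D x -> h x <= k x) ->
    \int[mu]_(x in D) h x <= \int[mu]_(x in D) k x.
  move=> h0 k0 hk; rewrite !ge0_integralE//; apply: le_ereal_sup => _ [s hs <-].
  exists s => // x; apply: le_trans (hs x) _; rewrite /patch.
  by case: ifPn => // /set_mem; exact: hk.
move=> fg; rewrite (integralE mu D f) (integralE mu D g).
have hp : \int[mu]_(x in D) f^\+ x <= \int[mu]_(x in D) g^\+ x.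
  apply: pos => x Dx; [exact: funepos_ge0|exact: funepos_ge0|].
  by rewrite !funeposE ge_max !le_max lexx orbT andbT fg.
have hn : \int[mu]_(x in D) g^\- x <= \int[mu]_(x in D) f^\- x.
  apply: pos => x Dx; [exact: funeneg_ge0|exact: funeneg_ge0|].
  by rewrite !funenegE ge_max !le_max lexx orbT andbT leeN2 fg.
exact: leeB.
Qed.

End IntegralMonotone.

Section Subharmonic.
Context {R : realType}.
Local Notation C := R[i].
Local Notation modulus := (@ComplexField.Normc.normc R).

(** Averaged over the circle, the majorant leaves only [v + k], which the sub-mean value inequality
    at the centre compares with [v]. *)
Lemma subharmonic_trig_bound (U : set C) (f : C -> \bar R) (r v k a1 b1 a2 b2 : R) :
  0 < r -> subharmonic_on U f -> [set z | modulus z <= r] `<=` U -> f (0 : C) = v%:E ->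
  (forall t, (f (circle_point 0%R r t) <= (v + trig_poly k a1 b1 a2 b2 t)%:E)%E) ->
  0 <= k.
Proof.
move=> r0 [_ _ sm] sub f0 le.
have p0 : 0 < 2 * pi :> R by rewrite mulr_gt0 ?pi_gt0.
have := sm (0 : C) r r0; rewrite f0 => h.
have {h}/h h : [set z : C | modulus (z - 0) <= r] `<=` U.
  by move=> z /=; rewrite subr0; exact: sub.
have vk t : v + trig_poly k a1 b1 a2 b2 t = trig_poly (v + k) a1 b1 a2 b2 t.
  by rewrite /trig_poly; ring.
have Ieq : (\int[lebesgue_measure]_(t in `[0%R, (2 * pi)%R])
    (trig_poly (v + k)%R a1 b1 a2 b2 t)%:E = ((v + k) * (2 * pi))%:E)%E.
  rewrite -(trig_integral (v + k) a1 b1 a2 b2) /itv_int /Rintegral fineK//.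
  apply: integrable_fin_num => //; apply: itv_integrable.
  by apply: continuous_subspaceT => t; exact: continuous_trig_poly.
have : (v%:E <= ((2 * pi)^-1)%:E * ((v + k) * (2 * pi))%:E)%E.
  apply: le_trans h _; rewrite lee_pmul2l//; last by rewrite lte_fin invr_gt0.
  rewrite -Ieq; apply: integral_mono => t _; rewrite -vk; exact: le.
rewrite -EFinM lee_fin mulrC mulfK ?gt_eqF//; lra.
Qed.

End Subharmonic.

Section LogarithmBound.
Context {R : realType}.

(** The difference of the two sides, as a function of [x = 1 + y], has derivative
    [(x - 1) ^+ 3 / x]; it is therefore minimal at [x = 1], where it vanishes. *)
Lemma ln1D_le (y : R) : -1 < y -> ln (1 + y) <= y - y ^+ 2 / 2 + y ^+ 3 / 3.
Proof.
move=> y1; pose g : R -> R := id - cst 1.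
pose f : R -> R := g - 2^-1 *: (g * g) + 3^-1 *: (g * g * g) - (@ln R).
pose df (x : R) : R := (x - 1) ^+ 3 / x.
have der (x : R) : 0 < x -> is_derive x 1 f (df x).
  move=> x0; have dg := is_deriveB (is_derive_id x 1) (is_derive_cst (1 : R) x 1).
  have := is_deriveB (is_deriveD (is_deriveB dg (is_deriveZ 2^-1 (is_deriveM dg dg)))
    (is_deriveZ 3^-1 (is_deriveM (is_deriveM dg dg) dg))) (is_derive1_ln x0).
  move=> [h1 h2]; apply: DeriveDef; first exact: h1.
  by rewrite h2 /df /g /GRing.scale/= !fctE/=; field; rewrite gt_eqF.
have cont (a b : R) : 0 < a -> {within `[a, b], continuous f}.
  move=> a0; apply: continuous_in_subspaceT => x; rewrite inE/= in_itv/= => /andP[ax _].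
  have [dx _] := der x (lt_le_trans a0 ax).
  exact/differentiable_continuous/derivable1_diffP.
have fE x : f x = (x - 1) - (x - 1) ^+ 2 / 2 + (x - 1) ^+ 3 / 3 - ln x.
  by rewrite /f /g /GRing.scale/= !fctE/= /GRing.scale/=; field.
suff : 0 <= f (1 + y).
  by rewrite fE (_ : 1 + y - 1 = y); [lra|ring].
have f1 : f 1 = 0 by rewrite fE ln1; field.
have [y0|y0] := leP 0 y.
  have [|||c] := @MVT_segment _ f df 1 (1 + y); [lra| | |].
  - move=> x; rewrite in_itv/= => /andP[h _]; apply: der; lra.
  - by apply: cont.
  rewrite in_itv/= f1 subr0 => hc ->; apply: mulr_ge0; last by lra.
  by rewrite /df divr_ge0 ?exprn_ge0//; lra.
have [|||c] := @MVT_segment _ f df (1 + y) 1; [lra| | |].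
- move=> x; rewrite in_itv/= => /andP[h _]; apply: der; lra.
- by apply: cont; lra.
rewrite in_itv/= f1 sub0r => hc h; have -> : f (1 + y) = - df c * (1 - (1 + y)) by lra.
apply: mulr_ge0; last by lra.
rewrite /df -mulNr divr_ge0//; last by lra.
have -> : - (c - 1) ^+ 3 = (1 - c) ^+ 3 by ring.
by rewrite exprn_ge0//; lra.
Qed.

End LogarithmBound.

(** * Second order Taylor bounds *)

Section Jets.
Context {R : realType}.
Local Notation C := R[i].
Local Notation modulus := (@ComplexField.Normc.normc R).
Import ComplexField.Normc.

(** Order two with a cubic remainder suffices: the strict gain in the maximum principle is of order
    two, and cubic errors are negligible against it on small circles. *)
Definition taylor2 (f : C -> C) (z c1 c2 : C) := exists K d : R,
  [/\ 0 < d, 0 <= K & forall w, modulus w <= d ->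
    modulus (f (z + w) - (f z + c1 * w + c2 * w ^+ 2)) <= K * modulus w ^+ 3].

(* An upper second order Taylor bound whose polynomial part is harmonic. *)
Definition upper_jet (h : C -> R) (z : C) := exists (c1 c2 : C) (K d : R),
  [/\ 0 < d, 0 <= K & forall w, modulus w <= d ->
    h (z + w) <= h z + complex.Re (c1 * w + c2 * w ^+ 2) + K * modulus w ^+ 3].

Lemma taylor2_lipschitz f z c1 c2 : taylor2 f z c1 c2 ->
  exists2 L : R, 0 < L & exists2 d : R, 0 < d & forall w, modulus w <= d ->
    modulus (f (z + w) - f z) <= L * modulus w.
Proof.
move=> [K [d [d0 K0 H]]].
have L0 : 0 < modulus c1 + modulus c2 + K + 1.
  by rewrite ltr_wpDl// !addr_ge0 ?modulus_ge0.
exists (modulus c1 + modulus c2 + K + 1) => //; exists (Num.min d 1).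
  by rewrite lt_min d0 ltr01.
move=> w; rewrite le_min => /andP[/H h w1]; have w0 := modulus_ge0 w.
have -> : f (z + w) - f z = (f (z + w) - (f z + c1 * w + c2 * w ^+ 2)) +
  (c1 * w + c2 * w ^+ 2) by ring.
apply: (le_trans (modulus_leD _ _)).
have : modulus (c1 * w + c2 * w ^+ 2) <= modulus c1 * modulus w + modulus c2 * modulus w ^+ 2.
  by apply: (le_trans (modulus_leD _ _)); rewrite !normcM -expr2.
have w2 : modulus w ^+ 2 <= modulus w by rewrite expr2 ler_piMl.
have w3 : modulus w ^+ 3 <= modulus w.
  by rewrite exprS ler_piMr// exprn_ile1.
have : modulus c2 * modulus w ^+ 2 <= modulus c2 * modulus w.
  by rewrite ler_wpM2l ?modulus_ge0.
have : K * modulus w ^+ 3 <= K * modulus w by rewrite ler_wpM2l.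
have : 0 <= modulus c1 by exact: modulus_ge0.
by rewrite !mulrDl mul1r; lra.
Qed.

Lemma taylor2_continuous f z c1 c2 : taylor2 f z c1 c2 -> {for z, continuous f}.
Proof.
move=> /taylor2_lipschitz[k k0 [d d0 H]] A /nbhs_complexP[e e0 HA].
apply/nbhs_complexP; exists (Num.min d (e / k)).
  by rewrite lt_min d0 divr_gt0.
move=> w; rewrite lt_min => /andP[h1 h2]; apply: HA.
rewrite -[w](subrK z) (addrC _ z) (le_lt_trans (H _ (ltW h1)))//.
by rewrite mulrC -ltr_pdivlMr.
Qed.

Lemma upper_jet_lin (c z : C) : upper_jet (fun w => complex.Re (c * w)) z.
Proof.
exists c, 0, 0, 1; split => // w _.
by rewrite !mul0r !addr0 mulrDr Re_add.
Qed.

Lemma upper_jet_cst (r : R) (z : C) : upper_jet (fun=> r) z.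
Proof. by exists 0, 0, 0, 1; split => // w _; rewrite !mul0r !addr0. Qed.

Lemma upper_jetD g h z : upper_jet g z -> upper_jet h z ->
  upper_jet (fun w => g w + h w) z.
Proof.
move=> [a1 [a2 [K [d [d0 K0 H]]]]] [b1 [b2 [L [e [e0 L0 G]]]]].
exists (a1 + b1), (a2 + b2), (K + L), (Num.min d e); split.
- by rewrite lt_min d0.
- exact: addr_ge0.
move=> w; rewrite le_min => /andP[/H h1 /G h2].
have -> : (a1 + b1) * w + (a2 + b2) * w ^+ 2 =
  (a1 * w + a2 * w ^+ 2) + (b1 * w + b2 * w ^+ 2) by ring.
rewrite Re_add mulrDl; lra.
Qed.

Lemma upper_jetZ k g z : 0 <= k -> upper_jet g z -> upper_jet (fun w => k * g w) z.
Proof.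
move=> k0 [a1 [a2 [K [d [d0 K0 H]]]]].
exists (k%:C%C * a1), (k%:C%C * a2), (k * K), d; split => //; first exact: mulr_ge0.
move=> w /H h; apply: (le_trans (ler_wpM2l k0 h)).
rewrite -!mulrA -mulrDr Re_mul/=; lra.
Qed.

Lemma upper_jet_sum (I : finType) (g : I -> C -> R) z :
  (forall i, upper_jet (g i) z) -> upper_jet (fun w => \sum_i g i w) z.
Proof.
move=> h; elim: (index_enum I) => [|i s ih].
  by under eq_fun do rewrite big_nil; exact: upper_jet_cst.
by under eq_fun do rewrite big_cons; exact: upper_jetD.
Qed.

Lemma modulus_sqrD (x y : C) :
  modulus (x + y) ^+ 2 = modulus x ^+ 2 + 2 * complex.Re (x^*%C * y) + modulus y ^+ 2.
Proof. by rewrite !modulus_sqr Re_mul; case: x y => a b [c d] /=; ring. Qed.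

(** With [modulus (1 + x) ^+ 2 = 1 + y], the quadratic terms of [y - y ^+ 2 / 2] recombine into the
    real part of a polynomial in [x]: up to third order the logarithm of the modulus is harmonic. *)
Lemma ln_modulus1D_le (x : C) : modulus x <= 2^-1 ->
  ln (modulus (1 + x)) <= complex.Re (x - x ^+ 2 / 2) + 4 * modulus x ^+ 3.
Proof.
move=> hx; set m := modulus x in hx *; have m0 : 0 <= m by exact: modulus_ge0.
have m1 : 2^-1 <= modulus (1 + x).
  have := modulus_lerD 1 x; rewrite normc1 -/m; lra.
pose y := 2 * complex.Re x + m ^+ 2.
have yE : modulus (1 + x) ^+ 2 = 1 + y.
  by rewrite modulus_sqrD normc1 -/m /y Re_mul/= expr1n; ring.
have p : 0 < modulus (1 + x) by lra.
have y1 : -1 < y.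
  have : 0 < modulus (1 + x) ^+ 2 by rewrite exprn_gt0.
  by rewrite yE; lra.
have lnE : ln (modulus (1 + x)) = ln (1 + y) / 2.
  by rewrite -yE lnXn// -mulr_natl; field.
have rx : `|complex.Re x| <= m by exact: normr_Re.
have hy : `|y| <= 5 / 2 * m.
  apply: (le_trans (ler_normD _ _)); rewrite normrM (ger0_norm (sqr_ge0 _)) ger0_norm//.
  have : m ^+ 2 <= 2^-1 * m by rewrite expr2 ler_wpM2r.
  lra.
have y3 : y ^+ 3 <= 16 * m ^+ 3.
  apply: le_trans (ler_norm _) _; rewrite normrX.
  have : `|y| ^+ 3 <= (5 / 2 * m) ^+ 3 by rewrite lerXn2r ?nnegrE ?mulr_ge0//; lra.
  have : 0 <= m ^+ 3 by exact: exprn_ge0.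
  rewrite exprMn; lra.
have := ln1D_le y1; rewrite lnE => h.
have e1 : y - y ^+ 2 / 2 = 2 * (complex.Re (x - x ^+ 2 / 2)) -
    2 * complex.Re x * m ^+ 2 - m ^+ 4 / 2.
  have -> : complex.Re (x - x ^+ 2 / 2) = complex.Re x -
      (complex.Re x ^+ 2 - complex.Im x ^+ 2) / 2.
    have -> : x ^+ 2 / 2 = (2^-1)%:C%C * (x * x).
      by rewrite mulrC expr2; congr (_ * _); rewrite rmorphV ?unitfE//= rmorph_nat.
    by rewrite Re_add Re_opp !Re_mul /= mul0r; field.
  have m2 : m ^+ 4 = m ^+ 2 * m ^+ 2 by ring.
  by rewrite m2 /y /m modulus_sqr; field.
have : - (2 * complex.Re x * m ^+ 2) <= 2 * m ^+ 3.
  rewrite -mulNr (_ : 2 * m ^+ 3 = 2 * m * m ^+ 2); last by ring.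
  rewrite ler_wpM2r ?sqr_ge0//.
  by move: rx; rewrite ler_norml; lra.
have : 0 <= m ^+ 4 by exact: exprn_ge0.
have : 0 <= m ^+ 3 by exact: exprn_ge0.
by lra.
Qed.

(** Write [f (z + w) = f z * (1 + x)]. The polynomial part is the Taylor polynomial of a local
    branch of the logarithm of [f], whence the coefficient [b - a ^+ 2 / 2]. *)
Lemma upper_jet_ln f z c1 c2 : taylor2 f z c1 c2 -> f z != 0 ->
  upper_jet (fun w => ln (modulus (f w))) z.
Proof.
move=> [K [d [d0 K0 H]]] fz0; set v := f z in fz0.
have v0 : 0 < modulus v by rewrite modulus_gt0.
pose a := c1 / v; pose b := c2 / v; pose k := K / modulus v.
have k0 : 0 <= k by rewrite divr_ge0 ?modulus_ge0.
pose L := modulus a + modulus b + k + 1.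
have a0 := modulus_ge0 a; have b0 := modulus_ge0 b.
have L0 : 0 < L by rewrite ltr_wpDl// !addr_ge0.
(* The bound [2^-1 / L] on the radius gives [modulus x <= 2^-1], as [ln_modulus1D_le] requires. *)
exists a, (b - a ^+ 2 / 2), (k + L ^+ 2 + 4 * L ^+ 3), (Num.min (Num.min d 1) (2^-1 / L)).
have L2 : 0 <= L ^+ 2 by exact: sqr_ge0.
have L3 : 0 <= L ^+ 3 by rewrite exprn_ge0// ltW.
split; [by rewrite !lt_min d0 ltr01 divr_gt0 | lra |].
move=> w; rewrite !le_min => /andP[/andP[hd w1] wL].
set m := modulus w; have m0 : 0 <= m by exact: modulus_ge0.
pose x := f (z + w) / v - 1.
have rho : modulus (x - a * w - b * w ^+ 2) <= k * m ^+ 3.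
  have -> : x - a * w - b * w ^+ 2 = (f (z + w) - (v + c1 * w + c2 * w ^+ 2)) / v.
    by rewrite /x /a /b; field.
  rewrite modulus_div /k mulrAC ler_pM2r ?invr_gt0//; exact: H.
have m2 : m ^+ 2 <= m by rewrite expr2 ler_piMl.
have m3 : m ^+ 3 <= m ^+ 2 by rewrite exprS ler_piMl ?sqr_ge0.
have m20 : 0 <= m ^+ 2 by exact: sqr_ge0.
have m30 : 0 <= m ^+ 3 by exact: exprn_ge0.
have xaw : modulus (x - a * w) <= L * m ^+ 2.
  have -> : x - a * w = (x - a * w - b * w ^+ 2) + b * w ^+ 2 by ring.
  apply: (le_trans (modulus_leD _ _)); rewrite normcM modulusX -/m.
  have : k * m ^+ 3 <= k * m ^+ 2 by rewrite ler_wpM2l.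
  have : 0 <= modulus a * m ^+ 2 by exact: mulr_ge0.
  by rewrite /L !mulrDl mul1r; lra.
have xm : modulus x <= L * m.
  have -> : x = (x - a * w - b * w ^+ 2) + b * w ^+ 2 + a * w by ring.
  apply: (le_trans (modulus_leD _ _)); rewrite normcM -/m.
  have := modulus_leD (x - a * w - b * w ^+ 2) (b * w ^+ 2).
  rewrite normcM modulusX -/m.
  have : k * m ^+ 3 <= k * m by rewrite ler_wpM2l// (le_trans m3).
  have : modulus b * m ^+ 2 <= modulus b * m by rewrite ler_wpM2l.
  by rewrite /L !mulrDl mul1r; lra.
have x12 : modulus x <= 2^-1.
  by apply: (le_trans xm); rewrite mulrC -ler_pdivlMr.
have fE : ln (modulus (f (z + w))) = ln (modulus v) + ln (modulus (1 + x)).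
  have x1 : 0 < modulus (1 + x).
    have := modulus_lerD 1 x; rewrite normc1; lra.
  rewrite -lnM ?posrE// -normcM; congr (ln (modulus _)).
  by rewrite /x; field.
rewrite fE -addrA; apply: lerD => //; apply: (le_trans (ln_modulus1D_le x12)).
have x3 : modulus x ^+ 3 <= L ^+ 3 * m ^+ 3.
  by rewrite -exprMn lerXn2r ?nnegrE ?modulus_ge0// mulr_ge0// ltW.
have -> : x - x ^+ 2 / 2 = (a * w + (b - a ^+ 2 / 2) * w ^+ 2) +
   (x - a * w - b * w ^+ 2) - (2^-1 * ((x - a * w) * (x + a * w))) by field.
rewrite Re_add Re_opp Re_add.
have r1 : complex.Re (x - a * w - b * w ^+ 2) <= k * m ^+ 3.
  by apply: le_trans rho; apply: le_trans (normr_Re _); exact: ler_norm.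
have r2 : - complex.Re (2^-1 * ((x - a * w) * (x + a * w))) <= L ^+ 2 * m ^+ 3.
  apply: (@le_trans _ _ (modulus (2^-1 * ((x - a * w) * (x + a * w))))).
    apply: le_trans (normr_Re _); rewrite -normrN; exact: ler_norm.
  have h2 : modulus (2^-1 : C) = 2^-1.
    by rewrite normcV -(rmorph_nat (real_complex R)) modulus_real ger0_norm.
  have h3 : modulus (x + a * w) <= 2 * (L * m).
    apply: (le_trans (modulus_leD _ _)); rewrite normcM -/m.
    have : modulus a * m <= L * m by rewrite ler_wpM2r// /L; lra.
    lra.
  rewrite !normcM h2.
  have : modulus (x - a * w) * modulus (x + a * w) <= (L * m ^+ 2) * (2 * (L * m)).
    by apply: ler_pM; rewrite ?modulus_ge0.
  have -> : (L * m ^+ 2) * (2 * (L * m)) = 2 * (L ^+ 2 * m ^+ 3) by ring.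
  lra.
have -> : (k + L ^+ 2 + 4 * L ^+ 3) * m ^+ 3 =
  k * m ^+ 3 + L ^+ 2 * m ^+ 3 + 4 * (L ^+ 3 * m ^+ 3) by ring.
by lra.
Qed.

(** The absence of a linear term in [g] is essential: a term [c1 * w] would contribute
    [modulus (c1 * w) ^+ 2], which is of second order and not harmonic. *)
Lemma upper_jet_sqr (g : C -> C) (y0 c2 : C) (K d : R) : 0 < d -> 0 <= K ->
  (forall w, modulus w <= d ->
    modulus (g w - (y0 + c2 * w ^+ 2)) <= K * modulus w ^+ 3) ->
  upper_jet (fun w => modulus (g w) ^+ 2) 0.
Proof.
move=> d0 K0 H.
have g0 : g 0 = y0.
  have := H 0; rewrite normc0 => /(_ (ltW d0)).
  rewrite expr0n/= mulr0 expr0n/= mulr0 addr0 => h.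
  by apply/eqP; rewrite -subr_eq0 -modulus_eq0 eq_le h modulus_ge0.
pose L := modulus c2 + K; have c20 := modulus_ge0 c2.
have L0 : 0 <= L by rewrite addr_ge0.
exists 0, (2 * (y0^*%C * c2)), (2 * modulus y0 * K + L ^+ 2), (Num.min d 1).
split; [by rewrite lt_min d0 ltr01| |].
  by rewrite addr_ge0 ?sqr_ge0 ?mulr_ge0 ?modulus_ge0.
move=> w; rewrite le_min => /andP[/H h w1]; rewrite add0r g0 mul0r add0r.
set m := modulus w in h w1 *; have m0 : 0 <= m by exact: modulus_ge0.
have m20 : 0 <= m ^+ 2 by exact: sqr_ge0.
have m30 : 0 <= m ^+ 3 by exact: exprn_ge0.
have m3 : m ^+ 3 <= m ^+ 2 by rewrite exprS ler_piMl.
pose s := g w - y0.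
have -> : g w = y0 + s by rewrite /s; ring.
rewrite modulus_sqrD -addrA -addrA lerD2l.
have sE : s = c2 * w ^+ 2 + (g w - (y0 + c2 * w ^+ 2)) by rewrite /s; ring.
have sm : modulus s <= L * m ^+ 2.
  rewrite sE; apply: (le_trans (modulus_leD _ _)); rewrite normcM modulusX -/m.
  have : K * m ^+ 3 <= K * m ^+ 2 by rewrite ler_wpM2l.
  by rewrite /L mulrDl; lra.
have s2 : modulus s ^+ 2 <= L ^+ 2 * m ^+ 3.
  have : modulus s ^+ 2 <= (L * m ^+ 2) ^+ 2.
    by rewrite ler_sqr ?nnegrE ?modulus_ge0// mulr_ge0.
  have -> : (L * m ^+ 2) ^+ 2 = L ^+ 2 * (m ^+ 3 * m) by ring.
  have : L ^+ 2 * (m ^+ 3 * m) <= L ^+ 2 * m ^+ 3.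
    by rewrite ler_wpM2l ?sqr_ge0// ler_piMr.
  lra.
have e1 : 2 * complex.Re (y0^*%C * s) = complex.Re (2 * (y0^*%C * c2) * w ^+ 2) +
    2 * complex.Re (y0^*%C * (g w - (y0 + c2 * w ^+ 2))).
  rewrite {1}sE mulrDr Re_add mulrDr; congr (_ + _).
  have -> : 2 * (y0^*%C * c2) * w ^+ 2 = (2 : R)%:C%C * (y0^*%C * (c2 * w ^+ 2)).
    by rewrite rmorph_nat; ring.
  by rewrite [in RHS]Re_mul /= mul0r subr0.
have e2 : complex.Re (y0^*%C * (g w - (y0 + c2 * w ^+ 2))) <= modulus y0 * (K * m ^+ 3).
  apply: (le_trans (ler_norm _)); apply: (le_trans (normr_Re _)).
  by rewrite normcM modulus_conj ler_wpM2l// modulus_ge0.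
rewrite e1 !mulrDl; lra.
Qed.

End Jets.

Section MaximumPrinciple.
Context {R : realType}.
Local Notation C := R[i].
Local Notation modulus := (@ComplexField.Normc.normc R).
Import ComplexField.Normc.

Lemma lne_ltE (u a : R) : 0 <= u -> 0 < a ->
  (lne u%:E < (ln a)%:E)%E = (u < a).
Proof.
move=> u0 a0; rewrite -lne_EFin//.
by rewrite (lte_lne _ _) ?lte_fin// in_itv/= lee_fin leey ?u0 ?ltW.
Qed.

(** On a small circle the harmonic jet of [h] averages to zero, and the constant term left,
    [K * r ^+ 3 - e * r ^+ 2], is negative for small [r]. Where [u] vanishes its logarithm is [-oo],
    so the assumed bound concerns only positive values. *)
Lemma no_interior_psh_max p q (D : set 'M[C]_(p, q)) (u : 'M[C]_(p, q) -> R)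
    (z b : 'M[C]_(p, q)) (h : C -> R) (e d : R) :
  psh_on D (fun w => lne (u w)%:E) -> 0 < u z -> 0 < e -> 0 < d ->
  upper_jet h 0 ->
  (forall w : C, modulus w <= d -> D (z + w *: b) /\
    (0 < u (z + w *: b) -> ln (u (z + w *: b)) <=
      ln (u z) + (h w - h 0) - e * modulus w ^+ 2)) -> False.
Proof.
move=> [_ _ psh] uz e0 d0 [c1 [c2 [K [d' [d'0 K0 H]]]]] G.
have K1 : 0 < K + 1 by rewrite ltr_wpDl.
pose r := Num.min (Num.min d d') (e / (K + 1) / 2).
have r0 : 0 < r by rewrite !lt_min d0 d'0 !divr_gt0.
have rd : r <= d by rewrite !ge_min lexx.
have rd' : r <= d' by rewrite !ge_min lexx orbT.
have rK : K * r < e.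
  have : r * (K + 1) <= e / 2.
    rewrite -ler_pdivlMr// mulrAC; by rewrite !ge_min lexx orbT.
  by rewrite mulrDr; lra.
pose f (l : C) := lne (u (z + l *: b))%:E.
have sub : [set l : C | modulus l <= r] `<=` [set l : C | D (z + l *: b)].
  by move=> l /= hl; have [] := G l (le_trans hl rd).
have f0 : f 0 = (ln (u z))%:E by rewrite /f scale0r addr0 lne_EFin.
have le t : (f (circle_point 0%R r t) <=
    (ln (u z) + trig_poly (K * r ^+ 3 - e * r ^+ 2) (r * complex.Re c1)
      (- r * complex.Im c1) (r ^+ 2 * complex.Re c2) (- r ^+ 2 * complex.Im c2) t)%:E)%E.
  set w := circle_point 0 r t.
  have mw : modulus w = r by have := circle_pointB 0 t (ltW r0); rewrite subr0.
  have [_ g] := G w (eq_ind_r (fun x => x <= d) rd mw).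
  have [u0|u0] := leP (u (z + w *: b)) 0.
    by rewrite /f le0_lneNy ?lee_fin// leNye.
  rewrite /f lne_EFin// lee_fin; apply: (le_trans (g u0)).
  have := H w; rewrite mw add0r => /(_ rd').
  have -> : complex.Re (c1 * w + c2 * w ^+ 2) =
      r * complex.Re c1 * cos t + - r * complex.Im c1 * sin t +
      r ^+ 2 * complex.Re c2 * (cos t ^+ 2 - sin t ^+ 2) +
      - r ^+ 2 * complex.Im c2 * (2 * (cos t * sin t)).
    rewrite Re_add expr2 !Re_mul !Im_mul /w /circle_point add0r Re_mul Im_mul/=; ring.
  by rewrite /trig_poly; lra.
have := subharmonic_trig_bound r0 (psh z b) sub f0 le.
have -> : K * r ^+ 3 - e * r ^+ 2 = (K * r - e) * r ^+ 2 by ring.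
by rewrite pmulr_lge0 ?exprn_gt0// subr_ge0 leNgt rK.
Qed.

Lemma continuous_sum (T : topologicalType) (I : finType) (g : I -> T -> R) (z : T) :
  (forall i, {for z, continuous (g i)}) -> {for z, continuous (fun x => \sum_i g i x)}.
Proof.
move=> h; elim: (index_enum I) => [|i s ih].
  have -> : (fun x => \sum_(i <- [::]) g i x) = fun=> 0.
    by apply/funext => x; rewrite big_nil.
  exact: cvg_cst.
have -> : (fun x => \sum_(j <- i :: s) g j x) = (fun x => g i x + \sum_(j <- s) g j x).
  by apply/funext => x; rewrite big_cons.
exact: (cvgD (h i) ih).
Qed.

Lemma continuous_near_lt (T : topologicalType) (g : T -> R) (z : T) (a : R) :
  {for z, continuous g} -> g z < a -> \forall x \near z, g x < a.
Proof.
move=> cg ga; have := cg [set x | x < a]; apply.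
by apply: open_nbhs_nbhs; split => //; exact: open_lt.
Qed.

Lemma continuous_near_gt (T : topologicalType) (g : T -> R) (z : T) (a : R) :
  {for z, continuous g} -> a < g z -> \forall x \near z, a < g x.
Proof.
move=> cg ga; have := cg [set x | a < x]; apply.
by apply: open_nbhs_nbhs; split => //; exact: open_gt.
Qed.

Lemma usc_mul_continuous (T : topologicalType) (K : set T) (u g : T -> R) (z : T) :
  K z -> (forall x, K x -> 0 <= u x) -> (forall x, 0 < g x) ->
  (forall a, u z < a -> \forall x \near z, K x -> u x < a) ->
  {for z, continuous g} ->
  forall a, u z * g z < a -> \forall x \near z, K x -> u x * g x < a.
Proof.
move=> Kz u0 g0 usc cg a h.
pose A := (u z + a / g z) / 2.
have uA : u z < a / g z by rewrite ltr_pdivlMr.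
have [A1 A2] : u z < A /\ A < a / g z by rewrite /A; split; lra.
have A0 : 0 < A by exact: le_lt_trans (u0 z Kz) A1.
have gA : g z < a / A by rewrite ltr_pdivlMr// mulrC -ltr_pdivlMr.
have n1 := usc A A1; have n2 := continuous_near_lt cg gA.
apply: filterS2 n1 n2 => x h1 h2 Kx.
have h3 : A * g x < a by rewrite mulrC -ltr_pdivlMr.
apply: le_lt_trans h3; apply: ler_wpM2r; first exact: ltW.
exact: ltW (h1 Kx).
Qed.

End MaximumPrinciple.

Section Continuity.
Context {R : realType}.
Local Notation C := R[i].
Local Notation modulus := (@ComplexField.Normc.normc R).
Import ComplexField.Normc.

Lemma tube (T U : topologicalType) (K : set T) (P : T -> U -> Prop) (y0 : U) :
  compact K ->
  (forall x, K x -> \forall z \near (x, y0), K z.1 -> P z.1 z.2) ->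
  \forall y \near y0, forall x, K x -> P x y.
Proof.
move=> /compact_near_coveringP/near_covering_withinP cK h.
exact: (cK U (nbhs y0) (fun y x => P x y) _ h).
Qed.

Lemma continuous_fst (T U V : topologicalType) (f : T -> V) (x : T * U) :
  {for x.1, continuous f} -> {for x, continuous (fun x => f x.1)}.
Proof. by move=> cf; exact: (cvg_comp _ _ (@cvg_fst _ _ (nbhs x.1) (nbhs x.2) _) cf). Qed.

Lemma continuous_snd (T U V : topologicalType) (f : U -> V) (x : T * U) :
  {for x.2, continuous f} -> {for x, continuous (fun x => f x.2)}.
Proof. by move=> cf; exact: (cvg_comp _ _ (@cvg_snd _ _ (nbhs x.1) (nbhs x.2) _) cf). Qed.

Lemma continuous_dist (z0 z : C) : {for z, continuous (fun w : C => modulus (w - z0))}.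
Proof.
move=> A /nbhs_ballP[e /= e0 H]; apply/nbhs_complexP; exists e => // w hw.
apply: H; rewrite -ball_normE/=; apply: le_lt_trans hw; rewrite ler_norml.
have := modulus_lerB (w - z0) (z - z0); have := modulus_lerB (z - z0) (w - z0).
have -> : w - z0 - (z - z0) = w - z by ring.
have -> : z - z0 - (w - z0) = z - w by ring.
by rewrite (modulusB z w); lra.
Qed.

Lemma continuous_mx (T : topologicalType) p q (f : T -> 'M[C]_(p, q)) (x : T) :
  (forall i j, {for x, continuous (fun x => f x i j)}) -> {for x, continuous f}.
Proof.
move=> h A /nbhs_mxP[e e0 H].
have : \forall y \near x, forall i j, modulus (f y i j - f x i j) < e.
  apply: filter_forall => i; apply: filter_forall => j; apply: (h i j [set w | modulus (w - f x i j) < e]).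
  by apply/nbhs_complexP; exists e.
by apply: filterS => y hy; exact: H.
Qed.

Lemma continuous_mxD (T : topologicalType) p q (f g : T -> 'M[C]_(p, q)) (x : T) :
  {for x, continuous f} -> {for x, continuous g} ->
  {for x, continuous (fun x => f x + g x)}.
Proof.
move=> cf cg A /nbhs_mxP[e e0 H]; have e20 : 0 < e / 2 by rewrite divr_gt0.
have nf : nbhs (f x) [set M : 'M[C]_(p, q) | forall i j, modulus (M i j - f x i j) < e / 2].
  by apply/nbhs_mxP; exists (e / 2).
have ng : nbhs (g x) [set M : 'M[C]_(p, q) | forall i j, modulus (M i j - g x i j) < e / 2].
  by apply/nbhs_mxP; exists (e / 2).
have nf' : \forall y \near x, forall i j, modulus (f y i j - f x i j) < e / 2.
  exact: (cf _ nf).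
have ng' : \forall y \near x, forall i j, modulus (g y i j - g x i j) < e / 2.
  exact: (cg _ ng).
apply: filterS2 nf' ng' => y hf hg; apply: H => i j.
rewrite !mxE; have -> : f y i j + g y i j - (f x i j + g x i j) =
  (f y i j - f x i j) + (g y i j - g x i j) by ring.
by apply: (le_lt_trans (modulus_leD _ _)); have := hf i j; have := hg i j; lra.
Qed.

Definition sqnorm p q (y : 'M[C]_(p, q)) : R := \sum_i \sum_j modulus (y i j) ^+ 2.

Lemma sqnorm_ge0 p q (y : 'M[C]_(p, q)) : 0 <= sqnorm y.
Proof. by rewrite sumr_ge0// => i _; rewrite sumr_ge0// => j _; rewrite sqr_ge0. Qed.

Lemma sqnorm0 p q : sqnorm (0 : 'M[C]_(p, q)) = 0.
Proof.
by rewrite /sqnorm big1// => i _; rewrite big1// => j _; rewrite mxE normc0 expr0n.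
Qed.

Lemma sqnorm_ge p q (y : 'M[C]_(p, q)) i j : modulus (y i j) ^+ 2 <= sqnorm y.
Proof.
rewrite /sqnorm (bigD1 i)//= (bigD1 j)//= -addrA lerDl addr_ge0// sumr_ge0//.
  by move=> k _; rewrite sqr_ge0.
by move=> k _; rewrite sumr_ge0// => l _; rewrite sqr_ge0.
Qed.

Lemma continuous_sqnorm p q : continuous (@sqnorm p q).
Proof.
move=> y; apply: (@continuous_sum R 'M[C]_(p, q) _
  (fun i y => \sum_j modulus (y i j) ^+ 2) y) => i.
apply: (@continuous_sum R 'M[C]_(p, q) _ (fun j y => modulus (y i j) ^+ 2) y) => j.
have c : {for y, continuous (fun y : 'M[C]_(p, q) => modulus (y i j))}.
  exact: (cvg_comp _ _ (@coord_continuous _ _ _ i j y) (@continuous_modulus R _)).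
exact: (cvg_comp _ _ c (@exprn_continuous R 2 _)).
Qed.

Lemma upper_jet_shift (h : C -> R) (z : C) :
  upper_jet h z -> upper_jet (fun w => h (z + w)) 0.
Proof.
move=> [c1 [c2 [K [d [d0 K0 H]]]]]; exists c1, c2, K, d; split => // w hw.
by rewrite add0r addr0; exact: H.
Qed.

Lemma compact_annulus (x0 y0 : C) (a b : R) :
  compact [set z : C | a <= modulus (z - x0) /\ modulus (z - y0) <= b].
Proof.
have cl : closed [set z : C | a <= modulus (z - x0) /\ modulus (z - y0) <= b].
  apply: closedI.
    apply: (@preimage_closed C R (fun z => modulus (z - x0)) [set x | a <= x]).
      by move=> z _; exact: continuous_dist.
    exact: closed_ge.
  apply: (@preimage_closed C R (fun z => modulus (z - y0)) [set x | x <= b]).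
    by move=> z _; exact: continuous_dist.
  exact: closed_le.
apply: (subclosed_compact cl) (@compact_disk R (b + modulus y0)) _ => z [_ /= h].
by have := modulus_leD (z - y0) y0; rewrite subrK; lra.
Qed.

End Continuity.

(** * The maximum principle along a curved disc *)

Section MaximumPrincipleCurve.
Context {R : realType}.
Local Notation C := R[i].
Local Notation modulus := (@ComplexField.Normc.normc R).
Import ComplexField.Normc.
Variables (p q : nat) (D : set 'M[C]_(p, q)) (u : 'M[C]_(p, q) -> R).
Variables (phi : C -> 'M[C]_(p, q)) (h : C -> R) (x0 y0 : C) (a b : R).
(** A disc minus an open disc whose centre is unrelated: the Green estimate removes a small
    neighbourhood of [T] from a disc about [0]. *)
Let K : set C := [set z | a <= modulus (z - x0) /\ modulus (z - y0) <= b].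
Let bdry (z : C) := modulus (z - x0) = a \/ modulus (z - y0) = b.
Hypothesis u01 : forall w, D w -> 0 <= u w < 1.
Hypothesis psh_u : psh_on D (fun w => lne (u w)%:E).
Hypothesis openD : forall z, K z -> nbhs (phi z) D.
Hypothesis phi_jet : forall z, K z ->
  forall i j, exists c1 c2, taylor2 (fun w => phi w i j) z c1 c2.
Hypothesis h_cont : forall z, K z -> {for z, continuous h}.
Hypothesis h_jet : forall z, K z -> upper_jet h z.
(** Strictness leaves room to replace [phi z] by nearby points [phi z + y]. *)
Hypothesis u_bdry : forall z, K z -> bdry z -> u (phi z) < expR (h z).

Let T : topologicalType := (C * 'M[C]_(p, q))%type.

Let phi_cont z : K z -> {for z, continuous phi}.
Proof.
move=> Kz; apply: continuous_mx => i j.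
by have [c1 [c2 hc]] := phi_jet Kz i j; exact: taylor2_continuous hc.
Qed.

Let continuous_opp (U : topologicalType) (g : U -> R) (x : U) :
  {for x, continuous g} -> {for x, continuous (fun x => - g x)}.
Proof. by move=> cg; exact: cvgN cg. Qed.

Let D_phi z : K z -> D (phi z).
Proof.
move=> /openD/nbhs_mxP[e e0]; apply => i j.
by rewrite subrr normc0.
Qed.

Let sum_cont (x : T) : K x.1 -> {for x, continuous (fun x : T => phi x.1 + x.2)}.
Proof.
move=> Kx; apply: continuous_mxD.
  exact: (@continuous_fst _ _ _ phi x (phi_cont Kx)).
exact: (@continuous_snd C _ _ id x (fun A hA => hA)).
Qed.

Let u_usc (x : T) : K x.1 -> D (phi x.1 + x.2) -> forall r, u (phi x.1 + x.2) < r ->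
  \forall y \near x, D (phi y.1 + y.2) -> u (phi y.1 + y.2) < r.
Proof.
move=> Kx Dx r ur; have [_ usc _] := psh_u.
have /andP[u0 _] := u01 Dx; have r0 : 0 < r by exact: le_lt_trans ur.
have /usc hu : (lne (u (phi x.1 + x.2))%:E < (ln r)%:E)%E by rewrite lne_ltE.
have hn : \forall y \near x, D (phi y.1 + y.2) ->
    (lne (u (phi y.1 + y.2))%:E < (ln r)%:E)%E.
  exact: (sum_cont Kx (hu Dx)).
apply: filterS hn => y hy Dy.
have /andP[uy0 _] := u01 Dy.
by have := hy Dy; rewrite lne_ltE.
Qed.

Let h_cont1 (x : T) : K x.1 -> {for x, continuous (fun x : T => h x.1)}.
Proof. by move=> Kx; exact: (@continuous_fst _ _ _ h x (h_cont Kx)). Qed.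

Let expR_cont (g : T -> R) (x : T) : {for x, continuous g} ->
  {for x, continuous (fun x => expR (g x))}.
Proof. by move=> cg; exact: (cvg_comp _ _ cg (@continuous_expR R _)). Qed.

(** One radius serves all [z] by compactness of [K]. Near a boundary point the bound persists by
    upper semicontinuity; near any other point the boundary clause is vacuous. *)
Let tube_radius : exists2 d : R, 0 < d & forall y : 'M[C]_(p, q),
  (forall i j, modulus (y i j) <= d) -> forall z, K z ->
    D (phi z + y) /\ (bdry z -> u (phi z + y) < expR (h z)).
Proof.
have : \forall y \near (0 : 'M[C]_(p, q)), forall z, K z ->
    D (phi z + y) /\ (bdry z -> u (phi z + y) < expR (h z)).
  apply: (@tube C 'M[C]_(p, q) K
    (fun z y => D (phi z + y) /\ (bdry z -> u (phi z + y) < expR (h z))) 0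
    (@compact_annulus R x0 y0 a b)) => z Kz.
  have nD : \forall x \near ((z, 0) : T), D (phi x.1 + x.2).
    have Kz1 : K ((z, 0) : T).1 by [].
    have := openD Kz; rewrite -[phi z]addr0 => oD.
    exact: (sum_cont Kz1 oD).
  have [bz|nbz] := pselect (bdry z).
    have us' : \forall x \near ((z, 0) : T), D (phi x.1 + x.2) ->
        u (phi x.1 + x.2) * expR (- h x.1) < 1.
      have Dz0 : D (phi z + 0) by rewrite addr0; exact: D_phi.
      apply: (@usc_mul_continuous R T (fun x => D (phi x.1 + x.2))
        (fun x => u (phi x.1 + x.2)) (fun x => expR (- h x.1)) ((z, 0) : T)).
      - exact: Dz0.
      - by move=> x /u01/andP[].
      - by move=> x; exact: expR_gt0.
      - exact: (@u_usc (z, 0)).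
      - apply: (expR_cont (g := fun x : T => - h x.1)).
        exact: (cvgN (@h_cont1 (z, 0) Kz)).
      - by rewrite /= addr0 expRN ltr_pdivrMr ?expR_gt0// mul1r; exact: u_bdry.
    apply: filterS2 nD us' => x Dx hx Kx; split => // _.
    by have := hx Dx; rewrite expRN ltr_pdivrMr ?expR_gt0// mul1r.
  have a1 : a < modulus (z - x0).
    case: Kz; rewrite le_eqVlt => /predU1P[e|//] _; by case: nbz; left.
  have b1 : modulus (z - y0) < b.
    case: Kz => _; rewrite le_eqVlt => /predU1P[e|//]; by case: nbz; right.
  have na : \forall x \near ((z, 0) : T), a < modulus (x.1 - x0).
    have c : {for (z, 0) : T, continuous (fun x : T => modulus (x.1 - x0))}.
      exact: (@continuous_fst C 'M[C]_(p, q) R (fun w => modulus (w - x0)) ((z, 0) : T) (@continuous_dist R x0 z)).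
    exact: (continuous_near_gt c).
  have nb : \forall x \near ((z, 0) : T), modulus (x.1 - y0) < b.
    have c : {for (z, 0) : T, continuous (fun x : T => modulus (x.1 - y0))}.
      exact: (@continuous_fst C 'M[C]_(p, q) R (fun w => modulus (w - y0)) ((z, 0) : T) (@continuous_dist R y0 z)).
    exact: (continuous_near_lt c).
  apply: filterS3 nD na nb => x Dx ha hb Kx; split => //.
  by case=> e; [move: ha|move: hb]; rewrite e ltxx.
move=> /nbhs_mxP[e e0 H]; exists (e / 2); first by rewrite divr_gt0.
move=> y hy z Kz; apply: H => // i j; rewrite mxE subr0.
by apply: (le_lt_trans (hy i j)); lra.
Qed.

(* Maximize [u (phi z + y) exp (- h z + e |z|^2 - k |y|^2)] over [z] in [K] and small
   [y]. At an interior maximum [(z, y)], compare with the points [(z + w, yy w)] such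
   that [phi (z + w) + yy w] runs through the affine line [phi z + y + w *: phi' z]:
   [u] is log-subharmonic there, and the logarithm of the weight is strictly subharmonic
   up to third order terms. *)
Lemma max_principle_curve z0 : K z0 -> u (phi z0) <= expR (h z0).
Proof.
move=> Kz0; rewrite leNgt; apply/negP => big.
have [dl dl0 tubeP] := tube_radius.
pose Y : set 'M[C]_(p, q) := [set y | forall i j, modulus (y i j) <= dl].
have Y0 : Y 0 by move=> i j; rewrite mxE normc0 ltW.
have DKY z y : K z -> Y y -> D (phi z + y) by move=> Kz Yy; have [] := tubeP y Yy z Kz.
pose B := (b + modulus y0) ^+ 2.
have KB z : K z -> modulus z ^+ 2 <= B.
  move=> [_ hz]; have := modulus_leD (z - y0) y0; rewrite subrK => hz'.
  by rewrite ler_sqr ?nnegrE ?modulus_ge0//; have := modulus_ge0 z; lra.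
have B0 : 0 <= B by exact: sqr_ge0.
have [zh Kzh hmax] : exists2 z, K z & forall w, K w -> - h w <= - h z.
  apply: (@usc_attains_max R C K (fun w => - h w)).
  - exact: compact_annulus.
  - by exists z0.
  - move=> x Kx r hr; have cN : {for x, continuous (fun w => - h w)}.
      exact: continuous_opp (h_cont Kx).
    by apply: (@filterS _ _ (nbhs_filter x)) (continuous_near_lt cN hr) => w hw _.
(* With this [k] the penalty [k * sqnorm y] reaches [|h zh| + 1], which exceeds every value of [- h]
   on [K] by at least 1, as soon as an entry of [y] has modulus [dl]. The maximum therefore stays
   inside [Y]. *)
pose k := (`|h zh| + 1) / dl ^+ 2.
have k0 : 0 < k by rewrite divr_gt0 ?exprn_gt0// ltr_wpDl.
have Dz0 : D (phi z0) by have := DKY z0 0 Kz0 Y0; rewrite addr0.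
have u0 : 0 < u (phi z0) by apply: lt_trans big; exact: expR_gt0.
pose eta := ln (u (phi z0)) - h z0.
have eta0 : 0 < eta by rewrite subr_gt0 -ltr_expR lnK.
(* [e * B < eta] keeps the value of [Psi] at [(z0, 0)] above 1, while the perturbation
   [e * (modulus z ^+ 2 - B)] is nonpositive on [K]. *)
pose e := eta / (B + 1).
have B1 : 0 < B + 1 by rewrite ltr_wpDl.
have e0 : 0 < e by rewrite divr_gt0.
have eB : e * B < eta.
  by rewrite /e mulrAC ltr_pdivrMr// ltr_pM2l//; lra.
pose G (x : T) := - h x.1 + e * (modulus x.1 ^+ 2 - B) - k * sqnorm x.2.
pose Psi (x : T) := u (phi x.1 + x.2) * expR (G x).
pose KY : set T := [set x | K x.1 /\ Y x.2].
have G_cont (x : T) : K x.1 -> {for x, continuous G}.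
  move=> Kx.
  have c1 := h_cont1 Kx.
  have c2 : {for x, continuous (fun x : T => modulus x.1 ^+ 2)}.
    have c : {for x, continuous (fun x : T => modulus x.1)}.
      exact: (@continuous_fst C _ R modulus x (@continuous_modulus R x.1)).
    exact: (cvg_comp _ _ c (@exprn_continuous R 2 _)).
  have c3 : {for x, continuous (fun x : T => sqnorm x.2)}.
    exact: (@continuous_snd C _ R (@sqnorm R p q) x (@continuous_sqnorm R p q x.2)).
  exact: (cvgB (cvgD (cvgN c1) (cvgM (cvg_cst e) (cvgB c2 (cvg_cst B))))
    (cvgM (cvg_cst k) c3)).
have [|||x Kx xmax] := @usc_attains_max R T KY Psi.
- rewrite (_ : KY = K `*` Y); last by [].
  by apply: compact_setX; [exact: compact_annulus|exact: compact_mx_ball].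
- by exists (z0, 0).
- move=> x [Kx Yx] r hr.
  have us : \forall y \near x, D (phi y.1 + y.2) -> u (phi y.1 + y.2) * expR (G y) < r.
    apply: (@usc_mul_continuous R T (fun x => D (phi x.1 + x.2))
      (fun x => u (phi x.1 + x.2)) (fun x => expR (G x)) x) hr.
    - exact: DKY.
    - by move=> y /u01/andP[].
    - by move=> y; exact: expR_gt0.
    - by apply: u_usc => //; exact: DKY.
    - exact: expR_cont (G_cont x Kx).
  by apply: filterS us => y hy [Ky Yy]; apply: hy; exact: DKY.
case: x Kx xmax => z y [/= Kz Yy] xmax.
have Psi1 : 1 < Psi (z, y).
  apply: lt_le_trans (xmax (z0, 0) (conj Kz0 Y0)).
  rewrite /Psi /G /= addr0 sqnorm0 mulr0 subr0 -[u (phi z0)]lnK// -expRD.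
  have : e * (modulus z0 ^+ 2 - B) >= - (e * B).
    by rewrite mulrBr lerDr mulr_ge0 ?sqr_ge0 ?ltW.
  move=> hm; rewrite -[ltLHS]expR0 ltr_expR; move: eB; rewrite /eta; lra.
have Dzy := DKY z y Kz Yy; have /andP[uzy0 uzy1] := u01 Dzy.
have eB0 : e * (modulus z ^+ 2 - B) <= 0.
  by apply: mulr_ge0_le0; [exact: ltW|rewrite subr_le0; exact: KB].
have kN0 : 0 <= k * sqnorm y by apply: mulr_ge0; [exact: ltW|exact: sqnorm_ge0].
have nb : ~ bdry z.
  move=> /(proj2 (tubeP y Yy z Kz)) hu; move: Psi1; rewrite ltNge => /negP; apply.
  apply: (@le_trans _ _ (expR (h z) * expR (G (z, y)))).
    by rewrite ler_wpM2r ?expR_ge0// ltW.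
  rewrite -expRD -[leRHS]expR0 ler_expR /G/=; lra.
have az : a < modulus (z - x0).
  case: (Kz); rewrite le_eqVlt => /predU1P[ee|//] _; by case: nb; left.
have bz : modulus (z - y0) < b.
  case: (Kz) => _; rewrite le_eqVlt => /predU1P[ee|//]; by case: nb; right.
have yin i j : modulus (y i j) < dl.
  rewrite lt_neqAle Yy andbT; apply/eqP => ye.
  move: Psi1; rewrite ltNge => /negP; apply.
  apply: (@le_trans _ _ (1 * expR (G (z, y)))).
    by rewrite ler_wpM2r ?expR_ge0// ltW.
  rewrite mul1r -[leRHS]expR0 ler_expR /G/=.
  have h1 : - h z <= `|h zh|.
    by apply: (le_trans (hmax z Kz)); rewrite -normrN; exact: ler_norm.
  have : `|h zh| + 1 <= k * sqnorm y.
    have -> : `|h zh| + 1 = k * dl ^+ 2 by rewrite /k divfK// gt_eqF ?exprn_gt0.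
    apply: ler_wpM2l; first exact: ltW.
    by have := sqnorm_ge y i j; rewrite ye.
  lra.
have upos : 0 < u (phi z + y).
  rewrite lt_neqAle uzy0 andbT eq_sym; apply/eqP => ue.
  by move: Psi1; rewrite /Psi /= ue mul0r ltr10.
have [c1 hc1] := choice (fun ij : 'I_p * 'I_q => phi_jet Kz ij.1 ij.2).
have {hc1}[c2 hc] := choice hc1.
pose M : 'M[C]_(p, q) := \matrix_(i, j) c1 (i, j).
pose yy (w : C) : 'M[C]_(p, q) := y + phi z + w *: M - phi (z + w).
have yyE w i j : yy w i j = y i j - (phi (z + w) i j - (phi z i j + c1 (i, j) * w)).
  by rewrite !mxE; ring.
have yy0 : yy 0 = y by rewrite /yy addr0 scale0r addr0 addrK.
(* The last summand is the linear part of [- e * modulus (z + w) ^+ 2]; the quadratic part of that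
   term is the strict gain [- e * modulus w ^+ 2]. *)
pose H w := h (z + w) + k * sqnorm (yy w) + complex.Re (- ((2 * e)%:C%C * z^*%C) * w).
have jH : upper_jet H 0.
  apply: upper_jetD; last exact: upper_jet_lin.
  apply: upper_jetD; first exact: upper_jet_shift (h_jet Kz).
  apply: upper_jetZ; first exact: ltW.
  apply: upper_jet_sum => i; apply: upper_jet_sum => j.
  have [L [d [d0 L0 hL]]] := hc (i, j).
  (* The linear part of [phi] is subtracted in [yy], so its entries have no linear term, as
     [upper_jet_sqr] requires. *)
  apply: (@upper_jet_sqr _ _ (y i j) (- c2 (i, j)) L d) => // w hw.
  rewrite yyE; apply: le_trans (hL w hw); rewrite -modulusN /=.
  by rewrite le_eqVlt; apply/orP; left; apply/eqP; congr (modulus _); ring.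
have near0 : exists2 d : R, 0 < d & forall w : C, modulus w <= d -> K (z + w) /\ Y (yy w).
  have nyy : \forall w \near (0 : C), forall i j, modulus (yy w i j) < dl.
    apply: (@filter_forall _ _ _ _ (nbhs_filter (0 : C))) => i.
    apply: (@filter_forall _ _ _ _ (nbhs_filter (0 : C))) => j.
    have [L L0 [d d0 hL]] := taylor2_lipschitz (hc (i, j)).
    pose S := L + modulus (c1 (i, j)).
    have S0 : 0 < S by rewrite ltr_wpDr ?modulus_ge0.
    apply/nbhs_complexP; exists (Num.min d ((dl - modulus (y i j)) / S)).
      by rewrite lt_min d0 divr_gt0// subr_gt0.
    move=> w; rewrite subr0 lt_min => /andP[/ltW/hL hw]; rewrite ltr_pdivlMr// => hw2.
    rewrite yyE; apply: (le_lt_trans (modulus_leB _ _)).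
    have -> : phi (z + w) i j - (phi z i j + c1 (i, j) * w) =
      (phi (z + w) i j - phi z i j) - c1 (i, j) * w by ring.
    have := modulus_leB (phi (z + w) i j - phi z i j) (c1 (i, j) * w).
    rewrite normcM; move: hw2 hw => /=; rewrite /S mulrDr; lra.
  move: nyy => /nbhs_complexP[d d0 hd].
  exists (Num.min (d / 2) (Num.min (modulus (z - x0) - a) (b - modulus (z - y0)))).
    by rewrite !lt_min divr_gt0// !subr_gt0 az.
  move=> w; rewrite !le_min => /andP[w1 /andP[w2 w3]]; split; last first.
    by move=> i j; apply: ltW; apply: hd; rewrite subr0; lra.
  split.
    have := modulus_lerD (z - x0) w; have -> : z - x0 + w = z + w - x0 by ring.
    lra.
  have := modulus_leD (z - y0) w; have -> : z - y0 + w = z + w - y0 by ring.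
  lra.
have [d d0 hd] := near0.
apply: (@no_interior_psh_max R p q D u (phi z + y) M H e d) => // w hw.
have [Kw Yw] := hd w hw.
have E : phi (z + w) + yy w = phi z + y + w *: M.
  by rewrite /yy addrC subrK (addrC y).
have Dw := DKY _ _ Kw Yw; rewrite E in Dw; split => // uw.
have := xmax (z + w, yy w) (conj Kw Yw).
rewrite /Psi /= E -[u (phi z + y + _)]lnK// -[u (phi z + y)]lnK// -!expRD ler_expR.
rewrite !expRK /G /H /= yy0 addr0 mulr0.
have -> : modulus (z + w) ^+ 2 = modulus z ^+ 2 + 2 * complex.Re (z^*%C * w) + modulus w ^+ 2.
  exact: modulus_sqrD.
have -> : complex.Re (- ((2 * e)%:C%C * z^*%C) * w) = - (2 * e) * complex.Re (z^*%C * w).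
  rewrite !Re_mul Re_opp Im_opp Re_mul Im_mul/=; ring.
have -> : complex.Re (0 : C) = 0 by [].
lra.
Qed.

End MaximumPrincipleCurve.

(** * The spectral ball *)

Section SpectralBall.
Context {R : realType}.
Local Notation C := R[i].
Local Notation modulus := (@ComplexField.Normc.normc R).
Import ComplexField.Normc.

Lemma char_poly_roots n (A : 'M[C]_n) :
  exists s : seq C, char_poly A = \prod_(x <- s) ('X - x%:P).
Proof.
have [s hs] := closed_field_poly_normal (char_poly A); exists s.
by rewrite hs (monicP (char_poly_monic A)) scale1r.
Qed.

Lemma eigenvalue_char_poly n (A : 'M[C]_n) (s : seq C) (a : C) :
  char_poly A = \prod_(x <- s) ('X - x%:P) -> eigenvalue A a = (a \in s).
Proof. by move=> h; rewrite eigenvalue_root_char h root_prod_XsubC. Qed.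

Lemma spectral_ballP n (A : 'M[C]_n) :
  spectral_ball n A <-> forall a, eigenvalue A a -> modulus a < 1.
Proof.
have [s hs] := char_poly_roots A.
have eE := eigenvalue_char_poly _ hs.
pose m := \big[Num.max/0]_(x <- s) modulus x.
have ub : ubound [set modulus a | a in [set a : C | eigenvalue A a]] m.
  by move=> x [a /=]; rewrite eE => sa <-; apply: le_bigmax_seq.
split => [h a ha|h].
  apply: le_lt_trans h; apply: ub_le_sup; first by exists m.
  by exists a.
rewrite /spectral_ball /= /spectral_radius.
(* Without eigenvalues the set of moduli is empty, and its supremum is 0 by convention. *)
have [[a ha]|ne] := pselect (exists a, eigenvalue A a); last first.
  rewrite (_ : [set modulus a | a in _] = set0) ?sup0//.
  by rewrite -subset0 => x [a ha _]; apply: ne; exists a.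
apply: (@le_lt_trans _ _ m).
  by apply: ge_sup => //; exists (modulus a), a.
rewrite /m big_seq; apply: bigmax_lt => // x sx; apply: h; by rewrite eE.
Qed.

Lemma eigenvalue_unitmx n (A : 'M[C]_n) (a : C) :
  eigenvalue A a = (a%:M - A \notin unitmx).
Proof.
rewrite unitmxE unitfE negbK; apply/eigenvalueP/det0P => -[v].
  by move=> vA v0; exists v => //; rewrite mulmxBr mul_mx_scalar vA subrr.
move=> v0 h; exists v => //; apply/eqP; rewrite eq_sym -subr_eq0.
by rewrite -mul_mx_scalar -mulmxBr h.
Qed.

Lemma resolvent_unitmx n (A : 'M[C]_n) (y : C) : spectral_ball n A ->
  modulus y <= 1 -> 1%:M - y *: A \in unitmx.
Proof.
move=> /spectral_ballP hA y1; have [->|y0] := eqVneq y 0.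
  by rewrite scale0r subr0 unitmx1.
have -> : 1%:M - y *: A = y *: (y^-1%:M - A).
  by rewrite scalerBr scale_scalar_mx divff.
rewrite unitmxZ ?unitfE//; apply: contraT; rewrite -eigenvalue_unitmx => /hA.
by rewrite normcV ltNge invf_ge1 ?modulus_gt0// y1.
Qed.

(** Together with [resolvent_unitmx] this describes the ball by the nonvanishing of a determinant
    over the compact disc [modulus y <= 1]. Openness then follows from the tube lemma, without
    continuity of eigenvalues. *)
Lemma spectral_ball_resolvent n (A : 'M[C]_n) :
  (forall y, modulus y <= 1 -> \det (1%:M - y *: A) != 0) -> spectral_ball n A.
Proof.
move=> h; apply/spectral_ballP => a ha; rewrite ltNge; apply/negP => a1.
have a0 : a != 0 by rewrite -modulus_gt0; lra.
have : modulus a^-1 <= 1 by rewrite normcV invf_le1// modulus_gt0.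
move=> /h; rewrite -unitfE -unitmxE.
have -> : 1%:M - a^-1 *: A = a^-1 *: (a%:M - A).
  by rewrite scalerBr scale_scalar_mx mulVf.
by rewrite unitmxZ ?unitfE ?invr_eq0// (negbTE (_ : a%:M - A \notin unitmx))// -eigenvalue_unitmx.
Qed.

Lemma continuous_det (T : topologicalType) n (F : T -> 'M[C]_n) (x : T) :
  (forall i j, {for x, continuous (fun t => F t i j)}) ->
  {for x, continuous (fun t => \det (F t))}.
Proof.
move=> cF; have sumc (I : finType) (g : I -> T -> C) :
    (forall i, {for x, continuous (g i)}) -> {for x, continuous (fun t => \sum_i g i t)}.
  move=> h; elim: (index_enum I) => [|i s ih].
    have -> : (fun t => \sum_(i <- [::]) g i t) = fun=> 0.
      by apply/funext => t; rewrite big_nil.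
    exact: cvg_cst.
  have -> : (fun t => \sum_(j <- i :: s) g j t) = (fun t => g i t + \sum_(j <- s) g j t).
    by apply/funext => t; rewrite big_cons.
  exact: (cvgD (h i) ih).
have prodc (I : finType) (g : I -> T -> C) :
    (forall i, {for x, continuous (g i)}) -> {for x, continuous (fun t => \prod_i g i t)}.
  move=> h; elim: (index_enum I) => [|i s ih].
    have -> : (fun t => \prod_(i <- [::]) g i t) = fun=> 1.
      by apply/funext => t; rewrite big_nil.
    exact: cvg_cst.
  have -> : (fun t => \prod_(j <- i :: s) g j t) = (fun t => g i t * \prod_(j <- s) g j t).
    by apply/funext => t; rewrite big_cons.
  exact: (cvgM (h i) ih).
rewrite /determinant; apply: sumc => s; apply: cvgM; first exact: cvg_cst.
by apply: prodc => i; exact: cF.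
Qed.

Lemma open_spectral_ball n (A : 'M[C]_n) :
  spectral_ball n A -> exists2 e : R, 0 < e &
    forall M : 'M[C]_n, (forall i j, modulus (M i j - A i j) < e) -> spectral_ball n M.
Proof.
move=> hA; pose T : topologicalType := (C * 'M[C]_n)%type.
pose good (M : 'M[C]_n) := forall y : C, modulus y <= 1 ->
  0 < modulus (\det (1%:M - y *: M)).
have nA : nbhs A good.
  apply: (@tube C 'M[C]_n [set y : C | modulus y <= 1]
    (fun y M => 0 < modulus (\det (1%:M - y *: M))) A (@compact_disk R 1)) => y /= y1.
  have c : {for (y, A) : T, continuous (fun t : T => \det (1%:M - t.1 *: t.2))}.
    apply: continuous_det => i j.
    have -> : (fun t : T => (1%:M - t.1 *: t.2) i j) =
        (fun t : T => (1%:M : 'M[C]_n) i j - t.1 * t.2 i j).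
      by apply/funext => t; rewrite !mxE.
    have c2 : {for (y, A) : T, continuous (fun t : T => t.2 i j)}.
      exact: (@continuous_snd C 'M[C]_n C (fun M => M i j) ((y, A) : T) (@coord_continuous _ _ _ i j A)).
    have c1 : {for (y, A) : T, continuous (fun t : T => t.1)}.
      exact: (@continuous_fst C 'M[C]_n C id ((y, A) : T) (fun B hB => hB)).
    exact: (cvgB (cvg_cst _) (cvgM c1 c2)).
  have cm : {for (y, A) : T, continuous (fun t : T => modulus (\det (1%:M - t.1 *: t.2)))}.
    exact: (cvg_comp _ _ c (@continuous_modulus R _)).
  have pos : 0 < modulus (\det (1%:M - ((y, A) : T).1 *: ((y, A) : T).2)).
    by rewrite modulus_gt0 -unitfE -unitmxE; exact: resolvent_unitmx.
  by apply: filterS (continuous_near_gt cm pos).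
have [e e0 h] := (nbhs_mxP good A).1 nA.
exists e; [exact: e0|move=> M /h hM].
by apply: spectral_ball_resolvent => y /hM; rewrite modulus_gt0.
Qed.

End SpectralBall.

Section SplitPolynomials.
Context {F : fieldType}.

Lemma perm_eq_prod_XsubC (s t : seq F) :
  \prod_(x <- s) ('X - x%:P) = \prod_(x <- t) ('X - x%:P) -> perm_eq s t.
Proof.
elim: s t => [|x s ih] t h.
  have := congr1 (fun p : {poly F} => size p) h.
  by rewrite !size_prod_XsubC /= => -[/esym/size0nil ->].
have xt : x \in t.
  by rewrite -root_prod_XsubC -h root_prod_XsubC mem_head.
have pt := perm_to_rem xt.
rewrite perm_sym (perm_trans pt)// perm_cons perm_sym; apply: ih.
have := h; rewrite (perm_big _ pt)/= !big_cons.
by apply: mulfI; rewrite polyXsubC_eq0.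
Qed.

End SplitPolynomials.

Section MatrixConjugation.
Context {F : fieldType} (n' : nat).
Local Notation n := n'.+1.

Lemma trig_mulmx_diag (A B : 'M[F]_n) (i : 'I_n) : is_trig_mx A -> is_trig_mx B ->
  (A *m B) i i = A i i * B i i.
Proof.
move=> /is_trig_mxP hA /is_trig_mxP hB; rewrite mxE (bigD1 i)//= big1 ?addr0// => j ji.
case: (ltngtP i j) => [ij|ji'|/val_inj e]; last by rewrite e eqxx in ji.
  by rewrite hA// mul0r.
by rewrite hB// mulr0.
Qed.

Lemma trig_mulmx (A B : 'M[F]_n) : is_trig_mx A -> is_trig_mx B -> is_trig_mx (A *m B).
Proof.
move=> /is_trig_mxP hA /is_trig_mxP hB; apply/is_trig_mxP => i j ij.
rewrite mxE big1// => k _; have [ik|ki] := ltnP i k; first by rewrite hA// mul0r.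
by rewrite hB ?mulr0// (leq_ltn_trans ki).
Qed.

Lemma trig_expr (A : 'M[F]_n) k : is_trig_mx A ->
  is_trig_mx (A ^+ k) /\ forall i, (A ^+ k) i i = A i i ^+ k.
Proof.
move=> tA; elim: k => [|k [ih1 ih2]].
  by split => [|i]; rewrite !expr0 ?mxE ?eqxx//; exact: scalar_mx_is_trig.
rewrite exprS; split => [|i]; first exact: trig_mulmx.
by rewrite -[A * _]/(A *m _) trig_mulmx_diag// ih2 exprS.
Qed.

Lemma conj_mulmx (P A B : 'M[F]_n) : P \in unitmx ->
  (P *m A *m invmx P) *m (P *m B *m invmx P) = P *m (A *m B) *m invmx P.
Proof. by move=> uP; rewrite !mulmxA mulmxKV. Qed.

Lemma conj_expr (P A : 'M[F]_n) k : P \in unitmx ->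
  (P *m A *m invmx P) ^+ k = P *m A ^+ k *m invmx P.
Proof.
move=> uP; elim: k => [|k ih]; first by rewrite !expr0 mulmx1 mulmxV.
by rewrite !exprS ih -![_ * _]/(_ *m _) conj_mulmx.
Qed.

Lemma char_poly_conj (P A : 'M[F]_n) : P \in unitmx ->
  char_poly (P *m A *m invmx P) = char_poly A.
Proof.
move=> uP; pose Q : 'M[{poly F}]_n := map_mx polyC P.
pose Q' : 'M[{poly F}]_n := map_mx polyC (invmx P).
have QQ : Q *m Q' = 1%:M by rewrite -map_mxM mulmxV// map_mx1.
have -> : char_poly (P *m A *m invmx P) = \det (Q *m char_poly_mx A *m Q').
  congr (\det _); rewrite /char_poly_mx mulmxBr mulmxBl mul_mx_scalar -scalemxAl QQ.
  by rewrite !map_mxM scale_scalar_mx mulr1.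
by rewrite !det_mulmx mulrAC -det_mulmx QQ det1 mul1r.
Qed.

End MatrixConjugation.

(** * Moebius transforms of matrices *)

Section MatrixMoebius.
Context {R : realType}.
Local Notation C := R[i].
Local Notation modulus := (@ComplexField.Normc.normc R).
Import ComplexField.Normc.
Variables (n' : nat).
Local Notation n := n'.+1.

Definition moebius (c x : C) : C := (x - c) / (1 - c^*%C * x).

Definition mx_moebius (c : C) (M : 'M[C]_n) : 'M[C]_n :=
  (M - c%:M) *m invmx (1%:M - c^*%C *: M).

Lemma moebius_denom_neq0 (c x : C) : modulus c < 1 -> modulus x <= 1 ->
  1 - c^*%C * x != 0.
Proof.
move=> c1 x1; rewrite -modulus_gt0.
have := modulus_lerB 1 (c^*%C * x); rewrite normc1 normcM modulus_conj.
have : modulus c * modulus x <= modulus c by rewrite ler_piMr ?modulus_ge0.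
lra.
Qed.

Lemma moebius_identity (c x : C) :
  modulus (1 - c^*%C * x) ^+ 2 - modulus (x - c) ^+ 2 =
  (1 - modulus c ^+ 2) * (1 - modulus x ^+ 2).
Proof. by rewrite !modulus_sqr; case: c x => a b [d e] /=; ring. Qed.

Lemma moebius_lt1 (c x : C) : modulus c < 1 -> modulus x < 1 ->
  modulus (moebius c x) < 1.
Proof.
move=> c1 x1; have d := moebius_denom_neq0 c1 (ltW x1).
rewrite modulus_div ltr_pdivrMr ?modulus_gt0// mul1r.
rewrite -ltr_sqr ?nnegrE ?modulus_ge0// -subr_gt0 moebius_identity mulr_gt0//.
  by rewrite subr_gt0 -[ltRHS](expr1n _ 2) ltr_sqr ?nnegrE ?modulus_ge0.
by rewrite subr_gt0 -[ltRHS](expr1n _ 2) ltr_sqr ?nnegrE ?modulus_ge0.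
Qed.

(** [A] commutes with its Moebius transform, so both become triangular in one basis; on the diagonal
    the relation [VU] then reads [V i i = moebius c (U i i)]. *)
Lemma trace_mx_moebius (c : C) (A : 'M[C]_n) (s : seq C) (k : nat) :
  modulus c < 1 -> spectral_ball n A ->
  char_poly A = \prod_(x <- s) ('X - x%:P) ->
  \tr (mx_moebius c A ^+ k) = \sum_(x <- s) moebius c x ^+ k.
Proof.
move=> c1 hA hs; set B := mx_moebius c A.
have uA : 1%:M - c^*%C *: A \in unitmx.
  by apply: resolvent_unitmx => //; rewrite modulus_conj ltW.
have AD : A *m (1%:M - c^*%C *: A) = (1%:M - c^*%C *: A) *m A.
  by rewrite mulmxBr mulmxBl mulmx1 mul1mx -scalemxAr -scalemxAl.
have AI : A *m invmx (1%:M - c^*%C *: A) = invmx (1%:M - c^*%C *: A) *m A.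
  set D := 1%:M - c^*%C *: A in uA AD *.
  by rewrite -[X in X *m invmx D](mulKmx uA A) -AD -!mulmxA mulmxV// mulmx1.
have AB : A *m B = B *m A.
  rewrite /B /mx_moebius -(mulmxA (A - c%:M)) -AI !mulmxA; congr (_ *m _).
  by rewrite mulmxBr mulmxBl mul_mx_scalar mul_scalar_mx.
have BD : B *m (1%:M - c^*%C *: A) = A - c%:M by rewrite /B /mx_moebius mulmxKV.
have [P /unitarymx_unit uP /andP[]] := cotrigonalization2 AB.
rewrite /similar_to /= !conjumx//.
set U := P *m A *m invmx P; set V := P *m B *m invmx P => tU tV.
have cU : char_poly A = \prod_(i < n) ('X - (U i i)%:P).
  exact: etrans (esym (char_poly_conj A uP)) (char_poly_trig tU).
have VU : V *m (1%:M - c^*%C *: U) = U - c%:M.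
  have -> : 1%:M - c^*%C *: U = P *m (1%:M - c^*%C *: A) *m invmx P.
    by rewrite mulmxBr mulmx1 mulmxBl mulmxV// /U -scalemxAr -scalemxAl.
  set D := 1%:M - c^*%C *: A in BD *.
  have -> : V *m (P *m D *m invmx P) = P *m (B *m D) *m invmx P.
    exact: conj_mulmx.
  rewrite BD mulmxBr mulmxBl; congr (_ - _).
  by rewrite mul_mx_scalar -scalemxAl mulmxV// scalemx1.
have VB : V ^+ k = P *m B ^+ k *m invmx P by exact: conj_expr.
clearbody U V.
have sE : perm_eq s [seq U i i | i <- index_enum 'I_n].
  by apply: perm_eq_prod_XsubC; rewrite -hs cU big_map.
have tU' : is_trig_mx (1%:M - c^*%C *: U).
  apply/is_trig_mxP => i j ij; rewrite !mxE (is_trig_mxP tU)// mulr0 subr0.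
  by rewrite -val_eqE (ltn_eqF ij).
have Vd i : V i i = moebius c (U i i).
  have := congr1 (fun M : 'M[C]_n => M i i) VU; rewrite trig_mulmx_diag// !mxE eqxx.
  move=> h; apply: (canRL (mulfK _)); last by rewrite h mulr1n.
  apply: moebius_denom_neq0 => //; apply: ltW; move/spectral_ballP: hA; apply.
  by rewrite (eigenvalue_char_poly _ hs) (perm_mem sE); apply/mapP; exists i; rewrite ?mem_index_enum.
have [_ Vkd] := trig_expr k tV.
have -> : \tr (B ^+ k) = \tr (V ^+ k) by rewrite VB mxtrace_mulC mulmxA mulVmx// mul1mx.
rewrite (perm_big _ sE)/= big_map /mxtrace.
by apply: eq_bigr => i _; rewrite Vkd Vd.
Qed.

Lemma mx_moebius_scalar (c : C) : mx_moebius c c%:M = 0.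
Proof. by rewrite /mx_moebius subrr mul0mx. Qed.

End MatrixMoebius.

(** * Lower bound for the Lempert function *)

Section DerivableMatrix.
Context {R : realType}.
Local Notation C := R[i].

Lemma derivable_entry p q (f : C -> 'M[C]_(p, q)) (z : C) i j :
  derivable f z 1 -> derivable (fun w => f w i j) z 1.
Proof.
move=> /cvg_ex[/= l hl]; apply/cvg_ex; exists (l i j).
have := cvg_comp _ _ hl (@coord_continuous _ _ _ i j l).
apply: cvg_trans; apply: near_eq_cvg; apply: nearW => w /=.
by rewrite !mxE.
Qed.

Lemma derivable_bigsum (I : Type) (r : seq I) (P : pred I) (g : I -> C -> C) (z : C) :
  (forall i, derivable (g i) z 1) -> derivable (fun w => \sum_(i <- r | P i) g i w) z 1.
Proof.
move=> h; elim: r => [|i s ih].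
  have -> : (fun w => \sum_(i <- [::] | P i) g i w) = fun=> 0.
    by apply/funext => t; rewrite big_nil.
  exact: derivable_cst.
have -> : (fun w => \sum_(j <- i :: s | P j) g j w) =
    (fun w => (if P i then g i w else 0) + \sum_(j <- s | P j) g j w).
  by apply/funext => t; rewrite big_cons; case: ifP => // _; rewrite add0r.
case: (P i); first exact: (derivableD (h i) ih).
exact: (derivableD (derivable_cst _ _ _) ih).
Qed.

Lemma derivable_bigprod (I : Type) (r : seq I) (g : I -> C -> C) (z : C) :
  (forall i, derivable (g i) z 1) -> derivable (fun w => \prod_(i <- r) g i w) z 1.
Proof.
move=> h; elim: r => [|i s ih].
  have -> : (fun w => \prod_(i <- [::]) g i w) = fun=> 1.
    by apply/funext => t; rewrite big_nil.
  exact: derivable_cst.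
have -> : (fun w => \prod_(j <- i :: s) g j w) = (fun w => g i w * \prod_(j <- s) g j w).
  by apply/funext => t; rewrite big_cons.
exact: (derivableM (h i) ih).
Qed.

Lemma derivable_det n (F : C -> 'M[C]_n) (z : C) :
  (forall i j, derivable (fun w => F w i j) z 1) -> derivable (fun w => \det (F w)) z 1.
Proof.
move=> h; rewrite /determinant; apply: derivable_bigsum => s.
apply: (derivableM (derivable_cst _ _ _)).
by apply: derivable_bigprod => i; exact: h.
Qed.

Lemma derivable_mulmx p q r (F : C -> 'M[C]_(p, q)) (G : C -> 'M[C]_(q, r)) (z : C) :
  (forall i j, derivable (fun w => F w i j) z 1) ->
  (forall i j, derivable (fun w => G w i j) z 1) ->
  forall i j, derivable (fun w => (F w *m G w) i j) z 1.
Proof.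
move=> hF hG i j; have -> : (fun w => (F w *m G w) i j) =
    (fun w => \sum_k F w i k * G w k j) by apply/funext => w; rewrite mxE.
by apply: derivable_bigsum => k; exact: (derivableM (hF i k) (hG k j)).
Qed.

Lemma derivable_invmx n (F : C -> 'M[C]_n) (z : C) :
  (\forall w \near z, F w \in unitmx) ->
  (forall i j, derivable (fun w => F w i j) z 1) ->
  forall i j, derivable (fun w => invmx (F w) i j) z 1.
Proof.
move=> uF hF i j.
have uz : F z \in unitmx by case/nbhs_complexP: uF => e e0; apply; rewrite subrr ComplexField.Normc.normc0.
have d : derivable (fun w => (\det (F w))^-1 * (\adj (F w)) i j) z 1.
  apply: derivableM.
    apply: derivableV; first by rewrite -unitfE -unitmxE.
    exact: derivable_det.
  have -> : (fun w => (\adj (F w)) i j) = (fun w => cofactor (F w) j i).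
    by apply/funext => w; rewrite mxE.
  apply: (derivableM (derivable_cst _ _ _)); apply: derivable_det => k l.
  have -> : (fun w => (row' j (col' i (F w))) k l) = (fun w => F w (lift j k) (lift i l)).
    by apply/funext => w; rewrite !mxE.
  exact: hF.
apply: near_eq_derivable d.
apply: (@filterS _ _ (nbhs_filter z)) uF => w uw.
by rewrite /invmx uw [RHS]mxE.
Qed.

End DerivableMatrix.

Section MoebiusLowerBound.
Context {R : realType}.
Local Notation C := R[i].
Local Notation modulus := (@ComplexField.Normc.normc R).
Import ComplexField.Normc.

Lemma modulus_sum_le (I : Type) (r : seq I) (P : pred I) (f : I -> C) (b : R) :
  0 <= b -> (forall i, P i -> modulus (f i) <= b) ->
  modulus (\sum_(i <- r | P i) f i) <= (size r)%:R * b.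
Proof.
move=> b0 h; elim: r => [|i r ih]; first by rewrite big_nil normc0 mul0r.
rewrite big_cons /= -natr1 mulrDl mul1r; case: ifP => Pi.
  by apply: (le_trans (modulus_leD _ _)); rewrite addrC lerD// h.
by rewrite ler_wpDr.
Qed.

Lemma size_index_enum_ord m : size (index_enum 'I_m) = m.
Proof. by rewrite -[RHS](size_enum_ord m) enumT. Qed.

Lemma modulus_expr_entry n' (M : 'M[C]_n'.+1) (b : R) k :
  0 <= b -> (forall i j, modulus (M i j) <= b) ->
  forall i j, modulus ((M ^+ k.+1) i j) <= (n'.+1%:R * b) ^+ k.+1.
Proof.
move=> b0 h; have n1 : 1 <= n'.+1%:R :> R by rewrite ler1n.
elim: k => [|k ih] i j.
  by rewrite !expr1; apply: (le_trans (h i j)); rewrite ler_peMl.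
rewrite exprS [X in modulus X]mxE.
apply: (@le_trans _ _ ((size (index_enum 'I_n'.+1))%:R * (b * (n'.+1%:R * b) ^+ k.+1))).
  apply: modulus_sum_le => [|l _]; first by rewrite mulr_ge0// exprn_ge0// mulr_ge0.
  by rewrite normcM ler_pM ?modulus_ge0.
by rewrite size_index_enum_ord [in leRHS]exprS mulrA.
Qed.

Lemma geometric_small (q e : R) : 0 <= q < 1 -> 0 < e -> exists k : nat, q ^+ k < e.
Proof.
move=> /andP[q0 q1] e0; have : `|q| < 1 by rewrite ger0_norm.
move=> /cvg_expr/cvgrPdist_lt/(_ e e0)[N _ /(_ N (leqnn N))] /=.
by rewrite sub0r normrN ger0_norm ?exprn_ge0//; exists N.
Qed.

(** Near the unit circle the Moebius map with zero [al] has modulus close to 1, so the modulus of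
    its inverse is at most a [q] only slightly above 1. *)
Lemma moebius_circle_bound (al : C) (l : R) : modulus al < l -> l < 1 ->
  exists rho q : R, [/\ modulus al < rho, rho < 1, 1 <= q, modulus al * q < l &
    forall z : C, modulus z = rho -> modulus (1 - al^*%C * z) <= q * modulus (z - al)].
Proof.
set s := modulus al => sl l1; have s0 : 0 <= s by exact: modulus_ge0.
pose d := (l - s) / 2; have d0 : 0 < d by rewrite divr_gt0// subr_gt0.
(* The first bound keeps the circle away from [al]; the second makes the defect in
   [moebius_identity], at most [2 * t], no larger than [2 * d * modulus (z - al) ^+ 2]. *)
pose t := Num.min ((1 - s) / 2) (d * (1 - s) ^+ 2 / 4).
have s1 : 0 < 1 - s by lra.
have t0 : 0 < t by rewrite lt_min !divr_gt0// mulr_gt0// exprn_gt0.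
have t1 : t <= (1 - s) / 2 by rewrite ge_min lexx.
have t2 : t <= d * (1 - s) ^+ 2 / 4 by rewrite ge_min lexx orbT.
exists (1 - t), (1 + d); split; [lra|lra|lra| |].
  have : s * d <= 1 * d by rewrite ler_wpM2r//; lra.
  by rewrite mulrDr /d; lra.
move=> z hz; have za : (1 - s) / 2 <= modulus (z - al).
  by have := modulus_lerB z al; rewrite hz -/s; lra.
rewrite -ler_sqr ?nnegrE ?mulr_ge0 ?modulus_ge0//; last by lra.
have := moebius_identity al z; rewrite -/s hz => e.
set m := modulus (z - al) in za e *.
have m2 : ((1 - s) / 2) ^+ 2 <= m ^+ 2 by rewrite ler_sqr ?nnegrE; lra.
have e2 : ((1 - s) / 2) ^+ 2 = (1 - s) ^+ 2 / 4 by field.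
have e3 : (1 - s ^+ 2) * (1 - (1 - t) ^+ 2) <= 2 * t.
  have h1 : 1 - (1 - t) ^+ 2 = 2 * t - t ^+ 2 by ring.
  have : 0 <= t ^+ 2 by exact: sqr_ge0.
  have : (1 - s ^+ 2) * (1 - (1 - t) ^+ 2) <= 1 * (1 - (1 - t) ^+ 2).
    rewrite ler_wpM2r//; last by rewrite lerBlDr lerDl sqr_ge0.
    rewrite h1 expr2 -mulrBl mulr_ge0//; lra.
  lra.
have e4 : 2 * t <= 2 * d * m ^+ 2.
  have : d * ((1 - s) ^+ 2 / 4) <= d * m ^+ 2 by rewrite ler_wpM2l -?e2// ltW.
  lra.
have -> : ((1 + d) * m) ^+ 2 = m ^+ 2 + 2 * d * m ^+ 2 + d ^+ 2 * m ^+ 2 by ring.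
have : 0 <= d ^+ 2 * m ^+ 2 by rewrite mulr_ge0 ?sqr_ge0.
lra.
Qed.

Lemma derivable_mx_lipschitz n (f : C -> 'M[C]_n) (z : C) :
  (forall i j, f z i j = 0) -> (forall i j, derivable (fun w => f w i j) z 1) ->
  exists2 L : R, 0 < L & exists2 d : R, 0 < d &
  forall w, modulus w <= d -> forall i j, modulus (f (z + w) i j) <= L * modulus w.
Proof.
move=> f0 df; have h (ij : 'I_n * 'I_n) : exists Ld : R * R, [/\ 0 < Ld.1, 0 < Ld.2 &
    forall w, modulus w <= Ld.2 -> modulus (f (z + w) ij.1 ij.2) <= Ld.1 * modulus w].
  have [L L0 [d d0 hd]] := complex_diff_lipschitz (derivable_complex_diff (df ij.1 ij.2)).
  by exists (L, d); split => // w /hd; rewrite f0 subr0.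
have [Ld hLd] := choice h.
pose L := 1 + \sum_ij (Ld ij).1.
have L0 : 0 < L by rewrite ltr_wpDr// sumr_ge0// => ij _; have [/ltW] := hLd ij.
exists L => //; pose d := \big[Num.min/1]_ij (Ld ij).2; exists d.
  by apply: lt_bigmin => // ij _; have [] := hLd ij.
move=> w hw i j; have [_ _ hd] := hLd (i, j).
apply: (@le_trans _ _ ((Ld (i, j)).1 * modulus w)).
  by apply: hd; apply: (le_trans hw); exact: bigmin_le.
rewrite ler_wpM2r ?modulus_ge0// /L (bigD1 (i, j))//= addrCA lerDl addr_ge0//.
by rewrite sumr_ge0// => ij _; have [/ltW] := hLd ij.
Qed.

Variable n' : nat.
Local Notation n := n'.+1.
Variables (c : C) (phi : C -> 'M[C]_n) (al : C).
Hypothesis c1 : modulus c < 1.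
Hypothesis al1 : modulus al < 1.
Hypothesis phi_in : forall z, modulus z < 1 -> spectral_ball n (phi z).
Hypothesis phi_derivable : forall z, modulus z < 1 -> derivable phi z 1.
Hypothesis phi_al : phi al = c%:M.

Let psi z := mx_moebius c (phi z).

Let near_disk (z : C) : modulus z < 1 -> \forall w \near z, modulus w < 1.
Proof.
move=> z1; apply/nbhs_complexP; exists (1 - modulus z); first by rewrite subr_gt0.
by move=> w hw; have := modulus_leD (w - z) z; rewrite subrK; lra.
Qed.

Let psi_derivable z i j : modulus z < 1 -> derivable (fun w => psi w i j) z 1.
Proof.
move=> z1; have dphi k l : derivable (fun w => phi w k l) z 1.
  by apply: derivable_entry; exact: phi_derivable.
apply: derivable_mulmx => [k l|k l].
  have -> : (fun w => (phi w - c%:M) k l) = (fun w => phi w k l - (c%:M : 'M[C]_n) k l).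
    by apply/funext => w; rewrite !mxE.
  exact: (derivableB (dphi k l) (derivable_cst _ _ _)).
apply: derivable_invmx => [|k' l'].
  apply: (@filterS _ _ (nbhs_filter z)) (near_disk z1) => w w1.
  by apply: resolvent_unitmx; [exact: phi_in|rewrite modulus_conj ltW].
have -> : (fun w => (1%:M - c^*%C *: phi w) k' l') =
    (fun w => (1%:M : 'M[C]_n) k' l' - c^*%C * phi w k' l').
  by apply/funext => w; rewrite !mxE.
exact: (derivableB (derivable_cst _ _ _) (derivableM (derivable_cst _ _ _) (dphi _ _))).
Qed.

Let F k z := \tr (psi z ^+ k).

Let F_derivable k z : modulus z < 1 -> derivable (F k) z 1.
Proof.
move=> z1; have h i j : derivable (fun w => (psi w ^+ k) i j) z 1.
  elim: k i j => [|k ih] i j.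
    have -> : (fun w => (psi w ^+ 0) i j) = fun=> (1 : 'M[C]_n) i j by [].
    exact: derivable_cst.
  have -> : (fun w => (psi w ^+ k.+1) i j) = (fun w => (psi w *m psi w ^+ k) i j).
    by apply/funext => w; rewrite exprS.
  have hpsi i' j' : derivable (fun w => psi w i' j') z 1 by exact: psi_derivable.
  exact (@derivable_mulmx R n n n psi (fun w => psi w ^+ k) z hpsi ih i j).
by rewrite /F /mxtrace; apply: derivable_bigsum.
Qed.

Let F_le k z : modulus z < 1 -> modulus (F k z) <= n%:R.
Proof.
move=> z1; have [s hs] := char_poly_roots (phi z).
rewrite /F (trace_mx_moebius k c1 (phi_in z1) hs).
have sn : size s = n.
  have := size_char_poly (phi z); rewrite hs size_prod_XsubC; by case.
rewrite -sn -[leRHS]mulr1 big_seq; apply: modulus_sum_le => // x sx.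
rewrite modulusX exprn_ile1 ?modulus_ge0// ltW//; apply: moebius_lt1 => //.
by move/spectral_ballP: (phi_in z1); apply; rewrite (eigenvalue_char_poly _ hs).
Qed.

Let psi_lipschitz : exists2 L : R, 0 < L & exists2 d : R, 0 < d &
  forall w, modulus w <= d -> forall i j, modulus (psi (al + w) i j) <= L * modulus w.
Proof.
apply: derivable_mx_lipschitz => [i j|i j]; last exact: psi_derivable.
by rewrite /psi phi_al mx_moebius_scalar mxE.
Qed.

(** [F k.+1] vanishes to order [k.+1] at [al] but is divided by only [k] powers of the Moebius map,
    so the quotient tends to [0] there. For positive [k] this is also its value at [al], since
    division by zero gives [0]; hence it is continuous. *)
Let H k z := F k.+1 z * ((1 - al^*%C * z) / (z - al)) ^+ k.

Let H_derivable k z : modulus z < 1 -> z != al -> complex_diff (H k) z.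
Proof.
move=> z1 za; apply: derivable_complex_diff.
pose G (w : C) : C := (1 - al^*%C * w) / (w - al).
suff dG : derivable (fun w => G w ^+ k) z 1.
  exact (derivableM (@F_derivable k.+1 z z1) dG).
have d1 : derivable G z 1.
  apply: derivableM.
    exact: (derivableB (derivable_cst _ _ _) (derivableM (derivable_cst _ _ _) (@derivable_id _ _ _ _))).
  apply: derivableV; first by rewrite subr_eq0.
  exact: (derivableB (@derivable_id _ _ _ _) (derivable_cst _ _ _)).
elim: k => [|k ih].
  have -> : (fun w => G w ^+ 0) = fun=> 1 by [].
  exact: derivable_cst.
have -> : (fun w => G w ^+ k.+1) = (fun w => G w * G w ^+ k).
  by apply/funext => w; rewrite exprS.
exact: (derivableM d1 ih).
Qed.

Let H_al k : H k.+1 al = 0.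
Proof. by rewrite /H subrr invr0 mulr0 exprS mul0r mulr0. Qed.

Let H_continuous_al k : {for al, continuous (H k.+1)}.
Proof.
have [L L0 [d d0 hd]] := psi_lipschitz.
(* The factors come from the [n] diagonal entries of the trace, from the entrywise bound for a
   matrix power, and from the bound [3] for [1 - al^*%C * z] when [modulus z <= 2]. *)
pose B := n%:R * (n%:R * L) ^+ k.+2 * 3 ^+ k.+1.
have n0 : 0 < n%:R :> R by rewrite ltr0n.
have B0 : 0 < B.
  apply: mulr_gt0; last by apply: exprn_gt0.
  by apply: mulr_gt0 => //; apply: exprn_gt0; apply: mulr_gt0.
move=> A /nbhs_complexP[e e0 HA]; apply/nbhs_complexP.
exists (Num.min (Num.min d 1) (e / B)); first by rewrite !lt_min d0 ltr01 divr_gt0.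
move=> z; rewrite !lt_min => /andP[/andP[zd z1] ze]; apply: HA; rewrite H_al subr0.
have [->|za] := eqVneq z al; first by rewrite H_al normc0.
set w := z - al in zd z1 ze; have zE : z = al + w by rewrite /w; ring.
have w0 : 0 < modulus w by rewrite modulus_gt0 /w subr_eq0.
apply: (@le_lt_trans _ _ (B * modulus w)); last by rewrite mulrC -ltr_pdivlMr.
rewrite /H normcM modulusX modulus_div -/w.
have hF : modulus (F k.+2 z) <= n%:R * (n%:R * (L * modulus w)) ^+ k.+2.
  rewrite /F /mxtrace.
  apply: le_trans (@modulus_sum_le _ _ _ _ ((n%:R * (L * modulus w)) ^+ k.+2) _ _) _.
  - by apply: exprn_ge0; apply: mulr_ge0; [exact: ltW|apply: mulr_ge0; exact: ltW].
  - move=> i _; apply: modulus_expr_entry; first by apply: mulr_ge0; exact: ltW.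
    by move=> i' j'; rewrite zE; apply: hd; exact: ltW.
  - by rewrite size_index_enum_ord.
have h3 : modulus (1 - al^*%C * z) <= 3.
  apply: (le_trans (modulus_leB _ _)); rewrite normc1 normcM modulus_conj.
  have hz : modulus z <= 2.
    by have := modulus_leD al w; rewrite -zE; have a1 := al1; lra.
  have : modulus al * modulus z <= 1 * 2 by apply: ler_pM; [exact: modulus_ge0|exact: modulus_ge0|exact: ltW|].
  lra.
have h4 : (modulus (1 - al^*%C * z) / modulus w) ^+ k.+1 <= (3 / modulus w) ^+ k.+1.
  rewrite lerXn2r ?nnegrE ?divr_ge0 ?modulus_ge0//.
  by rewrite ler_pM2r ?invr_gt0.
apply: le_trans (ler_pM _ _ hF h4) _; rewrite ?modulus_ge0 ?exprn_ge0 ?divr_ge0 ?modulus_ge0//.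
rewrite /B le_eqVlt; apply/orP; left; apply/eqP.
rewrite mulrA (exprMn_comm _ (mulrC _ _)) expr_div_n (exprS (modulus w)).
by field; rewrite expf_neq0// gt_eqF.
Qed.

(** At [0] the inverse Moebius factor has modulus [1 / modulus al], so the maximum principle for [H]
    turns its bound on the circle into a power of [modulus al * q]. *)
Let F0_le k (rho q : R) : al != 0 -> modulus al < rho -> rho < 1 -> 1 <= q ->
  (forall z : C, modulus z = rho -> modulus (1 - al^*%C * z) <= q * modulus (z - al)) ->
  modulus (F k.+2 0) <= n%:R * (modulus al * q) ^+ k.+1.
Proof.
move=> al0 alr r1 q1 hq; have a0 : 0 < modulus al by rewrite modulus_gt0.
have q0 : 0 < q by lra.
have M0 : 0 <= n%:R * q ^+ k.+1 by rewrite mulr_ge0// exprn_ge0// ltW.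
have hcont z : modulus z <= rho -> {for z, continuous (H k.+1)}.
  move=> hz; have [->|za] := eqVneq z al; first exact: H_continuous_al.
  by apply: complex_diff_continuous; apply: H_derivable => //; lra.
have hdiff z : modulus z < rho -> z != al -> complex_diff (H k.+1) z.
  by move=> hz za; apply: H_derivable => //; lra.
have hbd z : modulus z = rho \/ z = al -> modulus (H k.+1 z) <= n%:R * q ^+ k.+1.
  case=> [hz|->]; last by rewrite H_al normc0.
  rewrite /H normcM modulusX; apply: ler_pM; rewrite ?exprn_ge0 ?modulus_ge0//.
    by apply: F_le; lra.
  apply: lerXn2r; rewrite ?nnegrE ?modulus_ge0//; first exact: ltW.
  rewrite modulus_div ler_pdivrMr; first exact: hq.
  by have := modulus_lerB z al; rewrite hz; lra.
have rho0 : modulus 0 <= rho by rewrite normc0; lra.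
have := maximum_modulus M0 hcont hdiff hbd rho0.
rewrite /H mulr0 subr0 sub0r normcM modulusX modulus_div modulusN normc1 div1r exprVn.
by rewrite ler_pdivrMr ?exprn_gt0// exprMn (mulrC (modulus al ^+ _)) mulrA.
Qed.

Lemma moebius_lower_bound (A : 'M[C]_n) (s : seq C) (a0 : C) (be : R) :
  phi 0 = A -> char_poly A = \prod_(x <- s) ('X - x%:P) -> a0 \in s -> 0 <= be ->
  be < modulus (moebius c a0) ->
  (forall x, x \in s -> x != a0 -> modulus (moebius c x) <= be) ->
  modulus (moebius c a0) <= modulus al.
Proof.
move=> phi0 hs sa0 be0 bel hbe; set l := modulus (moebius c a0) in bel *.
rewrite leNgt; apply/negP => all.
have z0 : modulus (0 : C) < 1 by rewrite normc0.
have hA : spectral_ball n A by rewrite -phi0; exact: phi_in.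
have eA x : x \in s -> modulus x < 1.
  by move=> sx; move/spectral_ballP: hA; apply; rewrite (eigenvalue_char_poly _ hs).
have l1 : l < 1 by apply: moebius_lt1 => //; exact: eA.
have l0 : 0 < l by lra.
(* For [al = 0] the matrix [A] would be the scalar [c], whose only eigenvalue has Moebius image
   [0]. *)
have al0 : al != 0.
  apply/eqP => al0; have AE : A = c%:M by rewrite -phi0 -phi_al al0.
  have : eigenvalue A a0 by rewrite (eigenvalue_char_poly _ hs).
  move=> /eigenvalueP[v]; rewrite AE mul_mx_scalar => e v0.
  have ac : c = a0.
    apply/eqP; rewrite -subr_eq0; have : (c - a0) *: v = 0 by rewrite scalerBl e subrr.
    by move/eqP; rewrite scaler_eq0 (negbTE v0) orbF.
  by move: l0; rewrite /l ac /moebius subrr mul0r normc0 ltxx.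
have [rho [q [h1 h2 h3 h4 h5]]] := moebius_circle_bound all l1.
(* Relative to [l], the ratio [th < 1] dominates both the error from the maximum principle and the
   contribution of the other eigenvalues. *)
pose th := Num.max (modulus al * q / l) (be / l).
have th1 : th < 1 by rewrite gt_max !ltr_pdivrMr// !mul1r h4.
have aq0 : 0 <= modulus al * q by rewrite mulr_ge0 ?modulus_ge0//; lra.
have th0 : 0 <= th by rewrite le_max divr_ge0// ltW.
have n0 : 0 < n%:R :> R by rewrite ltr0n.
(* Two error terms, each at most [n%:R * th ^+ k * l ^+ k.+1], have to stay below [l ^+ k.+2]. *)
have ln0 : 0 < l / (2 * n%:R) by apply: divr_gt0 => //; apply: mulr_gt0.
have th01 : 0 <= th < 1 by rewrite th0.
have [k hk] := geometric_small th01 ln0.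
have Fs : F k.+2 0 = \sum_(x <- s) moebius c x ^+ k.+2.
  by rewrite /F /psi phi0 (trace_mx_moebius _ c1 hA hs).
have sn : size s = n.
  have := size_char_poly A; rewrite hs size_prod_XsubC; by case.
(* All copies of [a0] give the same summand, so they cannot cancel. *)
have S1 : l ^+ k.+2 <= modulus (\sum_(x <- s | x == a0) moebius c x ^+ k.+2).
  have -> : \sum_(x <- s | x == a0) moebius c x ^+ k.+2 =
      moebius c a0 ^+ k.+2 *+ count_mem a0 s.
    rewrite (eq_bigr (fun=> moebius c a0 ^+ k.+2)); last by move=> x /eqP ->.
    by rewrite big_const_seq iter_addr_0.
  rewrite normcMn modulusX -/l -mulr_natr ler_peMr ?exprn_ge0 ?(ltW l0)// ler1n.
  by rewrite -has_count has_pred1.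
have S2 : modulus (\sum_(x <- s | x != a0) moebius c x ^+ k.+2) <= n%:R * be ^+ k.+2.
  rewrite -sn big_seq_cond; apply: modulus_sum_le => [|x /andP[sx xa]].
    exact: exprn_ge0.
  by rewrite modulusX lerXn2r ?nnegrE ?modulus_ge0// hbe.
have hF := F0_le k al0 h1 h2 h3 h5.
have : modulus (\sum_(x <- s | x == a0) moebius c x ^+ k.+2) <=
    modulus (F k.+2 0) + modulus (\sum_(x <- s | x != a0) moebius c x ^+ k.+2).
  rewrite -lerBlDr; have -> : F k.+2 0 = \sum_(x <- s | x == a0) moebius c x ^+ k.+2 +
      \sum_(x <- s | x != a0) moebius c x ^+ k.+2 by rewrite Fs (bigID (pred1 a0)).
  exact: modulus_lerD.
have b1 : (modulus al * q) ^+ k.+1 <= th ^+ k.+1 * l ^+ k.+1.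
  rewrite -exprMn; apply: lerXn2r; rewrite ?nnegrE ?(mulr_ge0 th0 (ltW l0))//.
  by rewrite -ler_pdivrMr// le_max lexx.
have b2 : be ^+ k.+2 <= th ^+ k.+1 * l ^+ k.+1.
  apply: (@le_trans _ _ ((th * l) ^+ k.+2)).
    apply: lerXn2r; rewrite ?nnegrE ?(mulr_ge0 th0 (ltW l0))//.
    by rewrite -ler_pdivrMr// le_max lexx orbT.
  rewrite exprS exprMn; apply: ler_piMl.
    by apply: mulr_ge0; apply: exprn_ge0 => //; exact: ltW.
  by apply: mulr_ile1 => //; exact: ltW.
have b3 : th ^+ k.+1 <= th ^+ k by rewrite exprS; apply: ler_piMl; [exact: exprn_ge0|exact: ltW].
have lk : 0 < l ^+ k.+1 by rewrite exprn_gt0.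
move=> h6.
have : l ^+ k.+2 <= 2 * n%:R * th ^+ k * l ^+ k.+1.
  apply: (le_trans S1); apply: (le_trans h6); apply: (le_trans (lerD hF S2)).
  have t1 : th ^+ k.+1 * l ^+ k.+1 <= th ^+ k * l ^+ k.+1 by rewrite ler_wpM2r// ltW.
  have t2 : n%:R * (modulus al * q) ^+ k.+1 <= n%:R * (th ^+ k * l ^+ k.+1).
    by rewrite ler_pM2l//; exact: le_trans t1.
  have t3 : n%:R * be ^+ k.+2 <= n%:R * (th ^+ k * l ^+ k.+1).
    by rewrite ler_pM2l//; exact: le_trans t1.
  lra.
rewrite (exprS l k.+1) ler_pM2r// leNgt => /negP; apply.
by rewrite mulrC -ltr_pdivlMr// mulr_gt0.
Qed.

End MoebiusLowerBound.

(** * Holomorphic discs through a cyclic matrix *)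

Section CyclicMatrix.
Context {F : fieldType}.

(** The size is a parameter, not read off a polynomial, so that a family of polynomials gives
    matrices in one space, with entries affine in the coefficients. Up to a cast of its size it is
    the transpose of [companionmx]. *)
Definition companion n (f : nat -> F) : 'M[F]_n :=
  \matrix_(i, j) if j == n.-1 :> nat then - f i else (j.+1 == i :> nat)%:R.

Lemma char_poly_companion n (p : {poly F}) : p \is monic -> size p = n.+1 ->
  char_poly (companion n (fun i => p`_i)) = p.
Proof.
move=> mp sp; have e : (size p).-1 = n by rewrite sp.
have -> : companion n (fun i => p`_i) = (castmx (e, e) (companionmx p))^T.
  apply/matrixP => i j; rewrite !mxE castmxE mxE/= sp.
  by [].
have -> (m : nat) (M : 'M[F]_m) : char_poly M^T = char_poly M.
  rewrite /char_poly -[RHS]det_tr; congr (\det _).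
  by apply/matrixP => i j; rewrite !mxE eq_sym.
rewrite -[RHS](companionmxK mp); case: n / e {sp}.
by rewrite castmx_id.
Qed.

(** The columns of [P] are the vectors [A ^+ j *m v], a basis by cyclicity. Multiplication by [A]
    shifts them, and the Cayley-Hamilton theorem expresses the image of the last one. *)
Lemma cyclic_companion n' (A : 'M[F]_n'.+1) (v : 'cV[F]_n'.+1) :
  (<<[seq A ^+ k *m v | k : 'I_n'.+1]>> = fullv)%VS ->
  exists2 P : 'M[F]_n'.+1, P \in unitmx &
    A = P *m companion n'.+1 (fun i => (char_poly A)`_i) *m invmx P.
Proof.
move=> hv; pose P : 'M[F]_n'.+1 := \matrix_(i, j) (A ^+ j *m v) i 0.
have colP (w : 'cV[F]_n'.+1) : P *m w = \sum_k w k 0 *: (A ^+ k *m v).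
  apply/matrixP => i j; rewrite !mxE summxE; apply: eq_bigr => k _.
  by rewrite !ord1 [P _ _]mxE [in RHS]mxE mulrC.
have surj (x : 'cV[F]_n'.+1) : exists w : 'cV[F]_n'.+1, P *m w = x.
  have xin : x \in <<[tuple A ^+ k *m v | k < n'.+1]>>%VS.
    have -> : [tuple A ^+ k *m v | k < n'.+1] = [seq A ^+ k *m v | k : 'I_n'.+1] :> seq _.
      by rewrite /=.
    by rewrite hv memvf.
  exists (\col_k coord [tuple A ^+ k *m v | k < n'.+1] k x).
  rewrite colP [RHS](coord_span xin); apply: eq_bigr => k _.
  by rewrite mxE -tnth_nth tnth_mktuple.
have uP : P \in unitmx.
  have [w hw] := choice (fun j : 'I_n'.+1 => surj (delta_mx j 0)).
  suff : P *m (\matrix_(i, j) w j i 0) = 1%:M by move/mulmx1_unit => [].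
  apply/matrixP => i j; have := congr1 (fun M : 'cV[F]_n'.+1 => M i 0) (hw j).
  rewrite !mxE eqxx andbT => <-; apply: eq_bigr => k _.
  by congr (_ * _); rewrite mxE.
exists P => //; suff -> : P *m companion n'.+1 (fun i => (char_poly A)`_i) = A *m P by rewrite mulmxK.
have CH : A ^+ n'.+1 = - \sum_(k < n'.+1) (char_poly A)`_k *: A ^+ k.
  apply/eqP; rewrite -addr_eq0; apply/eqP; rewrite -[RHS](Cayley_Hamilton A).
  rewrite -[in RHS](coefK (char_poly A)) size_char_poly poly_def linear_sum.
  rewrite [in RHS]big_ord_recr/= addrC; congr (_ + _).
    have -> : (char_poly A)`_n'.+1 = 1.
      by have /monicP := char_poly_monic A; rewrite lead_coefE size_char_poly.
    by rewrite scale1r rmorphXn/= horner_mx_X.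
  by apply: eq_bigr => k _; rewrite linearZ/= rmorphXn/= horner_mx_X.
apply/matrixP => i j.
have -> : (A *m P) i j = (A ^+ j.+1 *m v) i 0.
  rewrite exprS -[_ * _]/(_ *m _) -mulmxA !mxE; apply: eq_bigr => k _.
  by rewrite [P _ _]mxE.
have [jn|jn] := eqVneq (j : nat) n'.
  rewrite jn CH mulNmx mulmx_suml [RHS]mxE summxE [LHS]mxE -sumrN; apply: eq_bigr => k _.
  by rewrite [companion _ _ _ _]mxE/= jn eqxx -scalemxAl [in RHS]mxE mulrN mulrC [P _ _]mxE.
have jn' : (j.+1 < n'.+1)%N by rewrite ltnS ltn_neqAle jn -ltnS ltn_ord.
rewrite mxE (bigD1 (Ordinal jn'))//= big1 => [|k hk].
  by rewrite addr0 [companion _ _ _ _]mxE/= (negbTE jn) eqxx mulr1 [P _ _]mxE.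
rewrite [companion _ _ _ _]mxE/= (negbTE jn) (_ : (j.+1 == k :> nat) = false) ?mulr0//.
by apply: contraNF hk => /eqP e; apply/eqP/val_inj.
Qed.

End CyclicMatrix.

Section JetAlgebra.
Context {R : realType}.
Local Notation C := R[i].
Local Notation modulus := (@ComplexField.Normc.normc R).
Import ComplexField.Normc.
Implicit Types (f g : C -> C) (z : C).

Lemma taylor2_poly (a b c z : C) :
  taylor2 (fun w => a + b * (w - z) + c * (w - z) ^+ 2) z b c.
Proof.
exists 0, 1; split => // w _; rewrite mul0r.
by rewrite [X in modulus X](_ : _ = 0) ?normc0//; ring.
Qed.

Lemma taylor2D f g z a1 a2 b1 b2 : taylor2 f z a1 a2 -> taylor2 g z b1 b2 ->
  taylor2 (fun w => f w + g w) z (a1 + b1) (a2 + b2).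
Proof.
move=> [K [d [d0 K0 H]]] [L [e [e0 L0 G]]].
exists (K + L), (Num.min d e); split; [by rewrite lt_min d0|exact: addr_ge0|].
move=> w; rewrite le_min => /andP[/H h1 /G h2].
have -> : f (z + w) + g (z + w) - (f z + g z + (a1 + b1) * w + (a2 + b2) * w ^+ 2) =
  (f (z + w) - (f z + a1 * w + a2 * w ^+ 2)) +
  (g (z + w) - (g z + b1 * w + b2 * w ^+ 2)) by ring.
by apply: (le_trans (modulus_leD _ _)); rewrite mulrDl; exact: lerD.
Qed.

Lemma taylor2M f g z a1 a2 b1 b2 : taylor2 f z a1 a2 -> taylor2 g z b1 b2 ->
  taylor2 (fun w => f w * g w) z (a1 * g z + f z * b1) (a2 * g z + a1 * b1 + f z * b2).
Proof.
move=> [K [d [d0 K0 H]]] hg; have [l l0 [r r0 lip]] := taylor2_lipschitz hg.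
have [L [e [e0 L0 G]]] := hg.
pose A := modulus (f z) + modulus a1 + modulus a2.
pose N := modulus (a1 * b2 + a2 * b1) + modulus (a2 * b2).
have A0 : 0 <= A by rewrite !addr_ge0 ?modulus_ge0.
have N0 : 0 <= N by rewrite !addr_ge0 ?modulus_ge0.
have M0 : 0 <= modulus (g z) + l by rewrite addr_ge0 ?modulus_ge0 ?ltW.
exists (K * (modulus (g z) + l) + L * A + N), (Num.min (Num.min d e) (Num.min r 1)); split.
- by rewrite !lt_min d0 e0 r0 ltr01.
- by rewrite !addr_ge0 ?mulr_ge0 ?modulus_ge0.
move=> w; rewrite !le_min => /andP[/andP[/H h1 /G h2] /andP[/lip h3 w1]].
set m := modulus w in h1 h2 h3 w1 *; have m0 : 0 <= m by exact: modulus_ge0.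
have m30 : 0 <= m ^+ 3 by exact: exprn_ge0.
set E := f (z + w) - _ in h1; set E' := g (z + w) - _ in h2.
have -> : f (z + w) * g (z + w) - (f z * g z + (a1 * g z + f z * b1) * w +
    (a2 * g z + a1 * b1 + f z * b2) * w ^+ 2) =
  E * g (z + w) + E' * (f z + a1 * w + a2 * w ^+ 2) +
  ((a1 * b2 + a2 * b1) * w ^+ 3 + a2 * b2 * w * w ^+ 3).
  by rewrite /E /E'; ring.
have k1 : modulus (g (z + w)) <= modulus (g z) + l.
  have := modulus_lerB (g (z + w)) (g z).
  have : l * m <= l by rewrite ler_piMr// ltW.
  lra.
have k2 : modulus (f z + a1 * w + a2 * w ^+ 2) <= A.
  apply: (le_trans (modulus_leD _ _)); apply: lerD.
    apply: (le_trans (modulus_leD _ _)); apply: lerD => //.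
    by rewrite normcM ler_piMr ?modulus_ge0.
  by rewrite normcM modulusX ler_piMr ?modulus_ge0// exprn_ile1.
have k3 : modulus ((a1 * b2 + a2 * b1) * w ^+ 3 + a2 * b2 * w * w ^+ 3) <= N * m ^+ 3.
  apply: (le_trans (modulus_leD _ _)); rewrite /N [leRHS]mulrDl; apply: lerD.
    by rewrite (normcM (_ + _)) modulusX.
  rewrite (normcM (a2 * b2 * w)) modulusX (normcM (a2 * b2)) ler_wpM2r//.
  by rewrite ler_piMr ?modulus_ge0.
apply: (le_trans (modulus_leD _ _)); rewrite [leRHS]mulrDl; apply: lerD => //.
apply: (le_trans (modulus_leD _ _)); rewrite [leRHS]mulrDl; apply: lerD; rewrite normcM.
  by rewrite mulrAC ler_pM ?modulus_ge0.
by rewrite mulrAC ler_pM ?modulus_ge0.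
Qed.

(** Instead of expanding the quotient, multiply [f] by the candidate quadratic polynomial: by
    [taylor2M] the product is [1] up to a cubic error, and dividing by [f] keeps the error cubic. *)
Lemma taylor2V f z a1 a2 : taylor2 f z a1 a2 -> f z != 0 ->
  taylor2 (fun w => (f w)^-1) z (- a1 / f z ^+ 2) (a1 ^+ 2 / f z ^+ 3 - a2 / f z ^+ 2).
Proof.
move=> hf fz; set c1 := - a1 / _; set c2 := _ - _.
have := taylor2M hf (taylor2_poly (f z)^-1 c1 c2 z).
cbv beta; rewrite subrr expr0n/= !mulr0 !addr0.
rewrite (_ : _ + _ * c1 = 0); last by rewrite /c1; field.
rewrite (_ : _ + _ * c2 = 0); last by rewrite /c1 /c2; field.
clearbody c1 c2; move=> [K [d [d0 K0 H]]]; have [l l0 [r r0 lip]] := taylor2_lipschitz hf.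
have F0 : 0 < modulus (f z) by rewrite modulus_gt0.
have F2 : 0 < modulus (f z) / 2 by rewrite divr_gt0.
exists (K / (modulus (f z) / 2)), (Num.min d (Num.min r (modulus (f z) / 2 / l))); split.
- by rewrite !lt_min d0 r0 divr_gt0.
- by rewrite divr_ge0// ltW.
move=> w; rewrite !le_min => /andP[/H]; rewrite subrr expr0n/= !mulr0 !addr0 mulfV// => h1 /andP[/lip h2]; rewrite ler_pdivlMr// => h3.
have k : modulus (f z) / 2 <= modulus (f (z + w)).
  have := modulus_lerB (f z) (f (z + w)); rewrite modulusB; lra.
have fw : f (z + w) != 0 by rewrite -modulus_gt0; exact: lt_le_trans k.
have -> : (f (z + w))^-1 - ((f z)^-1 + c1 * w + c2 * w ^+ 2) =
  - ((f (z + w) * ((f z)^-1 + c1 * (z + w - z) + c2 * (z + w - z) ^+ 2) -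
     (1 + 0 * w + 0 * w ^+ 2)) / f (z + w)).
  rewrite (_ : z + w - z = w); last by ring.
  by move: (f (z + w)) fw (f z) fz; clear => y y0 x x0; field; rewrite y0 x0.
rewrite modulusN modulus_div mulrAC; apply: ler_pM => //; rewrite ?modulus_ge0 ?invr_ge0 ?modulus_ge0//.
by rewrite lef_pV2 ?posrE ?modulus_gt0.
Qed.

Definition jet2 (f : C -> C) (z : C) := exists c1 c2, taylor2 f z c1 c2.

Lemma jet2_cst (a z : C) : jet2 (fun=> a) z.
Proof.
exists 0, 0, 0, 1; split => // w _.
by rewrite !mul0r !addr0 subrr normc0.
Qed.

Lemma jet2_id (z : C) : jet2 id z.
Proof.
exists 1, 0, 0, 1; split => // w _.
by rewrite mul0r addr0 mul1r subrr normc0 mul0r.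
Qed.

Lemma jet2D f g z : jet2 f z -> jet2 g z -> jet2 (fun w => f w + g w) z.
Proof. by move=> [a1 [a2 hf]] [b1 [b2 hg]]; do 2 eexists; exact: taylor2D hf hg. Qed.

Lemma jet2M f g z : jet2 f z -> jet2 g z -> jet2 (fun w => f w * g w) z.
Proof. by move=> [a1 [a2 hf]] [b1 [b2 hg]]; do 2 eexists; exact: taylor2M hf hg. Qed.

Lemma jet2N f z : jet2 f z -> jet2 (fun w => - f w) z.
Proof.
move=> hf; have -> : (fun w => - f w) = (fun w => (-1) * f w).
  by apply/funext => w; rewrite mulN1r.
by apply: jet2M => //; exact: jet2_cst.
Qed.

Lemma jet2B f g z : jet2 f z -> jet2 g z -> jet2 (fun w => f w - g w) z.
Proof. by move=> hf hg; apply: jet2D => //; exact: jet2N. Qed.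

Lemma jet2_div f g z : jet2 f z -> jet2 g z -> g z != 0 -> jet2 (fun w => f w / g w) z.
Proof.
move=> hf [b1 [b2 hg]] g0; apply: jet2M => //.
by do 2 eexists; exact: taylor2V hg g0.
Qed.

Lemma jet2_sum (I : Type) (r : seq I) (P : pred I) (f : I -> C -> C) z :
  (forall i, P i -> jet2 (f i) z) -> jet2 (fun w => \sum_(i <- r | P i) f i w) z.
Proof.
move=> h; elim: r => [|i r ih].
  have -> : (fun w => \sum_(i <- [::] | P i) f i w) = fun=> 0.
    by apply/funext => w; rewrite big_nil.
  exact: jet2_cst.
have -> : (fun w => \sum_(j <- i :: r | P j) f j w) =
    (fun w => (if P i then f i w else 0) + \sum_(j <- r | P j) f j w).
  by apply/funext => w; rewrite big_cons; case: ifP => // _; rewrite add0r.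
apply: jet2D => //; case Pi : (P i); [exact: h|exact: jet2_cst].
Qed.

End JetAlgebra.

(** * A two-point Pick problem for a pair of eigenvalues *)

Section PickInterpolation.
Context {R : realType}.
Local Notation C := R[i].
Local Notation modulus := (@ComplexField.Normc.normc R).
Import ComplexField.Normc.

Lemma pseudohyperbolic_identity (B u v : C) :
  modulus (u + B^*%C * v) ^+ 2 - modulus (v + B * u) ^+ 2 =
  (1 - modulus B ^+ 2) * (modulus u ^+ 2 - modulus v ^+ 2).
Proof. by rewrite !modulus_sqr; case: B u v => a b [d e] [k l] /=; ring. Qed.

(** This is [modulus k <= 1] for the parameter [k] of [pick_pair]. After squaring, the difference of
    the sides is affine and nonincreasing in [x], so the worst case is [x = A * B], when [a] and [b]
    point in the same direction. There [k2] and [k3] raise one modulus at a time to its bound, where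
    the inequality is the last hypothesis on [T]. *)
Lemma pick_bound (a b : C) (al be T : R) :
  modulus a <= al -> modulus b <= be -> be <= al -> al ^+ 2 < T -> al < 1 ->
  al + be - 2 * al * be <= T * (2 - al - be) ->
  modulus (a + b) * (1 + T) <= 2 * modulus (T%:C%C + b^*%C * a).
Proof.
move=> ha hb ba aT al1 hT.
have a0 := modulus_ge0 a; have b0 := modulus_ge0 b.
have T0 : 0 < T by apply: le_lt_trans aT; exact: sqr_ge0.
have T10 : 0 <= 1 + T by lra.
rewrite -ler_sqr ?nnegrE ?mulr_ge0 ?modulus_ge0// !exprMn.
set x := complex.Re (b^*%C * a).
have e1 : modulus (a + b) ^+ 2 = modulus a ^+ 2 + modulus b ^+ 2 + 2 * x.
  by rewrite /x !modulus_sqr; case: (a) (b) => ? ? [? ?] /=; ring.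
have e2 : modulus (T%:C%C + b^*%C * a) ^+ 2 =
    T ^+ 2 + 2 * T * x + (modulus a * modulus b) ^+ 2.
  by rewrite exprMn /x !modulus_sqr; case: (a) (b) => ? ? [? ?] /=; ring.
have hx : x <= modulus a * modulus b.
  apply: le_trans (ler_norm _) _; apply: le_trans (normr_Re _) _.
  by rewrite normcM modulus_conj mulrC.
rewrite e1 e2; move: x (modulus a) (modulus b) hx ha hb a0 b0 {e1 e2} => x A B hx ha hb A0 B0.
have k1 : 2 * A <= 1 + T.
  have : 0 <= (1 - A) ^+ 2 by exact: sqr_ge0.
  have : A ^+ 2 <= al ^+ 2 by rewrite ler_sqr ?nnegrE//; lra.
  rewrite sqrrB expr1n; lra.
have k2 : (A + be) * (1 + T) <= 2 * (T + A * be).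
  have k : 2 * be <= 1 + T.
    have : 0 <= (1 - be) ^+ 2 by exact: sqr_ge0.
    have be0 : 0 <= be by lra.
    have : be ^+ 2 <= al ^+ 2 by rewrite ler_sqr ?nnegrE//; lra.
    rewrite sqrrB expr1n; lra.
  have : 0 <= (al - A) * (1 + T - 2 * be) by rewrite mulr_ge0// subr_ge0.
  lra.
have k3 : (A + B) * (1 + T) <= 2 * (T + A * B).
  have : 0 <= (be - B) * (1 + T - 2 * A) by rewrite mulr_ge0// subr_ge0.
  lra.
have k4 : ((A + B) * (1 + T)) ^+ 2 <= (2 * (T + A * B)) ^+ 2.
  rewrite ler_sqr ?nnegrE//; apply: mulr_ge0 => //; apply: addr_ge0 => //.
    exact: ltW.
  exact: mulr_ge0.
have k5 : 0 <= (A * B - x) * (2 * (1 - T) ^+ 2).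
  by apply: mulr_ge0; [rewrite subr_ge0|apply: mulr_ge0 => //; exact: sqr_ge0].
rewrite -subr_ge0.
have -> : 2 ^+ 2 * (T ^+ 2 + 2 * T * x + (A * B) ^+ 2) -
    (A ^+ 2 + B ^+ 2 + 2 * x) * (1 + T) ^+ 2 =
  ((2 * (T + A * B)) ^+ 2 - ((A + B) * (1 + T)) ^+ 2) + (A * B - x) * (2 * (1 - T) ^+ 2).
  ring.
by rewrite addr_ge0// subr_ge0.
Qed.

(** On the branch [w], with [w ^+ 2 = z], the root is [w * h w] for [h = Nu / De]. By construction
    [h (- t) = B], and [k] is solved from [h t = a / t], so the branches at [t] and [- t] are [a]
    and [b]. The symmetric functions of the two branches are even in [w], hence rational in [z]. *)
Lemma pick_pair (a b : C) (al be T : R) :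
  modulus a <= al -> modulus b <= be -> be <= al -> al ^+ 2 < T -> T < 1 -> al < 1 ->
  al + be - 2 * al * be <= T * (2 - al - be) ->
  exists s1 s2 : C -> C,
    [/\ forall z, modulus z < 1 -> jet2 s1 z /\ jet2 s2 z,
        forall z, modulus z < 1 -> exists y1 y2 : C, [/\ modulus y1 < 1, modulus y2 < 1,
          s1 z = y1 + y2 & s2 z = y1 * y2],
        s1 T%:C%C = a + b, s2 T%:C%C = a * b & s1 0 = 0 /\ s2 0 = 0].
Proof.
move=> ha hb ba aT T1 al1 hT.
have T0 : 0 < T by apply: le_lt_trans aT; exact: sqr_ge0.
pose tr := Num.sqrt T; have tr0 : 0 < tr by rewrite sqrtr_gt0.
have trT : tr ^+ 2 = T by rewrite sqr_sqrtr// ltW.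
pose t : C := tr%:C%C.
have tT : t ^+ 2 = T%:C%C by rewrite /t -rmorphXn trT.
have t0 : t != 0 by rewrite /t -modulus_gt0 modulus_real gtr0_norm.
pose B : C := - b / t; pose S : C := T%:C%C + b^*%C * a.
have S0 : S != 0.
  rewrite -modulus_gt0; have := modulus_lerD T%:C%C (b^*%C * a).
  rewrite modulus_real gtr0_norm// normcM modulus_conj.
  have : modulus b * modulus a <= al * al.
    by apply: ler_pM; rewrite ?modulus_ge0//; exact: le_trans ba.
  rewrite -expr2 -/S; lra.
pose k : C := (a + b) * (1 + T%:C%C) / (2 * S).
have m2 : modulus 2 = 2 by rewrite -(rmorph_nat (real_complex R)) modulus_real ger0_norm.
have k1 : modulus k <= 1.
  rewrite /k modulus_div !normcM m2 ler_pdivrMr ?mulr_gt0 ?modulus_gt0// mul1r.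
  have -> : 1 + T%:C%C = (1 + T)%:C%C :> C by rewrite rmorphD rmorph1.
  rewrite modulus_real gtr0_norm; last by lra.
  exact: pick_bound hT.
have B1 : modulus B < 1.
  rewrite /B modulus_div modulusN modulus_real gtr0_norm// ltr_pdivrMr// mul1r.
  rewrite -ltr_sqr ?nnegrE ?modulus_ge0 ?ltW// trT; apply: le_lt_trans aT.
  have al0 : 0 <= al by apply: le_trans ha; exact: modulus_ge0.
  by rewrite ler_sqr ?nnegrE ?modulus_ge0//; exact: le_trans ba.
pose Nu z := k * (z + t) + B * (1 + t * z).
pose De z := (1 + t * z) + B^*%C * (k * (z + t)).
(* [h] composes two automorphisms of the disc with multiplication by [k], of modulus at most 1, so
   it maps the disc to itself. *)
have ND z : modulus z < 1 -> modulus (Nu z) < modulus (De z).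
  move=> z1; rewrite -ltr_sqr ?nnegrE ?modulus_ge0// -subr_gt0.
  rewrite /Nu /De pseudohyperbolic_identity mulr_gt0//.
    by rewrite subr_gt0 -[ltRHS](expr1n _ 2) ltr_sqr ?nnegrE ?modulus_ge0.
  have := pseudohyperbolic_identity t 1 z.
  have -> : t^*%C = t by rewrite /t /= oppr0.
  rewrite mulr1 normc1 expr1n modulus_real (ger0_norm (ltW tr0)) trT => h.
  have : 0 < (1 - T) * (1 - modulus z ^+ 2).
    rewrite mulr_gt0 ?subr_gt0// -[ltRHS](expr1n _ 2) ltr_sqr ?nnegrE ?modulus_ge0//.
  rewrite -h !subr_gt0; apply: le_lt_trans.
  by rewrite normcM ler_sqr ?nnegrE ?mulr_ge0 ?modulus_ge0// ler_piMl ?modulus_ge0.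
have D0 z : modulus z < 1 -> De z != 0.
  by move=> /ND h; rewrite -modulus_gt0; apply: le_lt_trans h; exact: modulus_ge0.
pose p := k * t + B; pose q := k + B * t; pose r := 1 + B^*%C * k * t; pose s := t + B^*%C * k.
have NuE z : Nu z = p + q * z by rewrite /Nu /p /q; ring.
have DeE z : De z = r + s * z by rewrite /De /r /s; ring.
pose s1 (z : C) : C := 2 * z * (q * r - p * s) / (r ^+ 2 - s ^+ 2 * z).
pose s2 (z : C) : C := - z * (p ^+ 2 - q ^+ 2 * z) / (r ^+ 2 - s ^+ 2 * z).
have sqE z : modulus z < 1 -> exists2 w, modulus w < 1 & w ^+ 2 = z.
  move=> z1; exists (sqrtC z); last exact: sqrtCK.
  by rewrite -(@expr_lt1 _ 2) ?modulus_ge0// -modulusX sqrtCK.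
have den w : r ^+ 2 - s ^+ 2 * w ^+ 2 = De w * De (- w) by rewrite !DeE; ring.
have s12 w : modulus w < 1 ->
    s1 (w ^+ 2) = w * Nu w / De w + (- w * Nu (- w) / De (- w)) /\
    s2 (w ^+ 2) = w * Nu w / De w * (- w * Nu (- w) / De (- w)).
  move=> w1; have d1 := D0 w w1.
  have d2 : De (- w) != 0 by apply: D0; rewrite modulusN.
  rewrite /s1 /s2 den; move: d1 d2; rewrite !NuE !DeE; clear.
  by move=> d1 d2; split; field; rewrite d1 d2.
have yb w : modulus w < 1 -> modulus (w * Nu w / De w) < 1.
  move=> w1; rewrite modulus_div normcM ltr_pdivrMr ?modulus_gt0 ?D0// mul1r.
  apply: le_lt_trans (ND _ w1); by rewrite ler_piMl ?modulus_ge0// ltW.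
have den0 z : modulus z < 1 -> r ^+ 2 - s ^+ 2 * z != 0.
  by move=> /sqE[w w1 <-]; rewrite den mulf_neq0 ?D0// modulusN.
have tr1 : tr < 1 by rewrite -(@expr_lt1 _ 2) ?ltW// trT.
have t1 : modulus t < 1 by rewrite modulus_real gtr0_norm.
have ya : t * Nu t / De t = a.
  have d := D0 t t1; apply: (canLR (mulfK d)).
  have kS : 2 * S * k = (a + b) * (1 + T%:C%C).
    by rewrite /k mulrCA divff ?mulr1// mulf_neq0// pnatr_eq0.
  have Bt : B * t = - b by rewrite /B divfK.
  have Bct : B^*%C * t = - b^*%C.
    rewrite -{1}(_ : t^*%C = t) -?rmorphM/= ?Bt ?rmorphN//.
    by rewrite /t /= oppr0.
  have -> : a * De t = a * (1 + t ^+ 2) + 2 * a * (B^*%C * t) * k by rewrite /De; ring.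
  have -> : t * Nu t = 2 * k * t ^+ 2 + B * t * (1 + t ^+ 2) by rewrite /Nu; ring.
  rewrite Bt Bct tT; apply/eqP; rewrite -subr_eq0; apply/eqP.
  have -> : 2 * k * T%:C%C + - b * (1 + T%:C%C) -
      (a * (1 + T%:C%C) + 2 * a * (- b^*%C) * k) =
    2 * S * k - (a + b) * (1 + T%:C%C) by rewrite /S; ring.
  by rewrite kS subrr.
have yb' : - t * Nu (- t) / De (- t) = b.
  have d : De (- t) != 0 by apply: D0; rewrite modulusN.
  apply: (canLR (mulfK d)); rewrite /De /Nu addNr !mulr0 addr0 add0r.
  have Bt : B * t = - b by rewrite /B divfK.
  have -> : - t * (B * (1 + t * - t)) = - (B * t) * (1 + t * - t) by ring.
  by rewrite Bt opprK.
exists s1, s2; split.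
- move=> z z1; have d := den0 z z1.
  have jd : jet2 (fun z => r ^+ 2 - s ^+ 2 * z) z.
    exact: (jet2B (jet2_cst _ _) (jet2M (jet2_cst _ _) (jet2_id _))).
  split; apply: jet2_div => //.
    exact: (jet2M (jet2M (jet2_cst _ _) (jet2_id _)) (jet2_cst _ _)).
  exact: (jet2M (jet2N (jet2_id _)) (jet2B (jet2_cst _ _) (jet2M (jet2_cst _ _) (jet2_id _)))).
- move=> z /sqE[w w1 <-]; exists (w * Nu w / De w), (- w * Nu (- w) / De (- w)).
  have [h1 h2] := s12 w w1; split => //; first exact: yb.
  by apply: yb; rewrite modulusN.
- by rewrite -tT; have [-> _] := s12 t t1; rewrite ya yb'.
- by rewrite -tT; have [_ ->] := s12 t t1; rewrite ya yb'.
by rewrite /s1 /s2 mulr0 oppr0 !mul0r.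
Qed.

End PickInterpolation.

Lemma monic_quadratic_split (F : fieldType) (a b : F) :
  'X^2 - (a + b)%:P * 'X + (a * b)%:P = ('X - a%:P) * ('X - b%:P).
Proof.
have h (S : comNzRingType) (x y z : S) : x ^+ 2 - (y + z) * x + y * z = (x - y) * (x - z).
  by ring.
by rewrite polyCD polyCM h.
Qed.

(** * Deformation of the spectrum to a single point *)

Section Deformation.
Context {R : realType}.
Local Notation C := R[i].
Local Notation modulus := (@ComplexField.Normc.normc R).
Import ComplexField.Normc.

Lemma moebius_opp (c y : C) : moebius (- c) y = (y + c) / (1 + c^*%C * y).
Proof.
by rewrite /moebius opprK (_ : (- c)^*%C = - c^*%C) ?mulNr ?opprK//; case: c.
Qed.

Lemma moebiusK (c x : C) : modulus c < 1 -> modulus x < 1 ->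
  moebius (- c) (moebius c x) = x.
Proof.
move=> c1 x1; have d := moebius_denom_neq0 c1 (ltW x1).
have d2 : 1 - c^*%C * c != 0 by apply: moebius_denom_neq0 => //; exact: ltW.
have d3 : 1 - c^*%C * x + c^*%C * (x - c) != 0.
  by rewrite (_ : _ + _ = 1 - c^*%C * c)//; ring.
rewrite moebius_opp /moebius; move: (c^*%C) d d2 d3 => k d d2 d3.
by field; rewrite d /= (_ : 1 - k * x + k * (x - c) = 1 - k * c)//; ring.
Qed.

Variable (c : C).
Hypothesis c1 : modulus c < 1.

(* The second order jets stand for holomorphy in the parameter. *)
Definition deformation (d : nat) (G : C -> {poly C}) :=
  [/\ forall z, modulus z < 1 -> exists s : seq C, [/\ size s = d,
        forall x, x \in s -> modulus x < 1 & G z = \prod_(x <- s) ('X - x%:P)],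
      forall z, modulus z < 1 -> forall k, jet2 (fun w => (G w)`_k) z &
      G 0 = ('X - c%:P) ^+ d].

Lemma deformation0 : deformation 0 (fun=> 1).
Proof.
split => [z _|z _ k|]; last by rewrite expr0.
  by exists [::]; rewrite big_nil.
exact: jet2_cst.
Qed.

Lemma deformationM d e G H : deformation d G -> deformation e H ->
  deformation (d + e) (fun z => G z * H z).
Proof.
move=> [g1 g2 g3] [h1 h2 h3]; split => [z z1|z z1 k|].
- have [s [s1 s2 s3]] := g1 z z1; have [t [t1 t2 t3]] := h1 z z1.
  exists (s ++ t); split; first by rewrite size_cat s1 t1.
    by move=> x; rewrite mem_cat => /orP[/s2|/t2].
  by rewrite big_cat/= -s3 -t3.
- have -> : (fun w => (G w * H w)`_k) = (fun w => \sum_(j < k.+1) (G w)`_j * (H w)`_(k - j)).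
    by apply/funext => w; rewrite coefM.
  by apply: jet2_sum => j _; apply: jet2M; [exact: g2|exact: h2].
- by rewrite g3 h3 exprD.
Qed.

Let cN1 : modulus (- c) < 1.
Proof. by rewrite modulusN. Qed.

Lemma moebiusN0 : moebius (- c) 0 = c.
Proof. by rewrite moebius_opp add0r mulr0 addr0 divr1. Qed.

(* The root [moebius (- c) y] is rational in the pair [y1, y2], hence the quadratic
   factor has coefficients rational in the symmetric functions of [pick_pair]. *)
Lemma deformation_pair (a b : C) (al be T : R) :
  modulus a < 1 -> modulus b < 1 ->
  modulus (moebius c a) <= al -> modulus (moebius c b) <= be -> be <= al ->
  al ^+ 2 < T -> T < 1 -> al < 1 ->
  al + be - 2 * al * be <= T * (2 - al - be) ->
  exists2 G, deformation 2 G & G T%:C%C = ('X - a%:P) * ('X - b%:P).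
Proof.
move=> a1 b1 ha hb ba aT T1 al1 hT.
have [s1 [s2 [js sy sTa sTb [s10 s20]]]] := pick_pair ha hb ba aT T1 al1 hT.
have T0 : 0 < T by apply: le_lt_trans aT; exact: sqr_ge0.
pose k := c^*%C.
pose De (z : C) := 1 + k * s1 z + k ^+ 2 * s2 z.
pose e1 (z : C) := (s1 z + 2 * k * s2 z + 2 * c + c * k * s1 z) / De z.
pose e2 (z : C) := (s2 z + c * s1 z + c ^+ 2) / De z.
pose G (z : C) : {poly C} := 'X^2 - (e1 z)%:P * 'X + (e2 z)%:P.
have dk (y : C) : modulus y < 1 -> 1 + k * y != 0.
  move=> y1; have := moebius_denom_neq0 cN1 (ltW y1).
  by rewrite (_ : (- c)^*%C = - k) ?mulNr ?opprK// /k; case: (c).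
have DeE (z y1 y2 : C) : s1 z = y1 + y2 -> s2 z = y1 * y2 ->
    De z = (1 + k * y1) * (1 + k * y2).
  by rewrite /De => -> ->; ring.
have GE z (y1 y2 : C) : modulus y1 < 1 -> modulus y2 < 1 ->
    s1 z = y1 + y2 -> s2 z = y1 * y2 ->
    G z = ('X - (moebius (- c) y1)%:P) * ('X - (moebius (- c) y2)%:P).
  move=> /dk d1 /dk d2 h1 h2.
  have f1 : e1 z = moebius (- c) y1 + moebius (- c) y2.
    rewrite /e1 (DeE z y1 y2)// h1 h2 !moebius_opp -/k.
    by move: d1 d2; clear; move=> d1 d2; field; rewrite d1 d2.
  have f2 : e2 z = moebius (- c) y1 * moebius (- c) y2.
    rewrite /e2 (DeE z y1 y2)// h1 h2 !moebius_opp -/k.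
    by move: d1 d2; clear; move=> d1 d2; field; rewrite d1 d2.
  by rewrite /G f1 f2 monic_quadratic_split.
have De0 z : modulus z < 1 -> De z != 0.
  move=> /sy[y1 [y2 [/dk d1 /dk d2 h1 h2]]].
  by rewrite (DeE z y1 y2)// mulf_neq0.
exists G; last first.
  rewrite (GE _ (moebius c a) (moebius c b))//; first by rewrite !moebiusK.
    exact: moebius_lt1.
  exact: moebius_lt1.
split.
- move=> z /sy[y1 [y2 [k1 k2 h1 h2]]].
  exists [:: moebius (- c) y1; moebius (- c) y2]; split => //.
    by move=> x; rewrite !inE => /orP[] /eqP ->; exact: moebius_lt1.
  by rewrite big_cons big_seq1; exact: GE.
- move=> z z1 j; have [j1 j2] := js z z1.
  have -> : (fun w => (G w)`_j) =
      (fun w => (j == 2)%:R - e1 w * (j == 1)%:R + e2 w * (j == 0)%:R).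
    apply/funext => w; rewrite /G coefD coefB coefXn coefCM coefX coefC.
    by congr (_ + _); case: (j == 0%N); rewrite ?mulr1 ?mulr0.
  have jD : jet2 De z.
    exact: (jet2D (jet2D (jet2_cst _ _) (jet2M (jet2_cst _ _) j1)) (jet2M (jet2_cst _ _) j2)).
  have je1 : jet2 e1 z.
    apply: jet2_div => //; last exact: De0.
    apply: jet2D; last exact: (jet2M (jet2_cst _ _) j1).
    apply: jet2D; last exact: jet2_cst.
    exact: (jet2D j1 (jet2M (jet2_cst _ _) j2)).
  have je2 : jet2 e2 z.
    apply: jet2_div => //; last exact: De0.
    apply: jet2D; last exact: jet2_cst.
    exact: (jet2D j2 (jet2M (jet2_cst _ _) j1)).
  exact: (jet2D (jet2B (jet2_cst _ _) (jet2M je1 (jet2_cst _ _))) (jet2M je2 (jet2_cst _ _))).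
rewrite (GE 0 0 0) ?normc0 ?ltr01 ?addr0 ?mulr0//.
by rewrite moebiusN0 expr2.
Qed.

Lemma deformation_single (x : C) (T : R) :
  modulus x < 1 -> 0 < T -> T < 1 -> modulus (moebius c x) < T ->
  exists2 G, deformation 1 G & G T%:C%C = 'X - x%:P.
Proof.
move=> x1 T0 T1 hx; pose y (z : C) := z * (moebius c x / T%:C%C).
have y1 z : modulus z < 1 -> modulus (y z) < 1.
  move=> z1; rewrite /y normcM modulus_div modulus_real gtr0_norm//.
  apply: mulr_ilt1 => //; rewrite ?modulus_ge0 ?divr_ge0 ?modulus_ge0 ?ltW//.
  by rewrite ltr_pdivrMr// mul1r.
have T0' : T%:C%C != 0 :> C by rewrite -modulus_gt0 modulus_real gtr0_norm.
exists (fun z => 'X - (moebius (- c) (y z))%:P); last first.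
  by rewrite /y mulrC divfK// moebiusK.
split.
- move=> z z1; exists [:: moebius (- c) (y z)]; rewrite big_seq1; split => //.
  by move=> w; rewrite inE => /eqP ->; apply: moebius_lt1 => //; exact: y1.
- move=> z z1 j.
  have -> : (fun w => ('X - (moebius (- c) (y w))%:P)`_j) =
      (fun w => (j == 1)%:R - moebius (- c) (y w) * (j == 0)%:R).
    apply/funext => w; rewrite coefB coefX coefC.
    by congr (_ - _); case: (j == 0%N); rewrite ?mulr1 ?mulr0.
  have jy : jet2 y z by exact: (jet2M (jet2_id _) (jet2_cst _ _)).
  apply: (jet2B (jet2_cst _ _)); apply: (fun h => jet2M h (jet2_cst _ _)).
  apply: jet2_div.
  + exact: (jet2B jy (jet2_cst _ _)).
  + exact: (jet2B (jet2_cst _ _) (jet2M (jet2_cst _ _) jy)).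
  + by apply: moebius_denom_neq0; [exact: cN1|apply: ltW; exact: y1].
by rewrite /y mul0r moebiusN0 expr1.
Qed.

Lemma deformation_exists (s : seq C) (a b : C) (al be T : R) :
  (forall x, x \in s -> modulus x < 1) -> a != b ->
  (forall x, x \in s -> x != a -> modulus (moebius c x) <= be) ->
  modulus (moebius c a) <= al -> (count_mem a s <= count_mem b s)%N ->
  be < T -> al ^+ 2 < T -> be <= al -> T < 1 -> al < 1 ->
  al + be - 2 * al * be <= T * (2 - al - be) ->
  exists2 G, deformation (size s) G & G T%:C%C = \prod_(x <- s) ('X - x%:P).
Proof.
move=> s1 ab hbe hal hcount bT aT ba T1 al1 hT.
have T0 : 0 < T by apply: le_lt_trans aT; exact: sqr_ge0.
(* Induction on the multiplicity of [a]: each step removes one [a] and one [b], which preserves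
   [hcount]. Once no [a] is left, every eigenvalue, spare copies of [b] included, moves alone. *)
elim: {s}(count_mem a s) {-2}s (erefl (count_mem a s)) s1 hbe hcount => [|m ih] s hm s1 hbe hcount.
  elim: s hm s1 hbe {hcount} => [|x s ihs] hm s1 hbe.
    by exists (fun=> 1); [exact: deformation0|rewrite big_nil].
  move: hm => /= /eqP; rewrite addn_eq0 eqb0 => /andP[xa /eqP/ihs hs].
  have [y ys|y ys|G dG GT] := hs; first by apply: s1; rewrite inE ys orbT.
    by apply: hbe; rewrite inE ys orbT.
  have x1 : modulus x < 1 by apply: s1; exact: mem_head.
  have [|H dH HT] := deformation_single x1 T0 T1.
    by apply: le_lt_trans bT; apply: hbe => //; exact: mem_head.
  exists (fun z => H z * G z); first exact: (deformationM dH dG).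
  by rewrite big_cons HT GT.
have sa : a \in s by rewrite -has_pred1 has_count hm.
have sb : b \in rem a s.
  by rewrite -has_pred1 has_count count_mem_rem (negbTE ab) subn0; apply: leq_trans hcount; rewrite hm.
pose s' := rem b (rem a s).
have p : perm_eq s (a :: b :: s').
  by apply: (perm_trans (perm_to_rem sa)); rewrite perm_cons perm_to_rem.
have sub x : x \in s' -> x \in s by move=> xs; rewrite (perm_mem p) !inE xs !orbT.
have cnt y : count_mem y s = ((a == y) + ((b == y) + count_mem y s'))%N.
  by rewrite (permP p).
have [||||G dG GT] := ih s'.
- by move: hm; rewrite cnt eqxx eq_sym (negbTE ab) => -[].
- by move=> x /sub; exact: s1.
- by move=> x /sub; exact: hbe.
- by move: hcount; rewrite !cnt !eqxx (negbTE ab) (eq_sym b) (negbTE ab) !add0n !add1n.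
have sb' : b \in s by rewrite (perm_mem p) !inE eqxx orbT.
have hb : modulus (moebius c b) <= be by apply: hbe => //; rewrite eq_sym.
have [H dH HT] := deformation_pair (s1 a sa) (s1 b sb') hal hb ba aT T1 al1 hT.
exists (fun z => H z * G z).
  by rewrite (perm_size p) -[size _]/(2 + size s')%N; exact: (deformationM dH dG).
by rewrite (perm_big _ p)/= !big_cons HT GT mulrA.
Qed.

End Deformation.

(** * Choice of the centre *)

Section Center.
Context {R : realType}.
Local Notation C := R[i].
Local Notation modulus := (@ComplexField.Normc.normc R).
Import ComplexField.Normc.

Lemma seq_maximum (T : eqType) (s : seq T) (f : T -> R) (x0 : T) : x0 \in s ->
  exists2 x, x \in s & forall y, y \in s -> f y <= f x.
Proof.
elim: s x0 => // x [|z s] ih x0 _.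
  by exists x; rewrite ?mem_head// => y; rewrite inE => /eqP ->.
have [w ws hw] := ih z (mem_head _ _).
have [h|h] := leP (f w) (f x).
  exists x; first exact: mem_head.
  by move=> y; rewrite inE => /orP[/eqP -> //|/hw /le_trans]; apply.
exists w; first by rewrite inE ws orbT.
by move=> y; rewrite inE => /orP[/eqP ->|/hw//]; exact: ltW.
Qed.

(** The centre on the left is the point that [moebius b] followed by [moebius (- a)] sends to [0];
    automorphisms of the disc with the same zero differ by a factor of modulus 1. *)
Lemma modulus_moebius_comp (a b x : C) :
  modulus a < 1 -> modulus b < 1 -> modulus x < 1 ->
  modulus (moebius (moebius (- b) (- a)) x) = modulus (moebius (- a) (moebius b x)).
Proof.
move=> a1 b1 x1; have y1 := moebius_lt1 b1 x1.
rewrite -{1}(moebiusK b1 x1); move: (moebius b x) y1 => y y1 {x x1}.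
rewrite !moebius_opp.
have opp (u v : C) : modulus u < 1 -> modulus v < 1 -> 1 + u^*%C * v != 0.
  move=> u1 v1; have := @moebius_denom_neq0 _ (- u) v; rewrite modulusN => /(_ u1 (ltW v1)).
  by rewrite (_ : (- u)^*%C = - u^*%C) ?mulNr ?opprK//; case: (u).
have d1 := opp b y b1 y1; have d2 := opp a y a1 y1.
have d3 : 1 + b^*%C * - a != 0 by apply: opp => //; rewrite modulusN.
have d4 : 1 + a^*%C * - b != 0 by apply: opp => //; rewrite modulusN.
have d5 : 1 - b^*%C * b != 0 by apply: moebius_denom_neq0 => //; exact: ltW.
have cE : ((- a + b) / (1 + b^*%C * - a))^*%C = (b^*%C - a^*%C) / (1 - a^*%C * b).
  rewrite rmorphM fmorphV rmorphD rmorphN rmorphD rmorphM rmorphN rmorph1/=.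
  have -> : (b^*)^*%C%C = b by case: (b) => ? ?; rewrite /= opprK.
  by congr (_ / _); ring.
have E : moebius ((- a + b) / (1 + b^*%C * - a)) ((y + b) / (1 + b^*%C * y)) =
    (y + a) / (1 + a^*%C * y) * ((1 + a^*%C * - b) / (1 + b^*%C * - a)).
  rewrite /moebius cE; move: (a^*%C) (b^*%C) d1 d2 d3 d4 d5 {cE opp} => a' b' d1 d2 d3 d4 d5.
  have d6 : 1 - a' * b != 0 by rewrite -mulrN.
  have d7 : 1 - b' * a != 0 by rewrite -mulrN.
  have e : (1 - a' * b) * (1 + b' * y) - (b' - a') * (y + b) =
    (1 - b' * b) * (1 + a' * y) by ring.
  field; rewrite ?d1 ?d2 ?d3 ?d4 ?d6 ?d7 /= ?e ?mulf_neq0//.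
rewrite E normcM (modulus_div (1 + a^*%C * - b)).
have -> : modulus (1 + a^*%C * - b) = modulus (1 + b^*%C * - a).
  rewrite -modulus_conj; congr modulus.
  by case: (a) (b) => ? ? [? ?] /=; congr (_ +i* _)%C; ring.
by rewrite divff ?mulr1// modulus_eq0.
Qed.

(** In the disc [modulus y <= modulus a], the point opposite to [- a] is the only one farthest from
    it. Strictness enters through [modulus (y - a) ^+ 2 > 0], which bounds
    [2 * complex.Re (a^*%C * y)] from above. *)
Lemma moebius_unique_max (a y : C) : modulus a < 1 -> modulus y <= modulus a -> y != a ->
  modulus (moebius (- a) y) < modulus (moebius (- a) a).
Proof.
move=> a1 ya yna; rewrite !moebius_opp !modulus_div.
have den (v : C) : modulus v <= modulus a -> 0 < modulus (1 + a^*%C * v).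
  move=> va; have := modulus_lerD 1 (a^*%C * v); rewrite normc1 normcM modulus_conj.
  have : modulus a * modulus v <= modulus v by rewrite ler_piMl ?modulus_ge0// ltW.
  lra.
have d1 := den y ya; have d2 := den a (lexx _).
rewrite ltr_pdivrMr// mulrAC ltr_pdivlMr//.
rewrite -ltr_sqr ?nnegrE ?mulr_ge0 ?modulus_ge0// !exprMn.
have e1 := pseudohyperbolic_identity a 1 y; rewrite !mulr1 normc1 expr1n in e1.
have e2 : modulus (a + a) ^+ 2 = 4 * modulus a ^+ 2.
  by rewrite !modulus_sqr; case: (a) => ? ? /=; ring.
have e3 : modulus (1 + a^*%C * a) ^+ 2 = (1 + modulus a ^+ 2) ^+ 2.
  by rewrite !modulus_sqr; case: (a) => ? ? /=; ring.
have e4 : modulus (1 + a^*%C * y) ^+ 2 =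
    1 + 2 * complex.Re (a^*%C * y) + modulus a ^+ 2 * modulus y ^+ 2.
  by rewrite !modulus_sqr; case: (a) (y) => ? ? [? ?] /=; ring.
have e5 : modulus (y - a) ^+ 2 =
    modulus y ^+ 2 + modulus a ^+ 2 - 2 * complex.Re (a^*%C * y).
  by rewrite !modulus_sqr; case: (a) (y) => ? ? [? ?] /=; ring.
have p5 : 0 < modulus (y - a) ^+ 2 by rewrite exprn_gt0// modulus_gt0 subr_eq0.
rewrite e2 e3.
have -> : modulus (y + a) ^+ 2 = modulus (1 + a^*%C * y) ^+ 2 -
    (1 - modulus a ^+ 2) * (1 - modulus y ^+ 2) by rewrite -e1; ring.
rewrite e4; move: e5 p5 => ->.
have : modulus y ^+ 2 <= modulus a ^+ 2 by rewrite ler_sqr ?nnegrE ?modulus_ge0.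
have : modulus a ^+ 2 < 1 by rewrite expr_lt1 ?modulus_ge0.
have : 0 <= modulus a ^+ 2 by exact: sqr_ge0.
have : 0 <= modulus y ^+ 2 by exact: sqr_ge0.
move: (complex.Re (a^*%C * y)) (modulus a ^+ 2) (modulus y ^+ 2).
move=> x A Y Y0 A0 A1 YA h.
have k : (1 + 2 * x + A * Y) * (1 - A) < (1 - Y) * (1 + A) ^+ 2.
  have k1 : (1 + 2 * x + A * Y) * (1 - A) < (1 + (Y + A) + A * Y) * (1 - A).
    rewrite ltr_pM2r ?subr_gt0//; lra.
  apply: (lt_le_trans k1).
  rewrite -subr_ge0.
  have -> : (1 - Y) * (1 + A) ^+ 2 - (1 + (Y + A) + A * Y) * (1 - A) =
    2 * (1 + A) * (A - Y) by ring.
  by rewrite mulr_ge0// ?subr_ge0// mulr_ge0//; lra.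
rewrite -subr_gt0.
have -> : 4 * A * (1 + 2 * x + A * Y) -
    (1 + 2 * x + A * Y - (1 - A) * (1 - Y)) * (1 + A) ^+ 2 =
  (1 - A) * ((1 - Y) * (1 + A) ^+ 2 - (1 + 2 * x + A * Y) * (1 - A)) by ring.
by rewrite mulr_gt0 ?subr_gt0.
Qed.

Lemma center_exists (s : seq C) (x0 x1 : C) :
  (forall x, x \in s -> modulus x < 1) -> x0 \in s -> x1 \in s -> x0 != x1 ->
  exists a b c : C, exists be : R,
    [/\ [/\ a \in s, a != b & modulus c < 1],
        (count_mem a s <= count_mem b s)%N,
        0 <= be < modulus (moebius c a) &
        forall x, x \in s -> x != a -> modulus (moebius c x) <= be].
Proof.
move=> s1 sx0 sx1 x01.
have [b sb hb] := seq_maximum (fun x => (count_mem x s)%:R) sx0.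
have [a sa ha] := seq_maximum (fun x => modulus (moebius b x)) sx0.
have b1 := s1 b sb.
have inj x : x \in s -> moebius b x = 0 -> x = b.
  by move=> /s1 x1' h; rewrite -(moebiusK b1 x1') h moebiusN0.
have ab : a != b.
  apply/eqP => ab; have z x : x \in s -> x = b.
    move=> sx; apply: inj => //; apply/eqP; rewrite -modulus_eq0 eq_le modulus_ge0 andbT.
    by have := ha x sx; rewrite ab /moebius subrr mul0r normc0.
  by move/eqP: x01; apply; rewrite (z x0)// (z x1).
set y := moebius b a; have y1 : modulus y < 1 by apply: moebius_lt1 => //; exact: s1.
pose c := moebius (- b) (- y).
have cE x : x \in s -> modulus (moebius c x) = modulus (moebius (- y) (moebius b x)).
  by move=> /s1 x1'; exact: modulus_moebius_comp.
have lt x : x \in s -> x != a -> modulus (moebius c x) < modulus (moebius c a).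
  move=> sx xa; rewrite !cE//; apply: moebius_unique_max => //; first exact: ha.
  apply: contraNneq xa => /(congr1 (moebius (- b))).
  by rewrite /y !moebiusK ?s1// => ->.
pose be := \big[Num.max/0]_(x <- s | x != a) modulus (moebius c x).
exists a, b, c, be; split.
- by split => //; apply: moebius_lt1; rewrite modulusN.
- by rewrite -(ler_nat R); exact: hb.
- apply/andP; split; first exact: bigmax_ge_id.
  rewrite /be big_seq_cond; apply: bigmax_lt => [|x /andP[sx xa]]; last exact: lt.
  by apply: le_lt_trans (lt b sb _); rewrite ?modulus_ge0// eq_sym.
- move=> x sx xa; exact (@le_bigmax_seq _ R _ s 0 x (fun x => x != a) (fun x => modulus (moebius c x)) sx xa).
Qed.

End Center.

(** * Upper bound for the Green function *)

Section GreenUpperBound.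
Context {R : realType}.
Local Notation C := R[i].
Local Notation modulus := (@ComplexField.Normc.normc R).
Import ComplexField.Normc.

(** The majorant is [M] times the real power [k] of [modulus (f z)]; its logarithm has upper jets
    because [f] has no zero in the region. *)
Lemma log_max_principle p q (D : set 'M[C]_(p, q)) (u : 'M[C]_(p, q) -> R)
    (phi : C -> 'M[C]_(p, q)) (f : C -> C) (x0 y0 : C) (a b k M : R) (z0 : C) :
  (forall w, D w -> 0 <= u w < 1) -> psh_on D (fun w => lne (u w)%:E) ->
  (forall z, a <= modulus (z - x0) -> modulus (z - y0) <= b ->
    [/\ nbhs (phi z) D, forall i j, jet2 (fun w => phi w i j) z, jet2 f z & f z != 0]) ->
  0 <= k -> 0 < M ->
  (forall z, modulus (z - x0) = a -> modulus (z - y0) <= b ->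
    u (phi z) < M * expR (k * ln (modulus (f z)))) ->
  (forall z, a <= modulus (z - x0) -> modulus (z - y0) = b ->
    u (phi z) < M * expR (k * ln (modulus (f z)))) ->
  a <= modulus (z0 - x0) -> modulus (z0 - y0) <= b ->
  u (phi z0) <= M * expR (k * ln (modulus (f z0))).
Proof.
move=> u01 psh H k0 M0 bd1 bd2 h1 h2.
pose h z := k * ln (modulus (f z)) + ln M.
have hE z : expR (h z) = M * expR (k * ln (modulus (f z))).
  by rewrite /h expRD lnK// mulrC.
rewrite -hE.
apply: (@max_principle_curve R p q D u phi h x0 y0 a b u01 psh); last by split.
- by move=> z [/H hz /hz[]].
- by move=> z [/H hz /hz[]].
- move=> z [/H hz /hz[_ _ [c1 [c2 jf]] f0]].
  have cm : {for z, continuous (fun w => modulus (f w))}.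
    exact: (cvg_comp _ _ (taylor2_continuous jf) (@continuous_modulus R _)).
  have m0 : 0 < modulus (f z) by rewrite modulus_gt0.
  have cl : {for z, continuous (fun w => ln (modulus (f w)))}.
    exact: (cvg_comp _ _ cm (continuous_ln m0)).
  exact: (cvgD (cvgM (cvg_cst _) cl) (cvg_cst _)).
- move=> z [/H hz /hz[_ _ [c1 [c2 jf]] f0]].
  apply: upper_jetD; last exact: upper_jet_cst.
  by apply: upper_jetZ => //; exact: (upper_jet_ln jf f0).
- by move=> z [z1 z2] [e|e]; rewrite hE; [exact: bd1|exact: bd2].
Qed.

Lemma nbhs_spectral_ball n (A : 'M[C]_n) : spectral_ball n A -> nbhs A (spectral_ball n).
Proof. by move=> /open_spectral_ball[e e0 h]; apply/nbhs_mxP; exists e. Qed.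

Lemma euclidean_norm_le p q (M : 'M[C]_(p, q)) (e : R) : 0 <= e ->
  (forall i j, modulus (M i j) <= e) -> euclidean_norm M <= (p * q)%:R * e.
Proof.
move=> e0 h; rewrite /euclidean_norm.
have n2 : ((p * q)%:R : R) <= (p * q)%:R ^+ 2.
  by rewrite -natrX ler_nat; case: (p * q)%N => // m; rewrite leq_pmulr.
rewrite -(ger0_norm (mulr_ge0 (ler0n _ _) e0)) -sqrtr_sqr ler_sqrt ?sqr_ge0//.
apply: (@le_trans _ _ (\sum_(i < p) \sum_(j < q) e ^+ 2)).
  apply: ler_sum => i _; apply: ler_sum => j _.
  by rewrite ler_sqr ?nnegrE ?modulus_ge0.
rewrite !sumr_const !card_ord -mulrnA (mulnC q p) -[leLHS]mulr_natl exprMn.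
by rewrite ler_wpM2r ?sqr_ge0.
Qed.

Lemma jet2_mx_lipschitz p q (f : C -> 'M[C]_(p, q)) (z : C) :
  (forall i j, jet2 (fun w => f w i j) z) ->
  exists2 L : R, 0 < L & exists2 d : R, 0 < d &
  forall w, modulus (w - z) <= d -> euclidean_norm (f w - f z) <= L * modulus (w - z).
Proof.
move=> jf; have h (ij : 'I_p * 'I_q) : exists Ld : R * R, [/\ 0 < Ld.1, 0 < Ld.2 &
    forall w, modulus w <= Ld.2 ->
      modulus (f (z + w) ij.1 ij.2 - f z ij.1 ij.2) <= Ld.1 * modulus w].
  have [c1 [c2 j]] := jf ij.1 ij.2; have [L L0 [d d0 hd]] := taylor2_lipschitz j.
  by exists (L, d); split.
have [Ld hLd] := choice h.
pose L := 1 + \sum_ij (Ld ij).1.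
have L0 : 0 < L by rewrite ltr_wpDr// sumr_ge0// => ij _; have [/ltW] := hLd ij.
exists ((p * q).+1%:R * L); first by rewrite mulr_gt0.
pose d := \big[Num.min/1]_ij (Ld ij).2; exists d.
  by apply: lt_bigmin => // ij _; have [] := hLd ij.
move=> w hw; rewrite -mulrA.
have Lw : 0 <= L * modulus (w - z) by rewrite mulr_ge0 ?modulus_ge0// ltW.
apply: (@le_trans _ _ ((p * q)%:R * (L * modulus (w - z)))); last first.
  by rewrite ler_wpM2r// ler_nat.
apply: euclidean_norm_le => // i j; have [_ _ hd] := hLd (i, j).
apply: (@le_trans _ _ ((Ld (i, j)).1 * modulus (w - z))).
  rewrite !mxE -{1}(subrK z w) (addrC _ z); apply: hd; apply: (le_trans hw).
  exact: bigmin_le.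
rewrite ler_wpM2r ?modulus_ge0// /L (bigD1 (i, j))//= addrCA lerDl addr_ge0//.
by rewrite sumr_ge0// => ij _; have [/ltW] := hLd ij.
Qed.

(** A Schwarz lemma with pole at [T], by comparison with [M] times the power [k < 1] of
    [modulus (f z)]. Near [T] the majorant wins because [u] is at most linear in the distance to
    [A]; near the unit circle it wins because [M > 1] and [modulus (f z)] is close to 1. *)
Lemma green_disc_bound n (A : 'M[C]_n) (u : 'M[C]_n -> R) (Psi : C -> 'M[C]_n) (T q : R) :
  green_candidate (spectral_ball n) A u ->
  (forall z, modulus z < 1 -> spectral_ball n (Psi z)) ->
  (forall z, modulus z < 1 -> forall i j, jet2 (fun w => Psi w i j) z) ->
  0 < T -> Psi T%:C%C = A -> T < q -> q < 1 -> u (Psi 0) <= q.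
Proof.
move=> [u01 psh [c0 c00 hc]] inD jP T0 PT Tq q1.
have T1 : T < 1 by lra.
have mT : modulus T%:C%C = T by rewrite modulus_real gtr0_norm.
have mT1 : modulus T%:C%C < 1 by rewrite mT.
pose S := (T + q) / 2; have ST : T < S by rewrite /S; lra.
have Sq : S < q by rewrite /S; lra.
have S0 : 0 < S by lra.
have lT : ln T < 0 by rewrite ln_lt0// T0.
have lS : ln S < 0 by rewrite ln_lt0// S0/=; lra.
have lTS : ln T < ln S by rewrite ltr_ln.
(* The power [k] of [T] is [S], so the majorant has the value [M * S = q] at [0]. *)
pose k := ln S / ln T.
have k0 : 0 < k by rewrite /k -mulrNN -invrN divr_gt0// oppr_gt0.
have k1 : k < 1 by rewrite /k ltr_ndivrMr// mul1r.
have kT : k * ln T = ln S by rewrite /k divfK// lt_eqF.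
pose M := q / S; have M1 : 1 < M by rewrite /M ltr_pdivlMr// mul1r.
have M0 : 0 < M by lra.
pose f := moebius T%:C%C.
have [L L0 [d d0 lip]] := jet2_mx_lipschitz (jP _ mT1).
(* The three bounds serve, in order, the Lipschitz estimate about [T], the position of [0] outside
   the removed disc, and the comparison of [c0 * L * sg] with the power [k] of [sg / 2]. *)
pose m := Num.max (- ln d) (Num.max (- ln (T / 2)) (((ln (c0 * L) + ln 2) / (1 - k)) + 1)).
pose sg := expR (- m).
have sg0 : 0 < sg by exact: expR_gt0.
have sgd : sg <= d by rewrite -ler_ln ?posrE// /sg expRK lerNl /m le_max lexx.
have sgT : sg <= T / 2.
  by rewrite -ler_ln ?posrE ?divr_gt0// /sg expRK lerNl /m !le_max lexx orbT.
(* The first bound puts the circle beyond [T]. The second gives [1 - T * r <= M * (r - T)], where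
   [(r - T) / (1 - T * r)] is the least modulus of [f] on the circle. *)
pose r := Num.max ((1 + T) / 2) ((1 + T * M) / (M + T)).
have r1 : r < 1.
  rewrite /r gt_max; apply/andP; split; first lra.
  rewrite ltr_pdivrMr; last by lra.
  have : 0 < (1 - T) * (M - 1) by rewrite mulr_gt0// subr_gt0.
  lra.
have rT : (1 + T) / 2 <= r by rewrite /r le_max lexx.
have rM : 1 + T * M <= r * (M + T).
  by rewrite -ler_pdivrMr ?addr_gt0// /r le_max lexx orbT.
have zlt1 z : modulus z <= r -> modulus z < 1 by move=> zr; lra.
have fden z : modulus z <= r -> 1 - (T%:C%C)^*%C * z != 0.
  by move=> zr; apply: moebius_denom_neq0 => //; apply: ltW; exact: zlt1.
have main : u (Psi 0) <= M * expR (k * ln (modulus (f 0))).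
  apply: (@log_max_principle _ _ (spectral_ball n) u Psi f T%:C%C 0 sg r k M 0 u01 psh).
  - move=> z z1; rewrite subr0 => zr; split.
    + by apply: nbhs_spectral_ball; apply: inD; exact: zlt1.
    + by apply: jP; exact: zlt1.
    + apply: jet2_div; last exact: fden.
        exact: (jet2B (jet2_id _) (jet2_cst _ _)).
      exact: (jet2B (jet2_cst _ _) (jet2M (jet2_cst _ _) (jet2_id _))).
    + rewrite /f /moebius mulf_neq0 ?invr_eq0 ?fden//.
      by rewrite -modulus_gt0; exact: lt_le_trans z1.
  - exact: ltW.
  - exact: M0.
  - move=> z ze; rewrite subr0 => zr.
    have b1 : u (Psi z) <= c0 * (L * sg).
      apply: (le_trans (hc _ (inD _ (zlt1 _ zr)))); rewrite ler_pM2l//.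
      by rewrite -PT -ze; apply: lip; rewrite ze.
    apply: (le_lt_trans b1).
    have fz : sg / 2 <= modulus (f z).
      rewrite /f modulus_div ze ler_pM2l// lef_pV2 ?posrE ?modulus_gt0 ?fden//.
      apply: (le_trans (modulus_leB _ _)); rewrite normc1 normcM modulus_conj mT.
      have : T * modulus z <= 1 * 1 by apply: ler_pM; rewrite ?modulus_ge0//; lra.
      lra.
    have f0 : 0 < modulus (f z) by apply: lt_le_trans fz; rewrite divr_gt0.
    have lnf : k * ln (sg / 2) <= k * ln (modulus (f z)).
      by rewrite ler_pM2l// ler_ln ?posrE// divr_gt0.
    have e : expR (k * ln (sg / 2)) <= M * expR (k * ln (modulus (f z))).
      apply: (@le_trans _ _ (expR (k * ln (modulus (f z))))); first by rewrite ler_expR.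
      by rewrite ler_peMl ?expR_ge0// ltW.
    apply: lt_le_trans e; rewrite mulrA -(@lnK _ (c0 * L * sg)); last first.
      by rewrite posrE !mulr_gt0.
    rewrite ltr_expR lnM ?posrE// ?mulr_gt0// ln_div ?posrE// /sg expRK.
    have hm : (ln (c0 * L) + ln 2) / (1 - k) + 1 <= m by rewrite /m !le_max lexx !orbT.
    have : ln (c0 * L) + ln 2 < m * (1 - k).
      rewrite -ltr_pdivrMr ?subr_gt0//; lra.
    have ln20 : 0 <= ln 2 :> R by rewrite ln_ge0// ler1n.
    have : k * ln 2 <= ln 2 :> R by rewrite ler_piMl// ltW.
    lra.
  - move=> z _; rewrite subr0 => zr.
    have zr' : modulus z <= r by rewrite zr.
    have /andP[_ uz1] := u01 _ (inD _ (zlt1 _ zr')).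
    apply: (lt_le_trans uz1).
    have fz1 : modulus (f z) < 1 by apply: moebius_lt1 => //; exact: zlt1.
    have zT : 0 < modulus (z - T%:C%C) by have := modulus_lerB z T%:C%C; rewrite zr mT; lra.
    have f0 : 0 < modulus (f z).
      by rewrite /f modulus_div divr_gt0// modulus_gt0 fden.
    have Mf : 1 <= M * modulus (f z).
      have d2 : 0 < modulus (1 - (T%:C%C)^*%C * z) by rewrite modulus_gt0 fden.
      rewrite /f modulus_div mulrA ler_pdivlMr// mul1r.
      rewrite -ler_sqr ?nnegrE ?(mulr_ge0 (ltW M0)) ?modulus_ge0//.
      have id := moebius_identity T%:C%C z; rewrite mT zr in id.
      have lo : r - T <= modulus (z - T%:C%C) by have := modulus_lerB z T%:C%C; rewrite zr mT.
      have e1 : 1 - T * r <= M * (r - T) by lra.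
      have e2 : (1 - T * r) ^+ 2 <= (M * (r - T)) ^+ 2.
        rewrite ler_sqr ?nnegrE//.
          by rewrite subr_ge0 mulr_ile1//; lra.
        by apply: mulr_ge0; lra.
      have e3 : (M ^+ 2 - 1) * (r - T) ^+ 2 <= (M ^+ 2 - 1) * modulus (z - T%:C%C) ^+ 2.
        apply: ler_wpM2l; first by rewrite subr_ge0 exprn_ege1// ltW.
        by rewrite ler_sqr ?nnegrE ?modulus_ge0//; lra.
      rewrite exprMn; rewrite exprMn in e2; move: id e2 e3.
      move: (modulus (1 - _) ^+ 2) (modulus (z - _) ^+ 2) (M ^+ 2) => X Y N id e2 e3.
      have e4 : (1 - T * r) ^+ 2 = (r - T) ^+ 2 + (1 - T ^+ 2) * (1 - r ^+ 2) by ring.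
      lra.
    apply: (le_trans Mf); rewrite ler_pM2l// -[leLHS]lnK// ler_expR.
    have : ln (modulus (f z)) < 0 by rewrite ln_lt0// f0.
    move=> l0; have : 0 <= (1 - k) * - ln (modulus (f z)).
      by rewrite mulr_ge0 ?subr_ge0 ?oppr_ge0 ?ltW.
    lra.
  - by rewrite sub0r modulusN mT; lra.
  - by rewrite subr0 normc0; lra.
apply: (le_trans main).
have -> : modulus (f 0) = T by rewrite /f /moebius sub0r mulr0 subr0 divr1 modulusN.
by rewrite kT lnK// /M divfK// gt_eqF.
Qed.

End GreenUpperBound.

Section HolomorphicDisc.
Context {R : realType}.
Local Notation C := R[i].
Local Notation modulus := (@ComplexField.Normc.normc R).
Import ComplexField.Normc.

(** Near [s = 1] upper semicontinuity gives [u < m]; on a large circle a small positive multiple of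
    the logarithm of the distance to [1] absorbs the bound [u < 1]. The maximum principle on the
    annulus between them controls the value at [s = 0]. *)
Lemma log_psh_liouville p q (D : set 'M[C]_(p, q)) (u : 'M[C]_(p, q) -> R)
    (X Y : 'M[C]_(p, q)) :
  (forall M, D M -> nbhs M D) ->
  (forall w, D w -> 0 <= u w < 1) -> psh_on D (fun w => lne (u w)%:E) ->
  (forall s : C, D (X + s *: Y)) -> u X <= u (X + Y).
Proof.
move=> oD u01 psh inD; pose phi (s : C) := X + s *: Y.
have X0 : X = phi 0 by rewrite /phi scale0r addr0.
have X1 : X + Y = phi 1 by rewrite /phi scale1r.
have j s i j : jet2 (fun w => phi w i j) s.
  have -> : (fun w => phi w i j) = (fun w => X i j + w * Y i j).
    by apply/funext => w; rewrite !mxE.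
  exact: (jet2D (jet2_cst _ _) (jet2M (jet2_id _) (jet2_cst _ _))).
rewrite X1; apply/ler_addgt0Pr => e e0.
have [//|ue1] := leP (u X) (u (phi 1) + e).
have /andP[u10 u11] := u01 _ (inD 1).
pose m := u (phi 1) + e / 2; pose m' := u (phi 1) + e.
have m0 : 0 < m by rewrite /m; lra.
have mm' : m < m' by rewrite /m /m'; lra.
have m'1 : m' < 1.
  by have := u01 _ (inD 0); rewrite -/(phi 0) -X0 => /andP[_ h]; rewrite /m'; lra.
have [dl [dl0 dl1 hdl]] : exists dl : R, [/\ 0 < dl, dl < 1 &
    forall s, modulus (s - 1) <= dl -> u (phi s) < m].
  have [_ usc _] := psh.
  have /(usc _ (inD 1)) hu : (lne (u (phi 1))%:E < (ln m)%:E)%E by rewrite lne_ltE// /m; lra.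
  have cphi : {for 1, continuous phi}.
    by apply: continuous_mx => i j'; have [c1 [c2 h]] := j 1 i j'; exact: taylor2_continuous h.
  have /nbhs_complexP[d d0 hd] : nbhs (1 : C) (fun s => D (phi s) -> (lne (u (phi s))%:E < (ln m)%:E)%E).
    exact: (cphi _ hu).
  exists (Num.min (d / 2) (1 / 2)); split.
  - by rewrite lt_min !divr_gt0.
  - rewrite gt_min; apply/orP; right; lra.
  move=> s; rewrite le_min => /andP[s1 _].
  have /hd/(_ (inD s)) : modulus (s - 1) < d by lra.
  by have /andP[us0 _] := u01 _ (inD s); rewrite lne_ltE.
have ld : 0 < - ln dl by rewrite oppr_gt0 ln_lt0// dl0.
(* With this [k] the majorant has the value [m'] at [0], which is at distance 1 from the centre. *)
pose k := (ln m' - ln m) / - ln dl.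
have k0 : 0 < k by rewrite divr_gt0// subr_gt0 ltr_ln ?posrE//; lra.
have kd : k * ln dl = ln m - ln m' by rewrite /k invrN mulrN mulNr divfK ?opprB// lt_eqF// -oppr_gt0.
(* Large enough for the majorant to be at least 1 on the outer circle; the summand 2 keeps [0]
   inside. *)
pose Rb := 2 + expR (- ln m / k).
have Rb2 : 2 < Rb by rewrite /Rb ltrDl expR_gt0.
have lnm : ln m < 0 by rewrite ln_lt0// m0/=; lra.
have kR : - ln m <= k * ln Rb.
  rewrite mulrC -ler_pdivrMr// -[leLHS]expRK ler_ln ?posrE ?expR_gt0//; last by lra.
  by rewrite /Rb lerDr.
pose f (s : C) : C := (s - 1) / dl%:C%C.
have mf s : modulus (f s) = modulus (s - 1) / dl.
  by rewrite /f modulus_div modulus_real gtr0_norm.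
have dl' : dl%:C%C != 0 :> C by rewrite -modulus_gt0 modulus_real gtr0_norm.
have H01 : modulus (0 - 1 : C) = 1 by rewrite sub0r modulusN normc1.
have : u (phi 0) <= m * expR (k * ln (modulus (f 0))).
  apply: (@log_max_principle R p q D u phi f 1 1 dl Rb k m 0 u01 psh).
  - move=> z z1 _; split; [exact/oD/inD|exact: j| |].
      exact: (jet2M (jet2B (jet2_id _) (jet2_cst _ _)) (jet2_cst _ _)).
    by rewrite mulf_neq0 ?invr_eq0// -modulus_gt0; exact: lt_le_trans z1.
  - exact: ltW.
  - exact: m0.
  - move=> z ze _; rewrite mf ze divff ?gt_eqF// ln1 mulr0 expR0 mulr1.
    by apply: hdl; rewrite ze.
  - move=> z _ ze; have /andP[_ uz] := u01 _ (inD z); apply: (lt_le_trans uz).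
    rewrite mf ze ln_div ?posrE//; last by lra.
    rewrite -{1}(lnK m0) -expRD -[leLHS]expR0 ler_expR.
    have : 0 <= k * - ln dl by rewrite mulr_ge0// ltW.
    lra.
  - by rewrite H01 ltW.
  - by rewrite H01; lra.
rewrite mf H01 div1r lnV ?posrE// mulrN kd opprB -{1}(lnK m0) -expRD addrC subrK lnK ?posrE; last by lra.
by move=> h; move: ue1; rewrite X0 => /(le_lt_trans h); rewrite ltxx.
Qed.

(** [B - c%:M] has no eigenvalue other than [0], and neither have its multiples. *)
Lemma spectral_ball_pencil n (B : 'M[C]_n) (c s : C) :
  modulus c < 1 -> char_poly B = ('X - c%:P) ^+ n ->
  spectral_ball n (c%:M + s *: (B - c%:M)).
Proof.
move=> c1 hB; apply/spectral_ballP => x /eigenvalueP[v hv v0].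
have eB y : eigenvalue B y -> y = c.
  rewrite eigenvalue_root_char hB rootE horner_exp hornerXsubC.
  by rewrite expf_eq0 => /andP[_]; rewrite subr_eq0 => /eqP.
suff -> : x = c by [].
have hv' : s *: (v *m (B - c%:M)) = (x - c) *: v.
  by rewrite scalerBl -hv (mulmxDr v c%:M) mul_mx_scalar -scalemxAr addrAC subrr add0r.
have [s0|s0] := eqVneq s 0.
  move/eqP: hv'; rewrite s0 scale0r eq_sym scaler_eq0 (negbTE v0) orbF subr_eq0.
  by move/eqP.
have : eigenvalue B (c + (x - c) / s).
  apply/eigenvalueP; exists v => //.
  have -> : v *m B = v *m (B - c%:M) + c *: v by rewrite mulmxBr mul_mx_scalar subrK.
  by rewrite -[v *m (B - _)](scalerK s0) hv' scalerA addrC -scalerDl (mulrC s^-1).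
move=> /eB /eqP; rewrite -subr_eq0 addrAC subrr add0r mulf_eq0 invr_eq0 (negbTE s0) orbF.
by rewrite subr_eq0 => /eqP.
Qed.

Lemma deformation_matrix n' (P : 'M[C]_n'.+1) (c : C) (G : C -> {poly C}) :
  P \in unitmx -> deformation c n'.+1 G ->
  exists Psi : C -> 'M[C]_n'.+1,
  [/\ forall z, Psi z = P *m companion n'.+1 (fun i => (G z)`_i) *m invmx P,
      forall z, modulus z < 1 -> char_poly (Psi z) = G z,
      forall z, modulus z < 1 -> spectral_ball n'.+1 (Psi z) &
      forall z, modulus z < 1 -> forall i j, jet2 (fun w => Psi w i j) z].
Proof.
move=> uP [g1 g2 g3].
pose Psi (z : C) := P *m companion n'.+1 (fun i => (G z)`_i) *m invmx P.
have cp z : modulus z < 1 -> char_poly (Psi z) = G z.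
  move=> /g1[s [s1 s2 s3]]; rewrite /Psi char_poly_conj// char_poly_companion//.
    by rewrite s3 monic_prod_XsubC.
  by rewrite s3 size_prod_XsubC s1.
exists Psi; split => //.
  move=> z z1; have [s [s1 s2 s3]] := g1 z z1; apply/spectral_ballP => x.
  have h : char_poly (Psi z) = \prod_(x <- s) ('X - x%:P) by rewrite cp.
  by rewrite (eigenvalue_char_poly _ h); exact: s2.
move=> z z1 i j; rewrite /Psi.
have -> : (fun w => (P *m companion n'.+1 (fun i => (G w)`_i) *m invmx P) i j) =
    (fun w => \sum_k (\sum_l P i l * companion n'.+1 (fun i => (G w)`_i) l k) * invmx P k j).
  by apply/funext => w; rewrite mxE; apply: eq_bigr => k _; rewrite mxE.
apply: jet2_sum => k _; apply: (fun h => jet2M h (jet2_cst _ _)).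
apply: jet2_sum => l _; apply: (jet2M (jet2_cst _ _)).
have -> : (fun w => companion n'.+1 (fun i => (G w)`_i) l k) =
    (fun w => if k == n'.+1.-1 :> nat then - (G w)`_l else (k.+1 == l :> nat)%:R).
  by apply/funext => w; rewrite mxE.
case: (k == n'.+1.-1 :> nat); [apply: jet2N; exact: g2|exact: jet2_cst].
Qed.

End HolomorphicDisc.

(** * Comparison of the two bounds *)

Section Bounds.
Context {R : realType}.
Local Notation C := R[i].
Local Notation modulus := (@ComplexField.Normc.normc R).
Import ComplexField.Normc.

(** The witness is the least [T] allowed by the last inequality. Clearing the denominator turns its
    comparison with [be], [al ^+ 2] and [al] into the positivity of a product of positive
    factors. *)
Lemma interpolation_parameter (al be : R) : 0 <= be -> be < al -> al < 1 ->
  exists T : R, [/\ be < T, al ^+ 2 < T, 0 < T, T < al &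
    al + be - 2 * al * be <= T * (2 - al - be)].
Proof.
move=> be0 bal al1; have d : 0 < 2 - al - be by lra.
have al0 : 0 < al by lra.
exists ((al + be - 2 * al * be) / (2 - al - be)).
have aT : al ^+ 2 < (al + be - 2 * al * be) / (2 - al - be).
  rewrite ltr_pdivlMr// -subr_gt0.
  have -> : al + be - 2 * al * be - al ^+ 2 * (2 - al - be) = (1 - al) ^+ 2 * (al + be) by ring.
  by rewrite mulr_gt0 ?exprn_gt0//; lra.
split.
- rewrite ltr_pdivlMr// -subr_gt0.
  have -> : al + be - 2 * al * be - be * (2 - al - be) = (al - be) * (1 - be) by ring.
  by rewrite mulr_gt0//; lra.
- exact: aT.
- by apply: lt_trans aT; exact: exprn_gt0.
- rewrite ltr_pdivrMr// -subr_gt0.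
  have -> : al * (2 - al - be) - (al + be - 2 * al * be) = (al - be) * (1 - al) by ring.
  by rewrite mulr_gt0//; lra.
by rewrite divfK// gt_eqF.
Qed.

Lemma green_lt_lempert n' (A : 'M[C]_n'.+1) (x0 x1 : C) :
  spectral_ball n'.+1 A -> cyclic_mx A ->
  eigenvalue A x0 -> eigenvalue A x1 -> x0 != x1 ->
  exists c : C, spectral_ball n'.+1 c%:M /\
    (green (spectral_ball n'.+1) A c%:M < lempert (spectral_ball n'.+1) A c%:M)%E.
Proof.
move=> hA [v hv] e0 e1 x01; have [s hs] := char_poly_roots A.
have eE := eigenvalue_char_poly _ hs.
have s1 x : x \in s -> modulus x < 1.
  by move=> sx; move/spectral_ballP: hA; apply; rewrite eE.
rewrite eE in e0; rewrite eE in e1.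
have [a [b [c [be [[sa ab c1] hcount /andP[be0 bal] hbe]]]]] := center_exists s1 e0 e1 x01.
set al := modulus (moebius c a) in bal.
have al1 : al < 1 by apply: moebius_lt1 => //; exact: s1.
have [T [bT aT T0 Tal hT]] := interpolation_parameter be0 bal al1.
have T1 : T < 1 by lra.
have sz : size s = n'.+1.
  by have := size_char_poly A; rewrite hs size_prod_XsubC => -[].
have [G dG GT] := deformation_exists c1 s1 ab hbe (lexx al) hcount bT aT (ltW bal) T1 al1 hT.
rewrite sz in dG.
have [P uP AE] := cyclic_companion hv.
have [Psi [PsiE cP inD jP]] := deformation_matrix uP dG.
have PT : Psi T%:C%C = A by rewrite PsiE GT -hs -AE.
have c0 : modulus (0 : C) < 1 by rewrite normc0.
have P0 : char_poly (Psi 0) = ('X - c%:P) ^+ n'.+1 by rewrite (cP 0 c0); have [_ _ ->] := dG.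
have pencil t := spectral_ball_pencil t c1 P0.
exists c; split; first by have := pencil 0; rewrite scale0r addr0.
(* The Green estimate holds for every [q > T]; taking [q] below [al] separates the two functions. *)
pose q := (T + al) / 2.
have Tq : T < q by rewrite /q; lra.
have qal : q < al by rewrite /q; lra.
have up : (green (spectral_ball n'.+1) A c%:M <= q%:E)%E.
  apply: ge_ereal_sup => _ [u hu <-]; rewrite lee_fin.
  have q1 : q < 1 by lra.
  have b0 := green_disc_bound hu inD jP T0 PT Tq q1.
  have [u01 psh _] := hu.
  have := log_psh_liouville (@nbhs_spectral_ball _ _) u01 psh pencil.
  by rewrite (addrC c%:M) subrK => /le_trans; apply.
have low : (al%:E <= lempert (spectral_ball n'.+1) A c%:M)%E.
  apply: le_ereal_inf_tmp => _ [z [z1 [phi [[phi1 phi2] phi0 phiz]]] <-]; rewrite lee_fin.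
  exact: (moebius_lower_bound c1 z1 phi1 phi2 phiz phi0 hs sa be0 bal hbe).
by apply: (le_lt_trans up); apply: lt_le_trans low; rewrite lte_fin.
Qed.

End Bounds.

Theorem proposition6p2 (R : realType) (n : nat) (A : 'M[R[i]]_n)
  (hA : spectral_ball n A) (hcyc : cyclic_mx A)
  (heig : exists a b : R[i], [/\ eigenvalue A a, eigenvalue A b & a <> b]) :
  exists B : 'M[R[i]]_n,
    spectral_ball n B /\
    (green (spectral_ball n) A B < lempert (spectral_ball n) A B)%E.
Proof.
have [a [b [ea eb /eqP ab]]] := heig.
case: n A hA hcyc ea eb {heig} => [|n'] A hA hcyc ea eb.
  (* In size 0 every vector is zero, so there is no eigenvector. *)
  by have [v _] := eigenvalueP ea; rewrite thinmx0 eqxx.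
have [c [hc h]] := green_lt_lempert hA hcyc ea eb ab.
by exists c%:M.
Qed.
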